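(* Let $C>0$ denote a generic constant independent of $h$, $\Delta t$, $\gamma$ and $\mu$ (possibly different at each occurrence), let $$D_\infty:=\max_{1\le j\le J,\;1\le n\le M}\|\nabla\cdot\hat{\boldsymbol u}_{j,h}^{\prime n}\|_{L^\infty},\qquad \zeta:=\frac{\alpha_{\min}}{2}-\frac{C}{\mu\Delta t}-\frac{C}{\alpha_{\min}}D_\infty^2 .$$ Assume $\boldsymbol f_j\in L^2(0,T;\boldsymbol H^{-1}(\mathcal D))$, $\hat{\boldsymbol u}_{j,h}^0,\hat{\boldsymbol u}_{j,h}^1\in \boldsymbol H^1(\mathcal D)$, $\zeta>0$ and $\alpha_{\min}>CD_\infty$. Choose $$\mu>\frac{C\alpha_{\min}}{\Delta t\,(\alpha_{\min}^2-CD_\infty^2)} .$$ Then, for all $\Delta t>0$, the solutions of the BDF-2-EEV-SPP scheme (described in the context) are stable: for every $j=1,\dots,J$, $$\|\hat{\boldsymbol u}_{j,h}^{M}\|^2+\zeta\Delta t\sum_{n=1}^{M}\|\nabla\hat{\boldsymbol u}_{j,h}^{n}\|^2+\Delta t\,\gamma\sum_{n=2}^{M}\|\nabla\cdot\hat{\boldsymbol u}_{j,h}^{n}\|^2\le 6\|\hat{\boldsymbol u}_{j,h}^{1}\|^2+2\|\hat{\boldsymbol u}_{j,h}^{0}\|^2+2\bar\nu_{\min}\Delta t\left(\|\nabla\hat{\boldsymbol u}_{j,h}^{0}\|^2+\|\nabla\hat{\boldsymbol u}_{j,h}^{1}\|^2\right)+\frac{4\Delta t}{\alpha_{\min}}\sum_{n=2}^{M}\|\boldsymbol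 f_j(t_n)\|_{-1}^2 .$$
   Context: Setting. $\mathcal D\subset\mathbb R^d$, $d\in\{2,3\}$, is a convex polygonal or polyhedral domain with outward unit normal $\hat{\boldsymbol n}$; $\|\cdot\|$ and $(\cdot,\cdot)$ are the $L^2(\mathcal D)$ norm and inner product, $\|\cdot\|_{-1}$ is the norm of $\boldsymbol H^{-1}(\mathcal D)$ (dual of $\boldsymbol H^1_0(\mathcal D)$ with respect to $\|\nabla\cdot\|$), $\|\cdot\|_\infty$ is the $L^\infty(\mathcal D)$ norm. Spaces: $\boldsymbol X=\boldsymbol H_0^1(\mathcal D)$, $\boldsymbol Y=\{\boldsymbol v\in\boldsymbol H^1(\mathcal D):\boldsymbol v\cdot\hat{\boldsymbol n}|_{\partial\mathcal D}=0\}$, $Q=L^2_0(\mathcal D)$ (mean-zero functions). Skew-symmetric form: $b^*(\boldsymbol u,\boldsymbol v,\boldsymbol w)=\frac12(\boldsymbol u\cdot\nabla\boldsymbol v,\boldsymbol w)-\frac12(\boldsymbol u\cdot\nabla\boldsymbol w,\boldsymbol v)$. Finite element spaces $\boldsymbol X_h\subset\boldsymbol X$, $\boldsymbol Y_h\subset\boldsymbol Y$, $Q_h\subset Q$ (with $\boldsymbol X_h\subset\boldsymbol Y_h$) are conforming, on a shape-regular quasi-uniform mesh family with maximal diameter $h$; $(\boldsymbol X_h,Q_h)$ satisfies the discrete inf-sup condition $\inf_{q_h\in Q_h}\sup_{\boldsymbol v_h\in\boldsymbol X_h}\frac{(q_h,\nabla\cdot\boldsymbol v_h)}{\|q_h\|\|\nabla\boldsymbol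 v_h\|}\ge\beta>0$ with $\beta$ independent of $h$. $\boldsymbol V_h=\{\boldsymbol v_h\in\boldsymbol X_h:(\nabla\cdot\boldsymbol v_h,q_h)=0\ \forall q_h\in Q_h\}$. Data: $J$ realizations $j=1,\dots,J$; viscosities $\nu_j\in L^\infty(\mathcal D)$ with $\nu_j(\boldsymbol x)\ge\nu_{j,\min}>0$; body forces $\boldsymbol f_j$; $\bar\nu=\frac1J\sum_j\nu_j$, $\nu_j'=\nu_j-\bar\nu$, $\bar\nu_{\min}=\min_{\boldsymbol x\in\mathcal D}\bar\nu(\boldsymbol x)$, $\alpha_j:=\bar\nu_{\min}-3\|\nu_j'\|_\infty$, assumed $>0$ for all $j$, and $\alpha_{\min}=\min_j\alpha_j$. Time step $\Delta t>0$, $t_n=n\Delta t$, $M=T/\Delta t$. Parameters: grad-div parameter $\gamma>0$, eddy viscosity parameter $\mu>0$. BDF-2-EEV-SPP scheme: given initial conditions $\boldsymbol u_j^0,\boldsymbol u_j^1\in\boldsymbol L^2(\mathcal D)$, put $\hat{\boldsymbol u}_{j,h}^i=\tilde{\boldsymbol u}_{j,h}^i=\boldsymbol u_{j,h}^i$, the $L^2$-projection of $\boldsymbol u_j^i$ onto $\boldsymbol V_h$, $i=0,1$. For $n\geq 1$ put $$\langle\hat{\boldsymbol u}_h\rangle^n=\frac1J\sum_{j=1}^J(2\hat{\boldsymbol u}_{j,h}^n-\hat{\boldsymbol u}_{j,h}^{n-1}),\quad \hat{\boldsymbol u}_{j,h}^{\prime n}=2\hat{\boldsymbol u}_{j,h}^n-\hat{\boldsymbol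 u}_{j,h}^{n-1}-\langle\hat{\boldsymbol u}_h\rangle^n,\quad \nu_T(\hat u_h',t_n)=\mu\Delta t\sum_{j=1}^J|\hat{\boldsymbol u}_{j,h}^{\prime n}|^2$$ ($|\cdot|$ is the Euclidean norm). For $n=1,\dots,M-1$ and every $j$: Step 1: find $\hat{\boldsymbol u}_{j,h}^{n+1}\in\boldsymbol X_h$ such that for all $\boldsymbol\chi_h\in\boldsymbol X_h$ $$\tfrac{1}{2\Delta t}(3\hat{\boldsymbol u}_{j,h}^{n+1}-4\tilde{\boldsymbol u}_{j,h}^{n}+\tilde{\boldsymbol u}_{j,h}^{n-1},\boldsymbol\chi_h)+b^*(\langle\hat{\boldsymbol u}_h\rangle^n,\hat{\boldsymbol u}_{j,h}^{n+1},\boldsymbol\chi_h)+(\bar\nu\nabla\hat{\boldsymbol u}_{j,h}^{n+1},\nabla\boldsymbol\chi_h)+\gamma(\nabla\cdot\hat{\boldsymbol u}_{j,h}^{n+1},\nabla\cdot\boldsymbol\chi_h)+(\nu_T(\hat u_h',t_n)\nabla\hat{\boldsymbol u}_{j,h}^{n+1},\nabla\boldsymbol\chi_h)$$ $$=(\boldsymbol f_j(t_{n+1}),\boldsymbol\chi_h)-b^*(\hat{\boldsymbol u}_{j,h}^{\prime n},2\hat{\boldsymbol u}_{j,h}^n-\hat{\boldsymbol u}_{j,h}^{n-1},\boldsymbol\chi_h)-(\nu_j'\nabla(2\hat{\boldsymbol u}_{j,h}^n-\hat{\boldsymbol u}_{j,h}^{n-1}),\nabla\boldsymbol\chi_h).$$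 Step 2: find $(\tilde{\boldsymbol u}_{j,h}^{n+1},\hat p_{j,h}^{n+1})\in\boldsymbol Y_h\times Q_h$ such that for all $(\boldsymbol v_h,q_h)\in\boldsymbol Y_h\times Q_h$ $$\tfrac{3}{2\Delta t}(\tilde{\boldsymbol u}_{j,h}^{n+1}-\hat{\boldsymbol u}_{j,h}^{n+1},\boldsymbol v_h)-(\hat p_{j,h}^{n+1},\nabla\cdot\boldsymbol v_h)=0,\qquad(\nabla\cdot\tilde{\boldsymbol u}_{j,h}^{n+1},q_h)=0.$$ *)

(* Defs.v *)
From HB Require Import structures.
From mathcomp Require Import all_boot all_order all_algebra.
From mathcomp Require Import all_classical all_reals all_analysis ess_sup_inf.
Set Implicit Arguments. Unset Strict Implicit. Unset Printing Implicit Defensive.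
Import Order.TTheory GRing.Theory Num.Theory.
Import numFieldNormedType.Exports.
Local Open Scope classical_set_scope.
Local Open Scope ring_scope.

Fact rV_display : measure_display. Proof. exact: default_measure_display. Qed.

Section rV_measurable.
Context {R : realType} (d : nat).
Let coord (i : 'I_d) (x : 'rV[R]_d) : measurableTypeR R := x ord0 i.

Let rV_set0 : g_sigma_preimage coord set0.
Proof. exact: sigma_algebra0. Qed.

Let rV_setC A : g_sigma_preimage coord A -> g_sigma_preimage coord (~` A).
Proof. exact: sigma_algebraC. Qed.

Let rV_bigcup (F : _^nat) : (forall i, g_sigma_preimage coord (F i)) ->
  g_sigma_preimage coord (\bigcup_i (F i)).
Proof. exact: sigma_algebra_bigcup. Qed.

HB.instance Definition _ := @isMeasurable.Build rV_display 'rV[R]_d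
  (g_sigma_preimage coord) rV_set0 rV_setC rV_bigcup.

Lemma measurable_coord (i : 'I_d) :
  measurable_fun [set: 'rV[R]_d] (fun x => x ord0 i : measurableTypeR R).
Proof.
move=> _ Y mY; rewrite setTI; apply: sub_sigma_algebra => /=.
rewrite -bigcup_seq/=; exists i => /=; first by rewrite mem_index_enum.
by exists Y => //; rewrite setTI.
Qed.

Lemma measurable_fun_rV d0 (T : measurableType d0) (f : T -> 'rV[R]_d) :
  (forall i, measurable_fun [set: T] (fun t => f t ord0 i : measurableTypeR R)) ->
  measurable_fun [set: T] f.
Proof.
move=> mf.
suff : g_sigma_preimage (fun i => coord i \o f) `<=` measurable.
  rewrite g_sigma_preimage_comp => prefS _ A mA.
  by rewrite setTI; apply: prefS; exists A => //; rewrite setTI.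
apply: smallest_sub; first exact: sigma_algebra_measurable.
rewrite -bigcup_seq; apply: bigcup_sub => i _ A [B mB <-].
exact: mf.
Qed.

End rV_measurable.

(* The corresponding library instance is shadowed by the one for finite
   measures, hence the restatement. *)
Lemma product_sigma_finite d1 d2 (T1 : measurableType d1)
    (T2 : measurableType d2) (R : realType)
    (m1 : {sigma_finite_measure set T1 -> \bar R})
    (m2 : {sigma_finite_measure set T2 -> \bar R}) :
  sigma_finite setT (m1 \x m2)%E.
Proof.
have /sigma_finiteP[F [TF ndF Foo]] := sigma_finiteT m1.
have /sigma_finiteP[G [TG ndG Goo]] := sigma_finiteT m2.
exists (fun n => F n `*` G n).
  rewrite -setXTT TF TG predeqE => -[x y]; split.
    move=> [/= [n _ Fnx] [k _ Gky]]; exists (maxn n k) => //; split.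
    - by move: x Fnx; exact/subsetPset/ndF/leq_maxl.
    - by move: y Gky; exact/subsetPset/ndG/leq_maxr.
  by move=> [n _ []/= ? ?]; split; exists n.
move=> k; have [? ?] := Foo k; have [? ?] := Goo k.
split; first exact: measurableX.
by rewrite product_measure1E// lte_mul_pinfty// ge0_fin_numE.
Qed.

Section lebesgue_rV.
Context {R : realType}.

Definition consrV d (p : measurableTypeR R * 'rV[R]_d) : 'rV[R]_d.+1 :=
  \row_i oapp (p.2 ord0) p.1 (unlift ord0 i).

Definition unconsrV d (x : 'rV[R]_d.+1) : measurableTypeR R * 'rV[R]_d :=
  (x ord0 ord0, \row_i x ord0 (lift ord0 i)).

Lemma consrVK d : cancel (@consrV d) (@unconsrV d).
Proof.
move=> [a x]; congr pair; rewrite ?mxE ?unlift_none//.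
by apply/rowP => i; rewrite !mxE liftK.
Qed.

Lemma measurable_consrV d : measurable_fun setT (@consrV d).
Proof.
apply: measurable_fun_rV => i; case: (unliftP ord0 i) => [j|] ->.
  rewrite (_ : (fun _ => _) =
     (fun x : 'rV[R]_d => x ord0 j : measurableTypeR R) \o snd).
    by apply: measurableT_comp => //; exact: measurable_coord.
  by apply/funext => p; rewrite mxE liftK.
rewrite (_ : (fun _ => _) = fst)//.
by apply/funext => p; rewrite mxE unlift_none.
Qed.

Lemma measurable_unconsrV d : measurable_fun setT (@unconsrV d).
Proof.
apply/measurable_fun_pairP; split; first exact: measurable_coord.
apply: measurable_fun_rV => i.
rewrite (_ : (fun _ => _) =
  fun x : 'rV[R]_d.+1 => x ord0 (lift ord0 i) : measurableTypeR R).
  exact: measurable_coord.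
by apply/funext => x; rewrite /= mxE.
Qed.

Section step.
Variables (d : nat) (m : {sigma_finite_measure set 'rV[R]_d -> \bar R}).

Definition consrV_measure : set 'rV[R]_d.+1 -> \bar R :=
  pushforward (@lebesgue_measure R \x m)%E (@consrV d).

Let consrV_measure0 : consrV_measure set0 = 0%E.
Proof. by rewrite /consrV_measure /pushforward preimage_set0 measure0. Qed.

Let consrV_measure_ge0 A : (0 <= consrV_measure A)%E.
Proof. by rewrite /consrV_measure /pushforward measure_ge0. Qed.

Let mpre A : measurable A -> measurable (@consrV d @^-1` A).
Proof. by move=> mA; rewrite -[X in measurable X]setTI; exact: measurable_consrV. Qed.

Let consrV_measure_sigma_additive : semi_sigma_additive consrV_measure.
Proof.
move=> F mF tF mUF; rewrite /consrV_measure /pushforward preimage_bigcup.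
apply: measure_semi_sigma_additive.
- by move=> n; exact: mpre.
- apply/trivIsetP => /= i j _ _ ij; rewrite -preimage_setI.
  by move/trivIsetP : tF => /(_ _ _ _ _ ij) ->//; rewrite preimage_set0.
- by rewrite -preimage_bigcup; exact: mpre.
Qed.

HB.instance Definition _ := isMeasure.Build _ _ _ consrV_measure
  consrV_measure0 consrV_measure_ge0 consrV_measure_sigma_additive.

Let consrV_measure_sigma_finite : sigma_finite setT consrV_measure.
Proof.
have [F TF mF] := product_sigma_finite (@lebesgue_measure R) m.
exists (fun k => @unconsrV d @^-1` F k).
  by rewrite -preimage_bigcup -TF preimage_setT.
move=> k; have [mFk Fk] := mF k; split.
  by rewrite -[X in measurable X]setTI; exact: measurable_unconsrV.
rewrite /consrV_measure /pushforward -comp_preimage.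
rewrite (_ : _ \o _ = id) ?preimage_id//.
by apply/funext => x; exact: consrVK.
Qed.

HB.instance Definition _ := Measure_isSigmaFinite.Build _ _ _ consrV_measure
  consrV_measure_sigma_finite.
End step.

Fixpoint leb (d : nat) : {sigma_finite_measure set 'rV[R]_d -> \bar R} :=
  if d is d'.+1 then consrV_measure (leb d') else \d_(0 : 'rV[R]_0).
End lebesgue_rV.

Section sobolev.
Context {R : realType} {d : nat}.
Local Notation E := 'rV[R]_d.
Local Notation functional := ((E -> E) -> R).

Definition ebase (i : 'I_d) : E := delta_mx ord0 i.

Definition C1 (phi : E -> R) :=
  continuous phi /\
  forall i, (forall x, derivable phi x (ebase i)) /\
            continuous ('D_(ebase i) phi).

(* C^1_0(D): weak derivatives and H^1_0 are defined with C^1 test functions, as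
   in Gilbarg and Trudinger, sections 7.3 and 7.5. *)
Definition C1c (D : set E) (phi : E -> R) :=
  [/\ C1 phi, compact (closure [set x | phi x != 0]) &
      closure [set x | phi x != 0] `<=` D].

Definition L2 (D : set E) (u : E -> R) :=
  measurable_fun D u /\ (\int[leb d]_(x in D) ((u x) ^+ 2)%:E < +oo)%E.

Definition sip (D : set E) (u v : E -> R) : R :=
  \int[leb d]_(x in D) (u x * v x).

Definition snorm (D : set E) (u : E -> R) : R := Num.sqrt (sip D u u).

Definition weak_partial (D : set E) (i : 'I_d) (u g : E -> R) :=
  forall phi, C1c D phi -> sip D u ('D_(ebase i) phi) = - sip D g phi.

Definition H1 (D : set E) (u : E -> R) :=
  L2 D u /\ forall i, exists g, L2 D g /\ weak_partial D i u g.

(* For u in H^1(D): a representative of the weak partial derivative, which is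
   unique up to a null set. *)
Definition partial (D : set E) (i : 'I_d) (u : E -> R) : E -> R :=
  xget (fun=> 0) [set g | L2 D g /\ weak_partial D i u g].

Definition H1norm (D : set E) (u : E -> R) : R :=
  Num.sqrt (snorm D u ^+ 2 + \sum_(i < d) snorm D (partial D i u) ^+ 2).

Definition H10 (D : set E) (u : E -> R) :=
  H1 D u /\ exists phi : nat -> E -> R, (forall k, C1c D (phi k)) /\
    (fun k => H1norm D (fun x => phi k x - u x)) @ \oo --> (0 : R).

Definition L20 (D : set E) (q : E -> R) :=
  L2 D q /\ \int[leb d]_(x in D) q x = 0.

Definition component (u : E -> E) (i : 'I_d) : E -> R := fun x => u x ord0 i.

Definition L2v D (u : E -> E) := forall i, L2 D (component u i).
Definition H1v D (u : E -> E) := forall i, H1 D (component u i).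
Definition H10v D (u : E -> E) := forall i, H10 D (component u i).

Definition grad (D : set E) (u : E -> E) : E -> 'M[R]_d :=
  fun x => \matrix_(i, k) partial D k (component u i) x.

Definition div (D : set E) (u : E -> E) : E -> R := fun x => \tr (grad D u x).

Definition dotm {m n} (A B : 'M[R]_(m, n)) : R :=
  \sum_i \sum_j A i j * B i j.

Definition enorm (x : E) : R := Num.sqrt (dotm x x).

Definition ip (D : set E) {m n} (f g : E -> 'M[R]_(m, n)) : R :=
  \int[leb d]_(x in D) dotm (f x) (g x).

Definition norm2 (D : set E) {m n} (f : E -> 'M[R]_(m, n)) : R :=
  Num.sqrt (ip D f f).

(* The normal trace of v in H^1(D) is the functional on H^1(D) given by Green's
   formula: <v.n, phi> = (v, grad phi) + (div v, phi). *)
Definition normal_trace (D : set E) (v : E -> E) (phi : E -> R) : R :=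
  \int[leb d]_(x in D)
    (\sum_(i < d) component v i x * partial D i phi x + div D v x * phi x).

Definition Yspace (D : set E) (v : E -> E) :=
  H1v D v /\ forall phi, H1 D phi -> normal_trace D v phi = 0.

Definition ess_sup_on (D : set E) (f : E -> R) : \bar R :=
  ess_sup (leb d) (patch (cst 0%E) D (fun x => `|f x|%:E)).

Definition Linfty (D : set E) (f : E -> R) :=
  measurable_fun D f /\ (ess_sup_on D f < +oo)%E.

Definition Linfty_norm (D : set E) (f : E -> R) : R := fine (ess_sup_on D f).

Definition ess_inf_on (D : set E) (f : E -> R) : R :=
  fine (ess_inf (leb d) (patch (cst +oo%E) D (EFin \o f))).

(* u . grad v *)
Definition advect (D : set E) (u v : E -> E) : E -> E :=
  fun x => u x *m (grad D v x)^T.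

Definition bstar (D : set E) (u v w : E -> E) : R :=
  2^-1 * ip D (advect D u v) w - 2^-1 * ip D (advect D u w) v.

Definition Hm1 (D : set E) (F : functional) :=
  (forall (a : R) u v, H10v D u -> H10v D v -> F (a *: u + v) = a * F u + F v) /\
  exists c, forall v, H10v D v -> `|F v| <= c * norm2 D (grad D v).

(* The quotient is 0 for v = 0. *)
Definition Hm1_norm (D : set E) (F : functional) : R :=
  sup [set F v / norm2 D (grad D v) | v in H10v D].

Definition simple_Hm1 (D : set E) (s : R -> functional) :=
  exists (m : nat) (A : 'I_m -> set R) (F : 'I_m -> functional),
    (forall k, measurable (A k) /\ Hm1 D (F k)) /\
    forall t v, s t v = \sum_(k < m) \1_(A k) t * F k v.

(* Bochner space L^2(0,T;H^-1); the elements are defined at every time, since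
   the scheme evaluates them at the time levels. *)
Definition L2_Hm1 (D : set E) (T : R) (f : R -> functional) :=
  [/\ forall t, 0 <= t <= T -> Hm1 D (f t),
      exists s : nat -> R -> functional, (forall k, simple_Hm1 D (s k)) /\
        \forall t \ae (@lebesgue_measure R), 0 <= t <= T ->
          (fun k => Hm1_norm D (fun v => s k t v - f t v)) @ \oo --> (0 : R) &
      (\int[@lebesgue_measure R]_(t in `[0%R, T]) ((Hm1_norm D (f t)) ^+ 2)%:E
         < +oo)%E].

End sobolev.

Section finite_elements.
Context {R : realType} {d : nat}.
Local Notation E := 'rV[R]_d.

(* (a, c) represents the half-space a . x <= c, with outward unit normal a. *)
Definition halfspaces := seq (E * R).

Definition opoly (P : halfspaces) : set E :=
  [set x | forall h, h \in P -> dotm h.1 x < h.2].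

Definition cpoly (P : halfspaces) : set E :=
  [set x | forall h, h \in P -> dotm h.1 x <= h.2].

Definition polytope (P : halfspaces) :=
  [/\ forall h, h \in P -> enorm h.1 = 1, bounded_set (cpoly P) &
      opoly P !=set0].

(* A supporting hyperplane with a = 0 gives the improper faces set0 and K. *)
Definition face (K F : set E) := exists (a : E) (c : R),
  (forall x, K x -> dotm a x <= c) /\ F = K `&` [set x | dotm a x = c].

Definition diam (K : halfspaces) : R :=
  sup [set r | exists x y, [/\ cpoly K x, cpoly K y & r = enorm (x - y)]].

Definition ball_diam (K : halfspaces) : R :=
  sup [set r | 0 <= r /\
    exists c, forall x, enorm (x - c) <= r / 2 -> cpoly K x].

Definition is_mesh (D : set E) (T : seq halfspaces) :=
  [/\ forall K, K \in T -> polytope K,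
      \bigcup_(K in [set` T]) cpoly K = closure D,
      forall K L, K \in T -> L \in T -> K != L ->
        opoly K `&` opoly L = set0 &
      forall K L, K \in T -> L \in T -> face (cpoly K) (cpoly K `&` cpoly L)].

Definition mesh_size (T : seq halfspaces) : R := \big[Num.max/0]_(K <- T) diam K.

(* On each (open) cell a finite element function is C^1 up to the boundary;
   this covers polynomial and mapped polynomial shape functions. *)
Definition piecewise_C1 (T : seq halfspaces) (f : E -> R) :=
  forall K, K \in T -> exists phi, C1 phi /\ forall x, opoly K x -> f x = phi x.

Definition finite_span {W : lmodType R} (V : set (E -> W)) :=
  exists (m : nat) (b : 'I_m -> E -> W),
    V = [set v | exists c : 'I_m -> R, v = \sum_(k < m) c k *: b k].

Record fe_data := FEData {
  fe_mesh : seq halfspaces;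
  fe_X : set (E -> E);
  fe_Y : set (E -> E);
  fe_Q : set (E -> R^o) }.

Definition conforming_fe (D : set E) (fe : fe_data) :=
  [/\ is_mesh D (fe_mesh fe),
      [/\ finite_span (fe_X fe), finite_span (fe_Y fe) & finite_span (fe_Q fe)],
      [/\ forall v i, fe_X fe v -> piecewise_C1 (fe_mesh fe) (component v i),
          forall v i, fe_Y fe v -> piecewise_C1 (fe_mesh fe) (component v i) &
          forall q, fe_Q fe q -> piecewise_C1 (fe_mesh fe) q] &
      [/\ fe_X fe `<=` H10v D, fe_Y fe `<=` Yspace D, fe_Q fe `<=` L20 D &
          fe_X fe `<=` fe_Y fe]].

Definition inf_sup (D : set E) (fe : fe_data) (beta : R) :=
  let quotient q v := sip D q (div D v) / (snorm D q * norm2 D (grad D v)) in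
  let X := [set v | fe_X fe v /\ norm2 D (grad D v) != 0] in
  let Q := [set q | fe_Q fe q /\ snorm D q != 0] in
  (beta%:E <= ereal_inf [set ereal_sup [set (quotient q v)%:E | v in X] | q in Q])%E.

Definition shape_regular (I : Type) (fem : I -> fe_data) :=
  exists2 sigma : R, 0 < sigma & forall i K, K \in fe_mesh (fem i) ->
    diam K <= sigma * ball_diam K.

Definition quasi_uniform (I : Type) (fem : I -> fe_data) :=
  exists2 kappa : R, 0 < kappa & forall i K, K \in fe_mesh (fem i) ->
    mesh_size (fe_mesh (fem i)) <= kappa * diam K.

Definition fe_family (D : set E) (I : Type) (fem : I -> fe_data) (beta : R) :=
  [/\ forall i, conforming_fe D (fem i), shape_regular fem, quasi_uniform fem &
      forall i, inf_sup D (fem i) beta].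

Definition Vspace (D : set E) (fe : fe_data) : set (E -> E) :=
  [set v | fe_X fe v /\ forall q, fe_Q fe q -> sip D (div D v) q = 0].

Definition L2_projection (D : set E) (V : set (E -> E)) (u uh : E -> E) :=
  V uh /\ forall v, V v -> ip D uh v = ip D u v.

End finite_elements.
Arguments halfspaces : clear implicits.
Arguments fe_data : clear implicits.

Section scheme.
Context {R : realType} {d : nat} (D : set 'rV[R]_d) (J : nat).
Local Notation E := 'rV[R]_d.
Implicit Types (nu : 'I_J -> E -> R) (uhat util : 'I_J -> nat -> E -> E).

Definition nu_bar nu : E -> R := fun x => J%:R^-1 * \sum_(j < J) nu j x.

Definition nu_fluct nu (j : 'I_J) : E -> R := fun x => nu j x - nu_bar nu x.

Definition nu_bar_min nu : R := ess_inf_on D (nu_bar nu).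

Definition alpha nu (j : 'I_J) : R :=
  nu_bar_min nu - 3 * Linfty_norm D (nu_fluct nu j).

Definition alpha_min nu : R := inf (range (alpha nu)).

(* Used for n >= 1 only. *)
Definition extrap (u : nat -> E -> E) (n : nat) : E -> E :=
  2 *: u n - u n.-1.

Definition u_mean uhat (n : nat) : E -> E :=
  J%:R^-1 *: \sum_(j < J) extrap (uhat j) n.

Definition u_fluct uhat (j : 'I_J) (n : nat) : E -> E :=
  extrap (uhat j) n - u_mean uhat n.

Definition nu_T (mu dt : R) uhat (n : nat) : E -> R :=
  fun x => mu * dt * \sum_(j < J) enorm (u_fluct uhat j n x) ^+ 2.

Definition D_infty (M : nat) uhat : R :=
  \big[Num.max/0]_(j < J) \big[Num.max/0]_(1 <= n < M.+1)
    Linfty_norm D (div D (u_fluct uhat j n)).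

Definition bdf2_step1 (fe : fe_data R d) nu (f : 'I_J -> R -> (E -> E) -> R)
    (gamma mu dt : R) uhat util (j : 'I_J) (n : nat) :=
  fe_X fe (uhat j n.+1) /\
  forall chi, fe_X fe chi ->
    (2 * dt)^-1 *
        ip D (3 *: uhat j n.+1 - 4 *: util j n + util j n.-1) chi
      + bstar D (u_mean uhat n) (uhat j n.+1) chi
      + ip D (fun x => nu_bar nu x *: grad D (uhat j n.+1) x) (grad D chi)
      + gamma * sip D (div D (uhat j n.+1)) (div D chi)
      + ip D (fun x => nu_T mu dt uhat n x *: grad D (uhat j n.+1) x)
          (grad D chi)
    = f j (n.+1%:R * dt) chi
      - bstar D (u_fluct uhat j n) (extrap (uhat j) n) chi
      - ip D (fun x => nu_fluct nu j x *: grad D (extrap (uhat j) n) x)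
          (grad D chi).

Definition bdf2_step2 (fe : fe_data R d) (dt : R) uhat util
    (phat : 'I_J -> nat -> E -> R) (j : 'I_J) (n : nat) :=
  [/\ fe_Y fe (util j n.+1), fe_Q fe (phat j n.+1),
      forall v, fe_Y fe v ->
        3 / (2 * dt) * ip D (util j n.+1 - uhat j n.+1) v
          - sip D (phat j n.+1) (div D v) = 0 &
      forall q, fe_Q fe q -> sip D (div D (util j n.+1)) q = 0].

Definition bdf2_eev_spp (fe : fe_data R d) nu f (u0 u1 : 'I_J -> E -> E)
    (gamma mu dt : R) (M : nat) uhat util phat :=
  [/\ forall j, util j 0 = uhat j 0 /\ util j 1 = uhat j 1,
      forall j, L2_projection D (Vspace D fe) (u0 j) (uhat j 0) /\
                L2_projection D (Vspace D fe) (u1 j) (uhat j 1),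
      forall j n, (1 <= n < M)%N ->
        bdf2_step1 fe nu f gamma mu dt uhat util j n &
      forall j n, (1 <= n < M)%N -> bdf2_step2 fe dt uhat util phat j n].

Definition zeta nu (C mu dt : R) (M : nat) uhat : R :=
  alpha_min nu / 2 - C / (mu * dt) - C / alpha_min nu * D_infty M uhat ^+ 2.

End scheme.

(* Main.v *)
Require Import Defs.
From mathcomp Require Import all_boot all_order all_algebra.
From mathcomp Require Import all_classical all_reals all_analysis.
From mathcomp Require Import ess_sup_inf measurable_realfun ring lra.
Import Order.TTheory GRing.Theory Num.Theory.
Import numFieldNormedType.Exports.
Set Implicit Arguments. Unset Strict Implicit. Unset Printing Implicit Defensive.
Local Open Scope classical_set_scope.
Local Open Scope ring_scope.

(** The scheme is tested with the new velocity, and the resulting energy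
    inequality closes for the following reasons.

    The difference quotient. The corrected velocity is the L2 projection of the
    new one onto the discretely divergence-free fields, so it may replace the
    new velocity against the earlier corrected ones ([bdf2_energy_step]), and
    the BDF2 quotient controls the increments of the squared G-norm
    |u^n|^2 + |2 u^n - u^(n-1)|^2. The initial value of this G-norm is not
    bounded by 6 |u^1|^2 + 2 |u^0|^2: the steps are therefore weighted, with
    weight 5/9 everywhere except at the last step, where the norm of one
    velocity suffices and weight 1/3 returns only 5/9 of the previous energy
    ([bdf2_last_step], [bdf2_energy_initial]).

    The convective term. The mean flow drops out by skew-symmetry. For the
    fluctuation u', integration by parts moves the derivative to the new
    velocity ([bstar_by_parts]); the term |u'| |grad u^(n+1)| |w| that appears
    is shared between the eddy viscosity, which is at least
    mu dt |u'|^2, and |w|^2 / (4 mu dt), while the divergence of u' is bounded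
    by D_infty ([convection_bound]). Poincare's inequality turns the L2 norms
    into gradient norms; its constant is the only source of C.

    The viscous fluctuation and the forcing are absorbed by Young's inequality.
    Each gradient norm occurs in one step as the new one and in two steps as an
    extrapolated one, which costs 3 ||nu'|| in all ([young_absorb]); the sum is
    organised as an induction on the number of steps ([bdf2_sum]).

    The analysis behind these manipulations consists of Poincare's inequality
    ([poincare]) and of the vanishing of the transport form on H^1_0
    ([transport_H10]). Both hold for test functions by integration by parts and
    pass to the limit. The second limit needs a bounded velocity with bounded
    divergence, and bounding the divergence by D_infty needs it to be bounded in
    the first place. Finite element functions have these properties since their
    weak derivatives agree almost everywhere with the cellwise classical ones
    ([piecewise_C1_bounded]), which rests on the fundamental lemma of the
    calculus of variations ([fundamental_lemma]) and on the mesh skeleton being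
    a null set. *)

(** * Boxes and measurability in R^d *)
Section boxes.
Context {R : realType} {d : nat}.
Local Notation E := 'rV[R]_d.

Definition obox (a b : E) : set E :=
  [set x | forall i, a ord0 i < x ord0 i < b ord0 i].

Definition cbox (a b : E) : set E :=
  [set x | forall i, a ord0 i <= x ord0 i <= b ord0 i].

Lemma nbhs_rVP (x : E) (A : set E) : nbhs x A <->
  exists2 e : R, 0 < e & [set y : E | forall i, `|x ord0 i - y ord0 i| < e] `<=` A.
Proof.
split.
  move=> /nbhs_ballP[e /= e0 xA]; exists e => // y /= xy; apply: xA.
  by split => // i j; rewrite (ord1 i) /ball/=.
move=> [e e0 xA]; apply/nbhs_ballP; exists e => //= y [_ xy]; apply: xA => i /=.
exact: xy.
Qed.

(** Boxes with rational corners are countably many. The closed boxes are kept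
    inside O so that functions supported in them are test functions on O. *)
Lemma open_bigcup_obox (O : set E) : open O ->
  exists (a b : nat -> E) (S : set nat),
    O = \bigcup_(k in S) obox (a k) (b k) /\
    forall k, S k -> cbox (a k) (b k) `<=` O.
Proof.
move=> oO.
pose ab k : 'rV[rat]_d * 'rV[rat]_d := odflt (0, 0) (unpickle k).
pose a k : E := map_mx ratr (ab k).1; pose b k : E := map_mx ratr (ab k).2.
exists a, b, [set k | cbox (a k) (b k) `<=` O]; split => //.
apply/seteqP; split; last first.
  by move=> x [k /= kO xk]; apply: kO => i; have /andP[/ltW-> /ltW->] := xk i.
move=> x Ox; move: oO; rewrite openE => /(_ _ Ox)/nbhs_rVP[e e0 xO].
have /choice[p pP] (i : 'I_d) : exists q : rat, ratr q \in `]x ord0 i - e, x ord0 i[.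
  by apply: rat_in_itvoo; rewrite gtrBl.
have /choice[q qP] (i : 'I_d) : exists q : rat, ratr q \in `]x ord0 i, x ord0 i + e[.
  by apply: rat_in_itvoo; rewrite ltrDl.
pose k := pickle (\row_i p i : 'rV[rat]_d, \row_i q i : 'rV[rat]_d).
have aE i : a k ord0 i = ratr (p i) by rewrite /a /ab /k pickleK/= !mxE.
have bE i : b k ord0 i = ratr (q i) by rewrite /b /ab /k pickleK/= !mxE.
exists k => /=.
  move=> y yk; apply: xO => i /=; have := yk i; rewrite aE bE.
  by move: (pP i) (qP i); rewrite !in_itv/= ltr_norml; lra.
by move=> i; rewrite aE bE; move: (pP i) (qP i); rewrite !in_itv/=; lra.
Qed.

Definition boxes : set (set E) := [set A | exists a b, A = obox a b].

Lemma obox_measurable (a b : E) : measurable (obox a b).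
Proof.
rewrite (_ : obox a b = \bigcap_(i in [set: 'I_d])
    [set x : E | `]a ord0 i, b ord0 i[%classic (x ord0 i)]).
  apply: fin_bigcap_measurable => // i _.
  have := @measurable_coord R d i measurableT `]a ord0 i, b ord0 i[%classic.
  by rewrite setTI; apply; exact: measurable_itv.
apply/seteqP; split => x /=.
  by move=> xab i _; rewrite /= in_itv/=.
by move=> xab i; have := xab i I; rewrite /= in_itv.
Qed.

Lemma open_measurable_rV (O : set E) : open O -> measurable O.
Proof.
move=> /open_bigcup_obox[a [b [S [-> _]]]].
by apply: bigcup_measurable => k _; exact: obox_measurable.
Qed.

Lemma closed_measurable_rV (F : set E) : closed F -> measurable F.
Proof.
move=> cF; rewrite -(setCK F); apply: measurableC; apply: open_measurable_rV.
exact: closed_openC.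
Qed.

Lemma continuous_measurable_rV (f : E -> R) : continuous f ->
  measurable_fun setT f.
Proof.
move=> /continuousP cf; apply: (measurability _ (RGenOpens.measurableE R)).
move=> _ [_ [a [b ->] <-]]; rewrite setTI; apply: open_measurable_rV.
by apply: cf; exact: interval_open.
Qed.

Lemma sigma_boxes_open (O : set E) : open O -> <<s boxes >> O.
Proof.
move=> /open_bigcup_obox[a [b [S [-> _]]]].
apply: (@bigcup_measurable _ (g_sigma_algebraType boxes)) => k _.
by apply: sub_sigma_algebra; exists (a k), (b k).
Qed.

(** The sigma-algebra defined by the coordinates is generated by the boxes,
    which are stable under intersection: a property of measurable sets can be
    proved by checking it on boxes. *)
Lemma measurable_rVE : @measurable _ 'rV[R]_d = <<s boxes >>.
Proof.
apply/seteqP; split; last first.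
  apply: smallest_sub; first exact: sigma_algebra_measurable.
  by move=> _ [a [b ->]]; exact: obox_measurable.
apply: smallest_sub; first exact: smallest_sigma_algebra.
rewrite -bigcup_seq; apply: bigcup_sub => i _ A [B mB <-].
rewrite setTI.
have : measurable_fun [set: g_sigma_algebraType boxes]
    (fun x : E => x ord0 i : R).
  apply: (measurability _ (RGenOpens.measurableE R)).
  move=> _ [_ [a [b ->] <-]]; rewrite setTI; apply: sigma_boxes_open.
  move: (@coord_continuous R 1 d ord0 i) => /continuousP; apply.
  exact: interval_open.
by move=> /(_ measurableT B mB); rewrite setTI.
Qed.

Lemma setI_obox (a b a' b' : E) : obox a b `&` obox a' b' =
  obox (\row_i Num.max (a ord0 i) (a' ord0 i))
       (\row_i Num.min (b ord0 i) (b' ord0 i)).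
Proof.
apply/seteqP; split => x /=.
  move=> [xab xab'] i; rewrite !mxE gt_max lt_min.
  by have /andP[-> ->] := xab i; have /andP[-> ->] := xab' i.
move=> xab; split => i; have := xab i; rewrite !mxE gt_max lt_min.
  by move=> /andP[/andP[-> _] /andP[-> _]].
by move=> /andP[/andP[_ ->] /andP[_ ->]].
Qed.

Lemma setI_boxes : setI_closed boxes.
Proof. by move=> _ _ [a [b ->]] [a' [b' ->]]; rewrite setI_obox; do 2 eexists. Qed.

End boxes.

(** * Iterated integration on R^d *)
Section fubini_rV.
Context {R : realType}.
Local Notation lam := (@lebesgue_measure R).

Lemma consrV_lift d (t : R) (x : 'rV[R]_d) (j : 'I_d) :
  consrV (t, x) ord0 (lift ord0 j) = x ord0 j.
Proof. by rewrite mxE liftK. Qed.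

Lemma consrV_ord0 d (t : R) (x : 'rV[R]_d) : consrV (t, x) ord0 ord0 = t.
Proof. by rewrite mxE unlift_none. Qed.

Lemma lebSE d (A : set 'rV[R]_d.+1) :
  leb d.+1 A = (lam \x leb d)%E (@consrV R d @^-1` A).
Proof. by []. Qed.

Lemma measurable_preimage_consrV d (A : set 'rV[R]_d.+1) : measurable A ->
  measurable (@consrV R d @^-1` A).
Proof. by move=> mA; rewrite -[X in measurable X]setTI; exact: measurable_consrV. Qed.

Lemma leb_xsection0 d (A : set 'rV[R]_d.+1) : measurable A ->
  (forall t, leb d [set x | A (consrV (t, x))] = 0%E) -> leb d.+1 A = 0%E.
Proof.
move=> mA A0; rewrite lebSE /product_measure1 integral0_eq// => t _ /=.
rewrite -[RHS](A0 t); congr (leb d _); apply/seteqP; split => x /=.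
  by move/xsectionP.
by move=> Atx; apply/xsectionP.
Qed.

Lemma leb_ysection0 d (A : set 'rV[R]_d.+1) : measurable A ->
  (forall x : 'rV[R]_d, lam [set t | A (consrV (t, x))] = 0%E) ->
  leb d.+1 A = 0%E.
Proof.
move=> mA A0; rewrite lebSE.
transitivity ((lam \x^ leb d)%E (@consrV R d @^-1` A)).
  apply: (@product_measure_unique _ _ _ _ _ lam (leb d) (lam \x^ leb d)%E).
    by move=> B C mB mC /=; rewrite product_measure2E.
  exact: measurable_preimage_consrV.
rewrite /product_measure2 integral0_eq// => x _ /=.
rewrite -[RHS](A0 x); congr (lam _); apply/seteqP; split => t /=.
  by move/ysectionP.
by move=> Atx; apply/ysectionP.
Qed.

Lemma integrable_consrV d (f : 'rV[R]_d.+1 -> \bar R) :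
  (leb d.+1).-integrable setT f ->
  (lam \x leb d)%E.-integrable setT (f \o @consrV R d).
Proof.
move=> fi; have mf := measurable_int _ fi.
apply/integrableP; split.
  exact: (measurable_comp _ _ mf (@measurable_consrV R d)).
have /integrableP[_ H] := fi; refine (le_lt_trans _ H).
rewrite (@ge0_integral_pushforward _ _ _ _ _ _ (@measurable_consrV R d)) //.
exact: (measurable_int _ (integrable_abse fi)).
Qed.

Lemma integral_consrV d (f : 'rV[R]_d.+1 -> \bar R) :
  (leb d.+1).-integrable setT f ->
  (\int[leb d.+1]_x f x = \int[lam \x leb d]_z f (consrV z))%E.
Proof.
move=> fi; have mf := measurable_int _ fi.
apply: (integral_pushforward (@measurable_consrV R d) mf) => //.
exact: integrable_consrV.
Qed.

Lemma integral_leb12 d (f : 'rV[R]_d.+1 -> \bar R) :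
  (leb d.+1).-integrable setT f ->
  (\int[leb d.+1]_x f x = \int[lam]_t \int[leb d]_x f (consrV (t, x)))%E.
Proof.
move=> fi; rewrite integral_consrV//.
by rewrite -(integral12_prod_meas1 (integrable_consrV fi)).
Qed.

Lemma integral_leb21 d (f : 'rV[R]_d.+1 -> \bar R) :
  (leb d.+1).-integrable setT f ->
  (\int[leb d.+1]_x f x = \int[leb d]_x \int[lam]_t f (consrV (t, x)))%E.
Proof.
move=> fi; rewrite integral_consrV//.
by rewrite -(integral21_prod_meas1 (integrable_consrV fi)).
Qed.

(** A cube is the product of an interval and a cube of lower dimension, which
    is how [leb] is built. *)
Lemma leb_cube_lty d (L : R) :
  (leb d [set x : 'rV[R]_d | (forall i, `|x ord0 i| <= L)%R] < +oo)%E.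
Proof.
elim: d => [|d IH].
  by rewrite /= diracE ltry.
rewrite lebSE (_ : _ @^-1` _ = `[-L, L]%classic `*`
    [set x : 'rV[R]_d | forall i, `|x ord0 i| <= L]); last first.
  apply/seteqP; split => -[t x] /=.
    move=> tx; split; first by have := tx ord0; rewrite consrV_ord0 ler_norml in_itv.
    by move=> j; have := tx (lift ord0 j); rewrite consrV_lift.
  move=> [tL xL] i; case: (unliftP ord0 i) => [j|] ->.
    by rewrite consrV_lift.
  by rewrite consrV_ord0 ler_norml; rewrite in_itv in tL.
rewrite product_measure1E//; last first.
  apply: closed_measurable_rV.
  rewrite (_ : mkset _ = \bigcap_(i in [set: 'I_d])
     [set x : 'rV[R]_d | x ord0 i \in `[- L, L]]); last first.
    apply/seteqP; split => x /= xL i.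
      by move=> _ /=; rewrite in_itv/= -ler_norml.
    by have := xL i I; rewrite /= in_itv/= -ler_norml.
  apply: closed_bigI => i _.
  have /continuous_closedP := @coord_continuous R 1 d ord0 i.
  by move=> /(_ [set` `[- L, L]]); apply; exact: interval_closed.
rewrite lte_mul_pinfty//.
have := @lebesgue_measure_itv R `[- L, L] => /= H.
rewrite [X in X \is a _](_ : _ = lebesgue_measure [set` `[- L, L]])// H.
by case: ifP => //; rewrite -EFinB.
Qed.

End fubini_rV.

(** * Null hyperplanes and the integral of a partial derivative *)
Section hyperplanes.
Context {R : realType}.

Lemma dotm_row d (a x : 'rV[R]_d) : dotm a x = \sum_j a ord0 j * x ord0 j.
Proof. by rewrite /dotm big_ord1. Qed.

Lemma continuous_sum (T : topologicalType) I (r : seq I) (F : I -> T -> R) :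
  (forall i, continuous (F i)) -> continuous (fun x => \sum_(i <- r) F i x).
Proof.
move=> cF x; elim: r => [|i r IH].
  by rewrite (_ : (fun _ => _) = cst 0); [exact: cvg_cst|apply/funext => y; rewrite big_nil].
rewrite (_ : (fun _ => _) = fun y => F i y + \sum_(j <- r) F j y); last first.
  by apply/funext => y; rewrite big_cons.
by apply: cvgD => //; exact: cF.
Qed.

Lemma continuous_dotm d (a : 'rV[R]_d) : continuous (dotm a : 'rV[R]_d -> R).
Proof.
move=> x; rewrite (_ : dotm a = fun x => \sum_j a ord0 j * x ord0 j); last first.
  by apply/funext => y; rewrite dotm_row.
apply: continuous_sum => j y.
apply: (@continuousM R _ (fun=> a ord0 j) (fun x : 'rV[R]_d => x ord0 j)).
  exact: cst_continuous.
exact: coord_continuous.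
Qed.

Lemma closed_hyperplane d (a : 'rV[R]_d) c : closed [set x | dotm a x = c].
Proof.
rewrite (_ : mkset _ = (dotm a : 'rV[R]_d -> R) @^-1` [set c]); last by [].
by move: (@continuous_dotm d a) => /continuous_closedP; apply; exact: closed_eq.
Qed.

(** By induction on the dimension. If some coordinate of a other than the first
    is nonzero, the slices at a fixed first coordinate are again hyperplanes;
    otherwise the lines in the direction of the first axis meet the hyperplane
    in one point. *)
Lemma hyperplane_null d (a : 'rV[R]_d) c : a != 0 ->
  leb d [set x | dotm a x = c] = 0%E.
Proof.
elim: d => [|d IH] in a c *.
  by move=> /eqP[]; apply/rowP; case.
move=> a0; have mH := closed_measurable_rV (closed_hyperplane (a := a) (c := c)).
pose b : 'rV[R]_d := \row_j a ord0 (lift ord0 j).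
have dotE t (x : 'rV[R]_d) : dotm a (consrV (t, x)) = a ord0 ord0 * t + dotm b x.
  rewrite !dotm_row big_ord_recl consrV_ord0; congr (_ + _).
  by apply: eq_bigr => j _; rewrite consrV_lift mxE.
have [b0|b0] := eqVneq b 0; last first.
  apply: leb_xsection0 => // t; rewrite -[RHS](IH b (c - a ord0 ord0 * t) b0).
  congr (leb d _); apply/seteqP; split => x /=; rewrite dotE.
    by move=> <-; rewrite addrAC subrr add0r.
  by move=> ->; rewrite addrC subrK.
have a00 : a ord0 ord0 != 0.
  apply: contraNneq a0 => a00; apply/eqP/rowP => i.
  case: (unliftP ord0 i) => [j|] ->; rewrite mxE//.
  by move/rowP: b0 => /(_ j); rewrite !mxE.
apply: leb_ysection0 => // x.
rewrite (_ : mkset _ = [set (c - dotm b x) / a ord0 ord0]).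
  exact: lebesgue_measure_set1.
apply/seteqP; split => t /=; rewrite dotE.
  by move=> <-; rewrite addrK mulrAC mulfV// mul1r.
by move=> ->; rewrite mulrCA mulfV// mulr1 subrK.
Qed.

End hyperplanes.

Section integral_partial.
Context {R : realType}.
Local Notation lam := (@lebesgue_measure R).

Lemma cube_cbox d (L : R) : [set x : 'rV[R]_d | forall i, `|x ord0 i| <= L] =
  cbox (const_mx (- L)) (const_mx L).
Proof.
by apply/seteqP; split => x xL i; have := xL i; rewrite !mxE ler_norml.
Qed.

Lemma closed_cbox d (a b : 'rV[R]_d) : closed (cbox a b).
Proof.
rewrite (_ : cbox a b = \bigcap_(i in [set: 'I_d])
   [set x : 'rV[R]_d | x ord0 i \in `[a ord0 i, b ord0 i]]); last first.
  apply/seteqP; split => x /= xab i; first by move=> _ /=; rewrite in_itv/=.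
  by have := xab i I; rewrite /= in_itv/=.
apply: closed_bigI => i _.
have /continuous_closedP := @coord_continuous R 1 d ord0 i.
by move=> /(_ [set` `[a ord0 i, b ord0 i]]); apply; exact: interval_closed.
Qed.

Lemma compact_cbox d (a b : 'rV[R]_d) : compact (cbox a b).
Proof.
rewrite (_ : cbox a b = [set v : 'rV[R]_d | forall i, `[a ord0 i, b ord0 i]%classic (v ord0 i)]).
  apply: (@rV_compact _ _ (fun i => `[a ord0 i, b ord0 i]%classic)) => i.
  exact: segment_compact.
apply/seteqP; split => x /= xab i; first by rewrite in_itv/=.
by have := xab i; rewrite /= in_itv/=.
Qed.

Lemma continuous_compact_bound (T : topologicalType) (K : set T) (f : T -> R) :
  compact K -> continuous f -> exists M, forall x, K x -> `|f x| <= M.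
Proof.
move=> cK cf; have : compact (f @` K).
  by apply: continuous_compact => //; exact: continuous_subspaceT.
move=> /compact_bounded[M [_ fM]]; exists (M + 1) => x Kx.
by apply: (fM (M + 1)); [rewrite ltrDl|exists x].
Qed.

Lemma bounded_integrable d0 (T : measurableType d0)
    (mu : {measure set T -> \bar R}) (A : set T) (f : T -> R) (M : R) :
  measurable A -> (mu A < +oo)%E -> measurable_fun A f ->
  (forall x, A x -> `|f x| <= M) -> mu.-integrable A (EFin \o f).
Proof.
move=> mA Aoo mf fM; apply: measurable_bounded_integrable => //.
by exists M; split; [exact: num_real|]=> N MN x Ax; exact: le_trans (fM x Ax) (ltW MN).
Qed.

Lemma integrable_cube d (f : 'rV[R]_d -> R) (L : R) : continuous f ->
  (forall (x : 'rV[R]_d) i, L < `|x ord0 i| -> f x = 0) ->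
  (leb d).-integrable setT (EFin \o f).
Proof.
move=> cf f0; pose B := [set x : 'rV[R]_d | forall i, `|x ord0 i| <= L].
have mB : measurable B.
  by rewrite /B cube_cbox; apply: closed_measurable_rV; exact: closed_cbox.
rewrite (_ : EFin \o f = (EFin \o f) \_ B).
  have [|M fM] := continuous_compact_bound (K := B) _ cf.
    by rewrite /B cube_cbox; exact: compact_cbox.
  apply/(integrable_mkcond _ mB); apply: (bounded_integrable mB _ _ fM).
  - exact: leb_cube_lty.
  - by apply: measurable_funTS; exact: continuous_measurable_rV.
apply/funext => x; rewrite patchE; case: ifPn => //; rewrite notin_setE /B/=.
by move=> /existsNP[i /negP]; rewrite -ltNge => /f0/= ->.
Qed.

Lemma continuous_consrVr d (t : R) :
  continuous (fun x : 'rV[R]_d => consrV (t, x)).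
Proof.
move=> x A /nbhs_rVP[e e0 eA]; apply/nbhs_rVP; exists e => // y /= xy.
apply: eA => i /=; case: (unliftP ord0 i) => [j|] ->.
  by rewrite !consrV_lift.
by rewrite !consrV_ord0 subrr normr0.
Qed.

Lemma continuous_consrVl d (x : 'rV[R]_d) :
  continuous (fun t : R => consrV (t, x)).
Proof.
move=> t A /nbhs_rVP[e e0 eA]; apply/nbhs_ballP; exists e => // s ts.
apply: eA => i /=; case: (unliftP ord0 i) => [j|] ->.
  by rewrite !consrV_lift subrr normr0.
by rewrite !consrV_ord0.
Qed.

Lemma derive_consrV_lift d (f : 'rV[R]_d.+1 -> R) t x (j : 'I_d) :
  (fun h : R => h^-1 *: ((f \o shift (consrV (t, x))) (h *: ebase (lift ord0 j))
     - f (consrV (t, x)))) =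
  (fun h => h^-1 *: (((fun y => f (consrV (t, y))) \o shift x) (h *: ebase j)
     - f (consrV (t, x)))).
Proof.
apply/funext => h; congr (_ *: (f _ - _)); apply/rowP => i /=.
rewrite !mxE; case: (unliftP ord0 i) => [k|] ->.
  by rewrite /= !mxE /= (inj_eq (@lift_inj _ _)).
by rewrite /= mulr0 add0r.
Qed.

Lemma derive_consrV_ord0 d (f : 'rV[R]_d.+1 -> R) t x :
  (fun h : R => h^-1 *: ((f \o shift (consrV (t, x))) (h *: ebase ord0)
     - f (consrV (t, x)))) =
  (fun h => h^-1 *: (((fun s => f (consrV (s, x))) \o shift t) (h *: 1)
     - f (consrV (t, x)))).
Proof.
apply/funext => h; congr (_ *: (f _ - _)); apply/rowP => i /=.
rewrite !mxE; case: (unliftP ord0 i) => [k|] ->.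
  by rewrite /= mulr0 add0r.
by [].
Qed.

Lemma derive_eq0_out d (f : 'rV[R]_d -> R) (L : R) :
  (forall (x : 'rV[R]_d) i, L < `|x ord0 i| -> f x = 0) ->
  forall (v x : 'rV[R]_d) i, L < `|x ord0 i| -> 'D_v f x = 0.
Proof.
move=> f0 v x i xL; rewrite (@near_eq_derive _ _ _ f (cst 0)); first exact: derive_cst.
apply/nbhs_rVP; exists (`|x ord0 i| - L); first by rewrite subr_gt0.
move=> y /= /(_ i) xy; apply: (f0 _ i).
rewrite ltNge; apply/negP => yL; move: xy; apply/negP; rewrite -leNgt.
rewrite lerBlDr (le_trans _ (lerD (lexx _) yL))//.
by rewrite -[in leLHS](subrK (y ord0 i) (x ord0 i)) ler_normD.
Qed.

Lemma integral_derive1_0 (g : R -> R) (L : R) :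
  (forall t : R, derivable g t 1) -> continuous ('D_1 g) ->
  (forall t, L < `|t| -> g t = 0) -> (forall t : R, L < `|t| -> 'D_1 g t = 0) ->
  (\int[lam]_t ('D_1 g t)%:E = 0)%E.
Proof.
move=> dg cdg g0 dg0; pose N : R := `|L| + 1.
have N0 : - N < N by rewrite /N; have := normr_ge0 L; lra.
have LN (t : R) : N <= `|t| -> L < `|t|.
  by apply: lt_le_trans; rewrite /N; have := ler_norm L; lra.
transitivity (\int[lam]_(t in `[(- N)%R, N]) ('D_1 g t)%:E)%E.
  rewrite [RHS]integral_mkcond; apply: eq_integral => t _.
  rewrite patchE; case: ifPn => //; rewrite notin_setE/= in_itv/= => /negP.
  by rewrite -ler_norml -ltNge => /ltW/LN/dg0 ->.
rewrite (@continuous_FTC2 R _ g)//.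
- by rewrite !g0 ?subee//; apply: LN; rewrite ?normrN ler_norm.
- exact: continuous_subspaceT.
- split; first by move=> t _; exact: dg.
  + by apply: cvg_at_right_filter; exact/differentiable_continuous/derivable1_diffP.
  + by apply: cvg_at_left_filter; exact/differentiable_continuous/derivable1_diffP.
- by move=> t _; rewrite derive1E.
Qed.

(** The integral in the variable of differentiation vanishes by the fundamental
    theorem of calculus; the other variables are split off one by one. *)
Lemma integral_partial0 d (k : 'I_d) (f : 'rV[R]_d -> R) (L : R) :
  continuous f -> (forall x, derivable f x (ebase k)) ->
  continuous ('D_(ebase k) f) -> (forall (x : 'rV[R]_d) i, L < `|x ord0 i| -> f x = 0) ->
  (\int[leb d]_x ('D_(ebase k) f x)%:E = 0)%E.
Proof.
elim: d => [|d IH] in k f *; first by case: k.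
move=> cf df cdf f0.
have df0 := derive_eq0_out f0 (ebase k).
have idf := integrable_cube cdf df0.
case: (unliftP ord0 k) => [j|] kE; rewrite {}kE in df cdf df0 idf *.
  rewrite integral_leb12//; apply: integral0_eq => t _ /=.
  have DE (x : 'rV[R]_d) : 'D_(ebase (lift ord0 j)) f (consrV (t, x)) =
      'D_(ebase j) (fun y => f (consrV (t, y))) x.
    by rewrite /derive derive_consrV_lift.
  have ct := @continuous_consrVr d t.
  under eq_integral => x _ do rewrite DE.
  apply: IH.
  - by move=> y; apply: continuous_comp; [exact: ct|exact: cf].
  - by move=> x; rewrite /derivable -derive_consrV_lift; exact: df.
  - rewrite -(funext DE) => y.
    exact: (@continuous_comp _ _ _ (fun y => consrV (t, y)) _ y (ct y) (cdf _)).
  - by move=> x i xL; apply: (f0 _ (lift ord0 i)); rewrite consrV_lift.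
rewrite integral_leb21//; apply: integral0_eq => x _ /=.
have DE t : 'D_(ebase ord0) f (consrV (t, x)) = 'D_1 (fun s => f (consrV (s, x))) t.
  by rewrite /derive derive_consrV_ord0.
have ct := @continuous_consrVl d x.
under eq_integral => t _ do rewrite DE.
apply: (@integral_derive1_0 _ L).
- by move=> t; rewrite /derivable -derive_consrV_ord0; exact: df.
- rewrite -(funext DE) => t.
  exact: (@continuous_comp _ _ _ (fun s => consrV (s, x)) _ t (ct t) (cdf _)).
- by move=> t tL; apply: (f0 _ ord0); rewrite consrV_ord0.
- by move=> t tL; rewrite -DE; apply: (df0 _ ord0); rewrite consrV_ord0.
Qed.

End integral_partial.

(** * Continuously differentiable functions and bumps *)
Section continuity.
Context {R : realType} (T : topologicalType).
Implicit Types f g : T -> R.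

Lemma ctsD f g : continuous f -> continuous g -> continuous (fun x => f x + g x).
Proof. by move=> cf cg x; exact: (continuousD (cf x) (cg x)). Qed.

Lemma ctsM f g : continuous f -> continuous g -> continuous (fun x => f x * g x).
Proof. by move=> cf cg x; exact: (continuousM (cf x) (cg x)). Qed.

Lemma ctsN f : continuous f -> continuous (fun x => - f x).
Proof. by move=> cf x; exact: (continuousN (cf x)). Qed.

Lemma ctsV f : (forall x, f x != 0) -> continuous f -> continuous (fun x => (f x)^-1).
Proof. by move=> f0 cf x; exact: (continuousV (f0 x) (cf x)). Qed.

Lemma cts_comp (S : topologicalType) (g : S -> R) (f : T -> S) :
  continuous f -> continuous g -> continuous (fun x => g (f x)).
Proof. by move=> cf cg x; exact: (continuous_comp (cf x) (cg (f x))). Qed.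

End continuity.

Section C1_calculus.
Context {R : realType} {d : nat}.
Local Notation E := 'rV[R]_d.
Implicit Types f g : E -> R.

Lemma C1_cst (c : R) : C1 (fun _ : E => c).
Proof.
split=> [|i]; first exact: cst_continuous.
split=> [x|]; first exact: derivable_cst.
rewrite (_ : 'D_(ebase i) _ = cst 0); first exact: cst_continuous.
by apply/funext => x; exact: derive_cst.
Qed.

Lemma C1D f g : C1 f -> C1 g -> C1 (fun x => f x + g x).
Proof.
move=> [cf df] [cg dg]; split=> [|i]; first exact: ctsD.
split=> [x|]; first by apply: derivableD; [exact: (df i).1|exact: (dg i).1].
rewrite (_ : 'D_(ebase i) _ = fun x => 'D_(ebase i) f x + 'D_(ebase i) g x).
  by by apply: ctsD; [exact: (df i).2|exact: (dg i).2].
by apply/funext => x; rewrite deriveD//; [exact: (df i).1|exact: (dg i).1].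
Qed.

Lemma derive_mul f g i x : C1 f -> C1 g ->
  'D_(ebase i) (fun x => f x * g x) x =
  f x * 'D_(ebase i) g x + g x * 'D_(ebase i) f x.
Proof.
move=> [cf df] [cg dg].
by rewrite (@deriveM _ _ f g)//; [exact: (df i).1|exact: (dg i).1].
Qed.

Lemma C1M f g : C1 f -> C1 g -> C1 (fun x => f x * g x).
Proof.
move=> Cf Cg; have [cf df] := Cf; have [cg dg] := Cg; split=> [|i].
  exact: ctsM.
split=> [x|]; first by apply: derivableM; [exact: (df i).1|exact: (dg i).1].
rewrite (_ : 'D_(ebase i) _ = fun x =>
    f x * 'D_(ebase i) g x + g x * 'D_(ebase i) f x).
  by apply: ctsD; apply: ctsM => //; [exact: (dg i).2|exact: (df i).2].
by apply/funext => x; exact: derive_mul.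
Qed.

Lemma C1V f : (forall x, f x != 0) -> C1 f -> C1 (fun x => (f x)^-1).
Proof.
move=> f0 [cf df]; split=> [|i]; first exact: ctsV.
split=> [x|]; first by apply: derivableV => //; exact: (df i).1.
rewrite (_ : 'D_(ebase i) _ = fun x => - ((f x)^-1 * (f x)^-1) * 'D_(ebase i) f x).
  apply: ctsM; last exact: (df i).2.
  by apply: ctsN; apply: ctsM; exact: ctsV.
apply/funext => x; rewrite deriveV//; last exact: (df i).1.
by rewrite -invfM -expr2.
Qed.

Lemma C1_prod I (r : seq I) (F : I -> E -> R) : (forall i, C1 (F i)) ->
  C1 (fun x => \prod_(i <- r) F i x).
Proof.
move=> CF; elim: r => [|i r IH].
  rewrite (_ : (fun _ => _) = fun=> 1); first exact: C1_cst.
  by apply/funext => x; rewrite big_nil.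
rewrite (_ : (fun _ => _) = fun x => F i x * \prod_(j <- r) F j x).
  exact: C1M.
by apply/funext => x; rewrite big_cons.
Qed.

(** A quadratic remainder estimate gives the derivative of a squared positive
    part uniformly, with no case distinction at the point where it vanishes. *)
Lemma is_derive_quadratic (f : R -> R) (t c K : R) :
  (forall h, `|f (h + t) - f t - c * h| <= K * h ^+ 2) -> is_derive t 1 f c.
Proof.
move=> fK.
have fc : (fun h : R => h^-1 *: ((f \o shift t) (h *: 1) - f t)) @ 0^' --> c.
  apply/cvgrPdist_le => e e0.
  have K1 : 0 < `|K| + 1 by rewrite ltr_wpDl.
  near=> h.
  have h0 : h != 0 by near: h; exact: nbhs_dnbhs_neq.
  rewrite /= -[h%:A]/(h * 1) mulr1 distrC.
  have -> : h^-1 *: (f (h + t) - f t) - c = h^-1 * (f (h + t) - f t - c * h).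
    by rewrite -[_ *: _]/(_ * _); field.
  rewrite normrM normfV ler_pdivrMl ?normr_gt0// (le_trans (fK h))//.
  apply: (@le_trans _ _ ((`|K| + 1) * `|h| ^+ 2)).
    rewrite real_normK ?num_real// ler_wpM2r ?sqr_ge0//.
    by rewrite (le_trans (ler_norm _))// lerDl.
  rewrite mulrC expr2 -mulrA ler_wpM2l// -ler_pdivlMr//.
  near: h; apply: dnbhs0_le; exact: divr_gt0.
apply: DeriveDef; first by apply/cvg_ex; exists c.
exact: cvg_lim fc.
Unshelve. all: by end_near. Qed.

Definition sqpos (t : R) : R := Num.max 0 t ^+ 2.

Lemma sqpos_quadratic (t h : R) :
  `|sqpos (h + t) - sqpos t - 2 * Num.max 0 t * h| <= 1 * h ^+ 2.
Proof.
rewrite /sqpos mul1r ler_norml.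
have [t0|t0] := leP 0 t; have [th0|th0] := leP 0 (h + t); apply/andP; split; nra.
Qed.

Section coordinate.
Variables (i : 'I_d) (g g' : R -> R).
Hypotheses (dg : forall t : R, is_derive t 1 g (g' t)) (cg' : continuous g').

Let quotientE (x : E) (j : 'I_d) :
  (fun h : R => h^-1 *: (((fun y : E => g (y ord0 i)) \o shift x) (h *: ebase j)
      - g (x ord0 i))) =
  if i == j
  then (fun h => h^-1 *: ((g \o shift (x ord0 i)) (h *: 1) - g (x ord0 i)))
  else cst 0.
Proof.
case: (eqVneq i j) => [<-|ij]; apply/funext => h /=.
  by rewrite !mxE !eqxx.
by rewrite !mxE (negbTE ij) andbF mulr0 add0r subrr scaler0.
Qed.

Lemma derive_coord (x : E) (j : 'I_d) :
  'D_(ebase j) (fun x : E => g (x ord0 i)) x =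
  if i == j then g' (x ord0 i) else 0.
Proof.
rewrite /derive quotientE; case: ifPn => _.
  by have [_ <-] := dg (x ord0 i).
by apply: cvg_lim => //; exact: cvg_cst.
Qed.

Lemma C1_coord : C1 (fun x : E => g (x ord0 i)).
Proof.
have cg : continuous g.
  move=> t; apply/differentiable_continuous/derivable1_diffP.
  by have [] := dg t.
split=> [|j].
  by apply: (@cts_comp _ _ _ g) => //; exact: coord_continuous.
split=> [x|].
  rewrite /derivable quotientE; case: ifPn => _; last exact: is_cvg_cst.
  by have [] := dg (x ord0 i).
rewrite (funext (fun x => derive_coord x j)).
case: (i == j); last exact: cst_continuous.
by apply: (@cts_comp _ _ _ g') => //; exact: coord_continuous.
Qed.

End coordinate.

(** Squaring the positive part of an affine function makes it continuously
    differentiable: bumps are built from such factors. *)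
Lemma C1_sqpos_coord (i : 'I_d) (s c : R) :
  C1 (fun x : E => sqpos (s * x ord0 i + c)).
Proof.
apply: (@C1_coord i (fun t => sqpos (s * t + c))
  (fun t => 2 * Num.max 0 (s * t + c) * s)) => [t|].
  apply: (@is_derive_quadratic _ _ _ (s ^+ 2)) => h.
  have := sqpos_quadratic (s * t + c) (s * h).
  rewrite mul1r exprMn; congr (_ <= _); congr (`|_|).
  by rewrite (_ : s * (h + t) + c = s * h + (s * t + c)); last (by ring); congr (_ - _); ring.
apply: ctsM; last exact: cst_continuous.
apply: ctsM; first exact: cst_continuous.
move=> t; apply: (@continuous_max _ _ (cst 0) (fun t : R => s * t + c)).
  exact: cst_continuous.
apply: ctsD; last exact: cst_continuous.
apply: ctsM; first exact: cst_continuous.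
by move=> x; exact: cvg_id.
Qed.

End C1_calculus.

(** * The fundamental lemma of the calculus of variations *)
Section bumps.
Context {R : realType} {d : nat}.
Local Notation E := 'rV[R]_d.

Definition box_weight (a b : E) (x : E) : R :=
  \prod_(i < d) (sqpos (1 * x ord0 i + - a ord0 i) *
                 sqpos (- 1 * x ord0 i + b ord0 i)).

(** The weight is positive exactly on the open box, so that the bumps increase
    to its indicator function with n. *)
Definition bump (a b : E) (n : nat) (x : E) : R :=
  1 - (1 + n%:R * box_weight a b x)^-1.

Lemma sqpos_ge0 (t : R) : 0 <= sqpos t.
Proof. exact: sqr_ge0. Qed.

Lemma sqpos_gt0 (t : R) : (0 < sqpos t) = (0 < t).
Proof.
rewrite /sqpos; have [t0|t0] := ltP 0 t; first by rewrite exprn_gt0.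
by rewrite expr0n ltxx.
Qed.

Lemma box_weight_ge0 a b x : 0 <= box_weight a b x.
Proof. by apply: prodr_ge0 => i _; rewrite mulr_ge0 ?sqpos_ge0. Qed.

Lemma box_weight_gt0 a b x : reflect (obox a b x) (0 < box_weight a b x).
Proof.
apply: (iffP idP) => [|xab].
  rewrite lt0r => /andP[/prodf_neq0 w0 _] i.
  have := w0 i isT; rewrite mulf_eq0 negb_or => /andP[].
  by rewrite !neq_lt !ltNge !sqpos_ge0/= -!ltNge !sqpos_gt0; lra.
apply: prodr_gt0 => i _; have := xab i.
by move=> /andP[? ?]; rewrite mulr_gt0// sqpos_gt0; lra.
Qed.

Lemma bump_den a b n x : 0 < 1 + n%:R * box_weight a b x.
Proof. by rewrite ltr_pwDl// mulr_ge0// box_weight_ge0. Qed.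

Lemma bump_bound a b n x : `|bump a b n x| <= 1.
Proof.
have := bump_den a b n x; rewrite /bump => D0.
have Dge1 : 1 <= 1 + n%:R * box_weight a b x.
  by rewrite lerDl mulr_ge0// box_weight_ge0.
have : (1 + n%:R * box_weight a b x)^-1 <= 1 by rewrite invf_le1.
have : 0 < (1 + n%:R * box_weight a b x)^-1 by rewrite invr_gt0.
rewrite ler_norml; lra.
Qed.

Lemma bump_out a b n x : ~ obox a b x -> bump a b n x = 0.
Proof.
move=> xab; rewrite /bump (_ : box_weight a b x = 0).
  by rewrite mulr0 addr0 invr1 subrr.
apply/eqP; rewrite eq_le box_weight_ge0 andbT leNgt.
by apply/box_weight_gt0.
Qed.

Lemma C1_bump a b n : C1 (bump a b n).
Proof.
rewrite (_ : bump a b n =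
    fun x => 1 + (- 1) * (1 + n%:R * box_weight a b x)^-1); last first.
  by apply/funext => x; rewrite mulN1r.
apply: C1D; first exact: C1_cst.
apply: C1M; first exact: C1_cst.
apply: C1V; first by move=> x; rewrite gt_eqF// bump_den.
apply: C1D; first exact: C1_cst.
apply: C1M; first exact: C1_cst.
by apply: C1_prod => i; apply: C1M; exact: C1_sqpos_coord.
Qed.

Lemma bump_support (O : set E) a b n : cbox a b `<=` O -> C1c O (bump a b n).
Proof.
move=> abO.
have sub : closure [set x | bump a b n x != 0] `<=` cbox a b.
  rewrite [X in _ `<=` X](closure_id _).1; last exact: closed_cbox.
  apply: closure_subset => x /= /eqP x0 i.
  suff /(_ i) : obox a b x by move=> /andP[/ltW -> /ltW ->].
  by apply: contrapT => /bump_out => /(_ n).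
split; [exact: C1_bump| |exact: subset_trans sub abO].
by apply: subclosed_compact sub; [exact: closed_closure|exact: compact_cbox].
Qed.

Lemma bump_cvg a b x : obox a b x -> bump a b n x @[n --> \oo] --> (1 : R).
Proof.
move=> /box_weight_gt0 w0; rewrite -[X in _ --> X]subr0.
apply: cvgB; first exact: cvg_cst.
apply/cvgrPdist_le => e e0; near=> n.
rewrite sub0r normrN normfV gtr0_norm ?bump_den//.
rewrite invf_ple ?posrE ?bump_den//.
have : e^-1 / box_weight a b x <= n%:R by near: n; exact: nbhs_infty_ger.
by rewrite ler_pdivrMr// => /le_trans; apply; rewrite lerDr.
Unshelve. all: by end_near. Qed.

(** Testing with bumps shows by dominated convergence that h integrates to zero
    over every box whose closure lies in O. Inside one such box the same then
    holds for every measurable set, so h vanishes almost everywhere there, and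
    countably many boxes cover O. *)
Lemma fundamental_lemma (O : set E) (h : E -> R) : open O ->
  (leb d).-integrable O (EFin \o h) ->
  (forall phi, C1c O phi -> \int[leb d]_(x in O) (h x * phi x) = 0) ->
  ae_eq (leb d) O h (cst 0).
Proof.
move=> oO ih h0.
have mO := open_measurable_rV oO.
have mh : measurable_fun O h by apply/measurable_EFinP; exact: measurable_int ih.
have box0 a b : cbox a b `<=` O -> (\int[leb d]_(x in obox a b) (h x)%:E = 0)%E.
  move=> abO.
  have bO : obox a b `<=` O.
    by move=> x xab; apply: abO => i; have /andP[/ltW -> /ltW ->] := xab i.
  have mb := obox_measurable a b.
  pose f n x := (h x * bump a b n x)%:E.
  pose g := (EFin \o h) \_ (obox a b).
  have mf n : measurable_fun O (f n).
    apply/measurable_EFinP; apply: measurable_funM => //.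
    apply: measurable_funTS; apply: continuous_measurable_rV.
    exact: (C1_bump a b n).1.
  have mg : measurable_fun O g.
    apply/measurable_restrict => //.
    apply: measurable_funS (measurable_int _ ih) => //.
  have fg : {ae leb d, forall x, O x -> f n x @[n --> \oo] --> g x}.
    apply: aeW => x Ox; rewrite /g patchE; case: ifPn => [|].
      rewrite inE => xab; apply: cvg_EFin; first exact: nearW.
      rewrite -[X in _ --> X]mulr1.
      by apply: cvgM; [exact: cvg_cst|exact: bump_cvg].
    rewrite notin_setE => xab; rewrite (_ : (fun n => f n x) = cst 0%E).
      exact: cvg_cst.
    by apply/funext => n; rewrite /f bump_out// mulr0.
  have fh : {ae leb d, forall x n, O x -> (`|f n x| <= `|(h x)%:E|)%E}.
    apply: aeW => x n Ox; rewrite /f /= lee_fin normrM -[leRHS]mulr1.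
    by rewrite ler_wpM2l// bump_bound.
  have [_ _] := @dominated_convergence _ _ _ (leb d) O mO f g
    (fun x => `|(h x)%:E|%E) mf mg fg (integrable_abse ih) fh.
  rewrite [X in X @ _](_ : _ = cst 0%E); last first.
    apply/funext => n /=; rewrite /f.
    have ifn : (leb d).-integrable O (EFin \o (fun x => h x * bump a b n x)).
      apply: le_integrable ih => //; first exact: mf.
      move=> x Ox /=.
      by rewrite lee_fin normrM -[leRHS]mulr1 ler_wpM2l// bump_bound.
    rewrite -[LHS](fineK (integrable_fin_num mO ifn)).
    by congr (_%:E); exact: h0 (bump_support n abO).
  move=> /(cvg_lim (@ereal_hausdorff R)); rewrite lim_cst// => g0.
  rewrite [RHS]g0 /g -integral_mkcondr.
  by congr integral; apply/esym/setIidPr.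
have [a [b [S [OE SO]]]] := open_bigcup_obox oO.
suff hB k : S k -> ae_eq (leb d) (obox (a k) (b k)) h (cst 0).
  rewrite OE; apply: (@negligibleS _ _ _ _ (\bigcup_k (if k \in S then obox (a k) (b k) `&` [set x | h x <> 0] else set0))).
    move=> x /= /not_implyP[[k Sk kx] hx]; exists k => //.
    by rewrite mem_set.
  apply: negligible_bigcup => k; case: ifPn => [|_]; last exact: negligible_set0.
  rewrite inE => /hB; apply: negligibleS => x /= [xk hx].
  by apply/not_implyP.
move=> Sk; set B := obox (a k) (b k).
have mB : measurable B := obox_measurable _ _.
have BO : B `<=` O.
  by move=> x xab; apply: (SO _ Sk) => i; have /andP[/ltW -> /ltW ->] := xab i.
have ihB : (leb d).-integrable B (EFin \o h) by exact: integrableS ih.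
pose hb := (EFin \o h) \_ B.
have ihb : (leb d).-integrable setT hb by apply/(integrable_mkcond _ mB).
have hb0 A : measurable A -> (\int[leb d]_(x in A) hb x = 0)%E.
  move=> mA; have : <<s boxes >> A by rewrite -measurable_rVE.
  move: A {mA}; apply: (@dynkin_induction _ _ boxes
    (fun A => (\int[leb d]_(x in A) hb x = 0)%E) measurable_rVE setI_boxes).
  - rewrite /hb -integral_mkcond; apply: box0; exact: SO.
  - move=> _ [a' [b' ->]]; rewrite /hb -integral_mkcondr.
    rewrite (_ : obox a' b' `&` B = obox (\row_i Num.max (a' ord0 i) (a k ord0 i))
        (\row_i Num.min (b' ord0 i) (b k ord0 i))) ?setI_obox//.
    apply: box0 => x xab; apply: (SO _ Sk) => i; have := xab i.
    by rewrite !mxE ge_max le_min => /andP[/andP[_ ->] /andP[_ ->]].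
  - move=> A mA A0.
    have mhb := measurable_int _ ihb.
    have := @integral_setU _ _ _ (leb d) A (~` A) hb mA (measurableC mA).
    rewrite setUCr A0 add0e => <- //; last by apply/disj_setPCl.
    by rewrite /hb -integral_mkcond; apply: box0; exact: SO.
  - move=> F mF tF F0; rewrite integral_bigcup//.
      by rewrite eseries0// => i _ _; exact: F0.
    by apply: integrableS ihb => //; exact: bigcup_measurable.
have := @integral_ae_eq _ _ _ (leb d) B mB (cst 0%E) (EFin \o h) ihB (measurable_cst _).
move=> H; have {H} : ae_eq (leb d) B (EFin \o h) (cst 0%E).
  apply: H => A AB mA; rewrite integral0 -(hb0 A mA) /hb -integral_mkcondr.
  by congr integral; apply/esym/setIidPl.
by apply: filterS => x /= /[apply] -[].
Qed.
End bumps.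

(** * Square-integrable functions on a bounded open set *)
Definition bounded_open {R : realType} {d : nat} (D : set 'rV[R]_d) :=
  open D /\ exists L : R, forall x, D x -> forall i, `|x ord0 i| <= L.

Definition ae_bounded {R : realType} {d : nat} (D : set 'rV[R]_d) (K : R)
    (b : 'rV[R]_d -> R) :=
  measurable_fun D b /\ {ae leb d, forall x, D x -> `|b x| <= K}.

Section L2_theory.
Context {R : realType} {d : nat} {D : set 'rV[R]_d}.
Hypothesis bD : bounded_open D.
Local Notation E := 'rV[R]_d.
Implicit Types u v w b : E -> R.

Lemma bounded_open_measurable : measurable D.
Proof. by apply: open_measurable_rV; exact: bD.1. Qed.
Local Notation mD := bounded_open_measurable.

Lemma bounded_open_lty : (leb d D < +oo)%E.
Proof.
have [_ [L DL]] := bD; apply: le_lt_trans (leb_cube_lty d L).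
apply: le_measure; rewrite ?inE//; first exact: mD.
by rewrite cube_cbox; apply: closed_measurable_rV; exact: closed_cbox.
Qed.

Lemma continuous_bounded_on u : continuous u ->
  exists M, forall x, D x -> `|u x| <= M.
Proof.
move=> cu; have [_ [L DL]] := bD.
have [|M uM] := continuous_compact_bound (K := [set x : E | forall i, `|x ord0 i| <= L]) _ cu.
  by rewrite cube_cbox; exact: compact_cbox.
by exists M => x /DL; exact: uM.
Qed.

Lemma L2_sqr_integrable u : L2 D u -> (leb d).-integrable D (EFin \o (fun x => u x ^+ 2)).
Proof.
move=> [mu iu]; apply/integrableP; split.
  by apply/measurable_EFinP; exact: measurable_funX.
under eq_integral do rewrite /= ger0_norm ?sqr_ge0//.
exact: iu.
Qed.

Lemma sqr_integrable_L2 u : measurable_fun D u ->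
  (leb d).-integrable D (EFin \o (fun x => u x ^+ 2)) -> L2 D u.
Proof.
move=> mu /integrableP[_ iu]; split => //; move: iu.
by under eq_integral do rewrite /= ger0_norm ?sqr_ge0//.
Qed.

Lemma L2_bounded u (M : R) : measurable_fun D u ->
  (forall x, D x -> `|u x| <= M) -> L2 D u.
Proof.
move=> mu uM; apply: sqr_integrable_L2 => //.
apply: (bounded_integrable (M := M ^+ 2)).
- exact: mD.
- exact: bounded_open_lty.
- exact: measurable_funX.
- move=> x Dx; rewrite normrX ler_sqr ?nnegrE ?uM//.
  exact: le_trans (uM x Dx).
Qed.

Lemma L2_continuous u : continuous u -> L2 D u.
Proof.
move=> cu; have [M uM] := continuous_bounded_on cu; apply: L2_bounded uM.
by apply: measurable_funTS; exact: continuous_measurable_rV.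
Qed.

Lemma L2_mul_integrable u v : L2 D u -> L2 D v ->
  (leb d).-integrable D (EFin \o (fun x => u x * v x)).
Proof.
move=> Lu Lv; have [mu _] := Lu; have [mv _] := Lv.
have iuv := integrableD mD (L2_sqr_integrable Lu) (L2_sqr_integrable Lv).
apply: le_integrable iuv => //; first exact: mD.
  by apply/measurable_EFinP; exact: measurable_funM.
move=> x Dx /=; rewrite lee_fin.
rewrite [leRHS]ger0_norm ?addr_ge0 ?sqr_ge0// normrM -(real_normK (num_real (u x))).
rewrite -(real_normK (num_real (v x))).
have := normr_ge0 (u x); have := normr_ge0 (v x); nra.
Qed.

Lemma L2Z (c : R) u : L2 D u -> L2 D (fun x => c * u x).
Proof.
move=> Lu; have [mu _] := Lu; apply: sqr_integrable_L2.
  by apply: measurable_funM => //; exact: measurable_cst.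
have := integrableZl mD (c ^+ 2) (L2_sqr_integrable Lu).
by apply: eq_integrable => // [|x Dx /=]; [exact: mD|rewrite exprMn EFinM].
Qed.

Lemma L2D u v : L2 D u -> L2 D v -> L2 D (fun x => u x + v x).
Proof.
move=> Lu Lv; have [mu _] := Lu; have [mv _] := Lv.
apply: sqr_integrable_L2; first exact: measurable_funD.
have H := integrableD mD (L2_sqr_integrable Lu) (L2_sqr_integrable Lv).
have := integrableD mD H (integrableZl mD 2 (L2_mul_integrable Lu Lv)).
apply: eq_integrable => // [|x Dx /=]; first exact: mD.
by rewrite -EFinM -!EFinD; congr EFin; ring.
Qed.

Lemma L2_0 : L2 D (fun _ => 0).
Proof. by apply: L2_continuous; exact: cst_continuous. Qed.

Lemma L2_sum I (r : seq I) (F : I -> E -> R) : (forall i, L2 D (F i)) ->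
  L2 D (fun x => \sum_(i <- r) F i x).
Proof.
move=> LF; elim: r => [|i r IH].
  by under eq_fun do rewrite big_nil; exact: L2_0.
by under eq_fun do rewrite big_cons; exact: L2D.
Qed.

Lemma L2N u : L2 D u -> L2 D (fun x => - u x).
Proof. by move=> /(L2Z (-1)); under eq_fun do rewrite mulN1r. Qed.

Lemma L2B u v : L2 D u -> L2 D v -> L2 D (fun x => u x - v x).
Proof. by move=> Lu Lv; apply: L2D => //; exact: L2N. Qed.

Lemma L2_integrable u : L2 D u -> (leb d).-integrable D (EFin \o u).
Proof.
move=> Lu; have L1 : L2 D (fun=> 1) by apply: L2_continuous; exact: cst_continuous.
have := L2_mul_integrable Lu L1.
by under eq_fun do rewrite mulr1.
Qed.

Lemma L2_bmul (K : R) b u : ae_bounded D K b -> L2 D u -> L2 D (fun x => b x * u x).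
Proof.
move=> [mb bK] Lu; have [mu _] := Lu.
split; first exact: measurable_funM.
have /integrableP[_] := integrableZl mD (K ^+ 2) (L2_sqr_integrable Lu).
apply: le_lt_trans; apply: ae_ge0_le_integral => //.
- exact: mD.
- by move=> x _; rewrite lee_fin sqr_ge0.
- by apply/measurable_EFinP; apply: measurable_funX; exact: measurable_funM.
- apply: measurableT_comp => //; apply/measurable_EFinP.
  apply: measurable_funM; [exact: measurable_cst|exact: measurable_funX].
- apply: filterS bK => x /= bK Dx; rewrite lee_fin -exprMn.
  rewrite ger0_norm ?sqr_ge0// !exprMn ler_wpM2r ?sqr_ge0//.
  rewrite -(real_normK (num_real (b x))) ler_sqr ?nnegrE ?bK//.
  exact: le_trans (bK Dx).
Qed.

(** * The L2 inner product *)
Lemma sipC u v : sip D u v = sip D v u.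
Proof. by apply: eq_Rintegral => x _; rewrite mulrC. Qed.

Lemma sipDl u v w : L2 D u -> L2 D v -> L2 D w ->
  sip D (fun x => u x + v x) w = sip D u w + sip D v w.
Proof.
move=> Lu Lv Lw; rewrite /sip -(RintegralD mD (L2_mul_integrable Lu Lw) (L2_mul_integrable Lv Lw)).
by apply: eq_Rintegral => x _; rewrite mulrDl.
Qed.

Lemma sipZl (c : R) u w : L2 D u -> L2 D w ->
  sip D (fun x => c * u x) w = c * sip D u w.
Proof.
move=> Lu Lw; rewrite /sip -(RintegralZl c mD (L2_mul_integrable Lu Lw)).
by apply: eq_Rintegral => x _; rewrite mulrA.
Qed.

Lemma sipNl u w : L2 D u -> L2 D w -> sip D (fun x => - u x) w = - sip D u w.
Proof.
by move=> Lu Lw; rewrite -mulN1r -sipZl//; apply: eq_Rintegral => x _; rewrite mulN1r.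
Qed.

Lemma sipBl u v w : L2 D u -> L2 D v -> L2 D w ->
  sip D (fun x => u x - v x) w = sip D u w - sip D v w.
Proof. by move=> Lu Lv Lw; rewrite sipDl// ?sipNl//; exact: L2N. Qed.

Lemma sip0l w : sip D (fun _ => 0) w = 0.
Proof. by rewrite /sip; under eq_Rintegral do rewrite mul0r; rewrite Rintegral_cst ?mul0r//; exact: mD. Qed.

Lemma sip_suml I (r : seq I) (F : I -> E -> R) w : (forall i, L2 D (F i)) ->
  L2 D w -> sip D (fun x => \sum_(i <- r) F i x) w = \sum_(i <- r) sip D (F i) w.
Proof.
move=> LF Lw; elim: r => [|i r IH].
  by under eq_fun do rewrite big_nil; rewrite big_nil sip0l.
by under eq_fun do rewrite big_cons; rewrite big_cons sipDl ?IH//; exact: L2_sum.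
Qed.

Lemma sip_ae u u' v v' : ae_eq (leb d) D u u' -> ae_eq (leb d) D v v' ->
  L2 D u -> L2 D u' -> L2 D v -> L2 D v' -> sip D u v = sip D u' v'.
Proof.
move=> uu vv Lu Lu' Lv Lv'; congr fine; apply: ae_eq_integral.
- exact: mD.
- exact: measurable_int (L2_mul_integrable Lu Lv).
- exact: measurable_int (L2_mul_integrable Lu' Lv').
- by apply: filterS2 uu vv => x /= uu vv Dx; rewrite uu// vv.
Qed.

Lemma sip_ge0 u : 0 <= sip D u u.
Proof. by apply: Rintegral_ge0 => x _; rewrite -expr2 sqr_ge0. Qed.

Lemma snorm_ge0 u : 0 <= snorm D u.
Proof. exact: sqrtr_ge0. Qed.

Lemma snorm_sqr u : snorm D u ^+ 2 = sip D u u.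
Proof. by rewrite /snorm sqr_sqrtr ?sip_ge0. Qed.

Lemma cauchy_schwarz u v : L2 D u -> L2 D v ->
  `|sip D u v| <= snorm D u * snorm D v.
Proof.
move=> Lu Lv.
have key (t : R) : 0 <= sip D u u + 2 * t * sip D u v + t ^+ 2 * sip D v v.
  pose w x := u x + t * v x.
  have Lw : L2 D w by apply: L2D => //; exact: L2Z.
  have wE z : L2 D z -> sip D w z = sip D u z + t * sip D v z.
    by move=> Lz; rewrite sipDl ?sipZl//; exact: L2Z.
  have := sip_ge0 w; rewrite wE// (sipC u) (sipC v) !wE// (sipC v u).
  by congr (_ <= _); ring.
have uu := sip_ge0 u; have vv := sip_ge0 v.
rewrite -(ler_sqr (x := `|_|)) ?nnegrE ?mulr_ge0 ?snorm_ge0//.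
rewrite exprMn !snorm_sqr real_normK ?num_real//.
have [v0|v0] := eqVneq (sip D v v) 0.
  have [->|s0] := eqVneq (sip D u v) 0; first by rewrite expr0n/= mulr_ge0.
  have := key (- (sip D u u + 1) / (2 * sip D u v)); rewrite v0 mulr0 addr0.
  have -> : 2 * (- (sip D u u + 1) / (2 * sip D u v)) * sip D u v = - (sip D u u + 1) by field.
  lra.
have v1 : 0 < sip D v v by rewrite lt0r v0.
have := key (- sip D u v / sip D v v).
have -> : sip D u u + 2 * (- sip D u v / sip D v v) * sip D u v +
  (- sip D u v / sip D v v) ^+ 2 * sip D v v = (sip D u u * sip D v v - sip D u v ^+ 2) / sip D v v.
  by field.
by rewrite pmulr_lge0 ?invr_gt0// subr_ge0.
Qed.
End L2_theory.

(** * Weak derivatives *)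
Section test_functions.
Context {R : realType} {d : nat}.
Local Notation E := 'rV[R]_d.
Implicit Types (O D : set E) (f chi : E -> R).

Lemma C1cW O D chi : O `<=` D -> C1c O chi -> C1c D chi.
Proof. by move=> OD [C1chi cchi sub]; split => //; exact: subset_trans sub OD. Qed.

Lemma C1c_out O chi x : C1c O chi -> ~ O x -> chi x = 0.
Proof.
move=> [_ _ sub] Ox; apply: contrapT => /eqP x0; apply: Ox; apply: sub.
exact: subset_closure.
Qed.

Lemma C1c_derive_out O chi v x : C1c O chi -> ~ O x -> 'D_v chi x = 0.
Proof.
move=> [_ _ sub] Ox; rewrite (@near_eq_derive _ _ _ chi (cst 0)); first exact: derive_cst.
have : open (~` closure [set x | chi x != 0]) by apply: closed_openC; exact: closed_closure.
rewrite openE => /(_ x); rewrite /interior => H.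
have /H : (~` closure [set x | chi x != 0]) x by move=> /sub.
apply: filterS => y /= yc; apply: contrapT => /eqP y0; apply: yc.
exact: subset_closure.
Qed.

Lemma C1c_cube O chi : C1c O chi ->
  exists L : R, forall (x : E) i, L < `|x ord0 i| -> chi x = 0.
Proof.
move=> [_ cK _].
have [M cM] : exists M : R, forall i (x : E), closure [set x | chi x != 0] x -> `|x ord0 i| <= M.
  have /choice[M cM] (i : 'I_d) : exists M : R,
      forall x : E, closure [set x | chi x != 0] x -> `|x ord0 i| <= M.
    by apply: continuous_compact_bound => //; exact: coord_continuous.
  exists (\sum_i `|M i|) => i x /(cM i)/le_trans; apply.
  by rewrite (le_trans (ler_norm _))// (bigD1 i)//= lerDl sumr_ge0.
exists M => x i xM; apply: contrapT => /eqP x0; move: xM; apply/negP; rewrite -leNgt.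
by apply: cM; exact: subset_closure.
Qed.

Lemma C1c_mul O f chi : C1 f -> C1c O chi -> C1c O (fun x => f x * chi x).
Proof.
move=> Cf [Cchi cK sub].
have sub' : closure [set x | f x * chi x != 0] `<=` closure [set x | chi x != 0].
  by apply: closure_subset => x /=; rewrite mulf_eq0 negb_or => /andP[].
split; [exact: C1M| |exact: subset_trans sub].
by apply: subclosed_compact sub' => //; exact: closed_closure.
Qed.

Lemma integral_C1c O chi i : C1c O chi -> \int[leb d]_x 'D_(ebase i) chi x = 0.
Proof.
move=> Cc; have [[cc dc] _ _] := Cc; have [L cL] := C1c_cube Cc.
by rewrite /Rintegral (@integral_partial0 _ _ i chi L)//; [exact: (dc i).1|exact: (dc i).2].
Qed.

Lemma Rintegral_out D f : (forall x, ~ D x -> f x = 0) ->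
  \int[leb d]_(x in D) f x = \int[leb d]_x f x.
Proof.
move=> f0; rewrite Rintegral_mkcond; apply: eq_Rintegral => x _.
by rewrite patchE; case: ifPn => //; rewrite notin_setE => /f0.
Qed.

Lemma sip_out O D f chi : O `<=` D -> (forall x, ~ O x -> chi x = 0) ->
  sip D f chi = sip O f chi.
Proof.
move=> OD c0; rewrite /sip (@Rintegral_out D) ?(@Rintegral_out O)// => x Ox.
  by rewrite c0 ?mulr0.
by rewrite c0 ?mulr0// => /OD.
Qed.

(** The derivative of the product integrates to zero. *)
Lemma C1_by_parts O f chi i : C1 f -> C1c O chi ->
  sip O f ('D_(ebase i) chi) = - sip O ('D_(ebase i) f) chi.
Proof.
move=> Cf Cc; have [cf df] := Cf; have [[cc dc] _ _] := Cc.
have [L cL] := C1c_cube Cc.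
apply/eqP; rewrite -addr_eq0 /sip !(@Rintegral_out O); last 2 first.
- by move=> x Ox; rewrite (C1c_out Cc)// mulr0.
- by move=> x Ox; rewrite (C1c_derive_out _ Cc)// mulr0.
rewrite -RintegralD//; last 2 first.
- apply: (integrable_cube (L := L)).
    by apply: ctsM => //; exact: (dc i).2.
  by move=> x j xL; rewrite (derive_eq0_out cL _ xL) mulr0.
- apply: (integrable_cube (L := L)).
    by apply: ctsM => //; exact: (df i).2.
  by move=> x j xL; rewrite (cL _ _ xL) mulr0.
rewrite -[X in _ == X](integral_C1c i (C1c_mul Cf Cc)); apply/eqP.
apply: eq_Rintegral => x _; rewrite derive_mul//.
by rewrite (mulrC (chi x)).
Qed.

End test_functions.

Section weak_derivatives.
Context {R : realType} {d : nat} {D : set 'rV[R]_d}.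
Hypothesis bD : bounded_open D.
Local Notation E := 'rV[R]_d.
Implicit Types u v w g : E -> R.
Local Notation mD := (bounded_open_measurable bD).

Lemma L2_derive f i : C1 f -> L2 D ('D_(ebase i) f).
Proof. by move=> [_ df]; exact: (L2_continuous bD (df i).2). Qed.

Lemma L2_C1 f : C1 f -> L2 D f.
Proof. by move=> [cf _]; exact: (L2_continuous bD cf). Qed.

Lemma L2_subset O u : O `<=` D -> measurable O -> L2 D u -> L2 O u.
Proof.
move=> OD mO Lu; have [mu _] := Lu.
apply: sqr_integrable_L2; first exact: (measurable_funS mD OD mu).
by apply: integrableS (L2_sqr_integrable Lu) => //; exact: mD.
Qed.

Lemma ae_eq_of_tests O g g' : open O -> O `<=` D -> L2 D g -> L2 D g' ->
  (forall chi, C1c O chi -> sip O g chi = sip O g' chi) ->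
  ae_eq (leb d) O g g'.
Proof.
move=> oO OD Lg Lg' gg.
have mO := open_measurable_rV oO.
have bO : bounded_open O.
  by split => //; have [_ [L DL]] := bD; exists L => x /OD; exact: DL.
have Lgg : L2 O (fun x => g x - g' x).
  by apply: L2_subset => //; exact: L2B.
have := @fundamental_lemma _ _ O (fun x => g x - g' x) oO (L2_integrable bO Lgg).
move=> H; have {H} : ae_eq (leb d) O (fun x => g x - g' x) (cst 0).
  apply: H => chi Cc.
  have Lc : L2 O chi by have [[cc _] _ _] := Cc; exact: (L2_continuous bO cc).
  rewrite -[LHS]/(sip O (fun x => g x - g' x) chi).
  by rewrite (sipBl bO) ?gg ?subrr//; exact: L2_subset.
by apply: filterS => x /= /[apply] /eqP; rewrite subr_eq0 => /eqP.
Qed.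

Lemma weak_partial_unique i u g g' : L2 D g -> L2 D g' ->
  weak_partial D i u g -> weak_partial D i u g' -> ae_eq (leb d) D g g'.
Proof.
move=> Lg Lg' wg wg'; apply: ae_eq_of_tests => //; first exact: bD.1.
by move=> chi Cc; apply: oppr_inj; rewrite -wg// wg'.
Qed.

Lemma H1_L2 u : H1 D u -> L2 D u. Proof. by case. Qed.

Lemma partialP i u : H1 D u ->
  L2 D (partial D i u) /\ weak_partial D i u (partial D i u).
Proof.
move=> [_ /(_ i) uP].
exact: (@xgetPex _ _ [set g | L2 D g /\ weak_partial D i u g] uP).
Qed.

Lemma L2_partial i u : H1 D u -> L2 D (partial D i u).
Proof. by move=> /(partialP i)[]. Qed.

Lemma partial_ae i u g : H1 D u -> L2 D g -> weak_partial D i u g ->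
  ae_eq (leb d) D (partial D i u) g.
Proof.
by move=> Hu Lg wg; have [Lp wp] := partialP i Hu; exact: weak_partial_unique wg.
Qed.

Lemma weak_partial_lin i (a : R) u v g k : L2 D u -> L2 D v -> L2 D g -> L2 D k ->
  weak_partial D i u g -> weak_partial D i v k ->
  weak_partial D i (fun x => a * u x + v x) (fun x => a * g x + k x).
Proof.
move=> Lu Lv Lg Lk wg wk chi Cc.
have Lc : L2 D chi by apply: L2_C1; case: Cc.
have Ldc : L2 D ('D_(ebase i) chi) by apply: L2_derive; case: Cc.
rewrite !(sipDl bD) ?(sipZl bD) ?wg ?wk//; try exact: L2Z.
by rewrite mulrN opprD.
Qed.

Lemma H1_lin (a : R) u v : H1 D u -> H1 D v -> H1 D (fun x => a * u x + v x).
Proof.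
move=> Hu Hv; split; first by apply: L2D => //; [apply: L2Z => //; case: Hu|case: Hv].
move=> i; exists (fun x => a * partial D i u x + partial D i v x).
have [Lu wu] := partialP i Hu; have [Lv wv] := partialP i Hv.
split; first by apply: L2D => //; exact: L2Z.
by apply: weak_partial_lin => //; [case: Hu|case: Hv].
Qed.

Lemma partial_lin i (a : R) u v : H1 D u -> H1 D v ->
  ae_eq (leb d) D (partial D i (fun x => a * u x + v x))
    (fun x => a * partial D i u x + partial D i v x).
Proof.
move=> Hu Hv; have [Lu wu] := partialP i Hu; have [Lv wv] := partialP i Hv.
apply: partial_ae; first exact: H1_lin.
  by apply: L2D => //; exact: L2Z.
by apply: weak_partial_lin => //; [case: Hu|case: Hv].
Qed.

Lemma C1_weak_partial i f : C1 f -> weak_partial D i f ('D_(ebase i) f).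
Proof. by move=> Cf chi Cc; exact: C1_by_parts. Qed.

Lemma C1_H1 f : C1 f -> H1 D f.
Proof.
move=> Cf; split=> [|i]; first exact: L2_C1.
by exists ('D_(ebase i) f); split; [exact: L2_derive|exact: C1_weak_partial].
Qed.

Lemma partial_C1 i f : C1 f -> ae_eq (leb d) D (partial D i f) ('D_(ebase i) f).
Proof.
move=> Cf; apply: partial_ae; [exact: C1_H1|exact: L2_derive|exact: C1_weak_partial].
Qed.

(** Test functions supported in O do not see u outside O, and on O both
    derivatives have the same pairings with them. *)
Lemma partial_local O i u f : open O -> O `<=` D -> H1 D u -> C1 f ->
  (forall x, O x -> u x = f x) ->
  ae_eq (leb d) O (partial D i u) ('D_(ebase i) f).
Proof.
move=> oO OD Hu Cf uf; have [Lp wp] := partialP i Hu.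
apply: ae_eq_of_tests => //; first exact: L2_derive.
move=> chi Cc; have CcD := C1cW OD Cc.
apply: oppr_inj; rewrite -C1_by_parts// -(sip_out _ OD); last first.
  by move=> x; exact: C1c_out Cc.
rewrite -wp// (sip_out _ OD); last by move=> x; exact: C1c_derive_out Cc.
by apply: eq_Rintegral => x /set_mem/uf ->.
Qed.

End weak_derivatives.

(** * Functions vanishing on the boundary *)
Section H10_theory.
Context {R : realType} {d : nat} {D : set 'rV[R]_d}.
Hypothesis bD : bounded_open D.
Local Notation E := 'rV[R]_d.
Implicit Types u v w g b : E -> R.

Lemma snorm_triangle u v : L2 D u -> L2 D v ->
  snorm D (fun x => u x + v x) <= snorm D u + snorm D v.
Proof.
move=> Lu Lv; have u0 := snorm_ge0 (D := D) u; have v0 := snorm_ge0 (D := D) v.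
rewrite -ler_sqr ?nnegrE ?addr_ge0 ?snorm_ge0// snorm_sqr.
have Luv := L2D bD Lu Lv.
rewrite (sipDl bD)// (sipC u) (sipC v) !(sipDl bD)// sqrrD !snorm_sqr (sipC v u).
have := le_trans (ler_norm _) (cauchy_schwarz bD Lu Lv); lra.
Qed.

Lemma snorm_bmul (K : R) b u : 0 <= K -> ae_bounded D K b -> L2 D u ->
  snorm D (fun x => b x * u x) <= K * snorm D u.
Proof.
move=> K0 bK Lu; have Lbu := L2_bmul bD bK Lu.
rewrite -ler_sqr ?nnegrE ?mulr_ge0 ?snorm_ge0// exprMn !snorm_sqr.
rewrite /sip -(RintegralZl (K ^+ 2) (bounded_open_measurable bD) (L2_mul_integrable bD Lu Lu)).
have mD := bounded_open_measurable bD.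
rewrite /Rintegral; apply: fine_le.
- exact: integrable_fin_num (L2_mul_integrable bD Lbu Lbu).
- by apply: integrable_fin_num => //; exact: (integrableZl mD (K ^+ 2) (L2_mul_integrable bD Lu Lu)).
- apply: ae_ge0_le_integral => //.
  + by move=> x _; rewrite lee_fin -expr2 sqr_ge0.
  + exact: measurable_int (L2_mul_integrable bD Lbu Lbu).
  + by move=> x _; rewrite lee_fin -expr2 mulr_ge0 ?sqr_ge0.
  + exact: measurable_int (integrableZl mD (K ^+ 2) (L2_mul_integrable bD Lu Lu)).
  + case: bK => _; apply: filterS => x /= bx Dx; rewrite lee_fin -!expr2 exprMn.
    rewrite ler_wpM2r ?sqr_ge0// -(real_normK (num_real (b x))).
    by rewrite ler_sqr ?nnegrE ?bx.
Qed.

Lemma snorm_ae u v : L2 D u -> L2 D v -> ae_eq (leb d) D u v -> snorm D u = snorm D v.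
Proof. by move=> Lu Lv uv; congr Num.sqrt; exact: sip_ae. Qed.

Lemma H10_approx u (e : R) : H10 D u -> 0 < e ->
  exists phi, [/\ C1c D phi, snorm D (fun x => phi x - u x) <= e &
    forall i, snorm D (partial D i (fun x => phi x - u x)) <= e].
Proof.
move=> [Hu [phi [Cphi /cvgrPdist_le phiu]]] e0.
have [k _ /(_ k (leqnn k))] := phiu _ e0.
rewrite /= sub0r normrN ger0_norm ?sqrtr_ge0// => He.
set w := fun x => phi k x - u x in He *.
have He2 : snorm D w ^+ 2 + \sum_(i < d) snorm D (partial D i w) ^+ 2 <= e ^+ 2.
  rewrite -(@sqr_sqrtr _ (_ + _)); first by rewrite ler_sqr ?nnegrE ?sqrtr_ge0 ?(ltW e0).
  by rewrite addr_ge0 ?sqr_ge0// sumr_ge0// => i _; exact: sqr_ge0.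
exists (phi k); split => // [|i]; rewrite -ler_sqr ?nnegrE ?snorm_ge0 ?(ltW e0)//.
  by apply: le_trans He2; rewrite lerDl sumr_ge0// => i _; exact: sqr_ge0.
apply: le_trans He2; rewrite (bigD1 i)//= addrCA lerDl addr_ge0 ?sqr_ge0//.
by rewrite sumr_ge0// => j _; exact: sqr_ge0.
Qed.

Lemma C1c_H1 phi : C1c D phi -> H1 D phi.
Proof. by case=> C1phi _ _; exact: C1_H1. Qed.

Lemma H1B u v : H1 D u -> H1 D v -> H1 D (fun x => u x - v x).
Proof.
move=> Hu Hv; have := H1_lin bD (-1) Hv Hu.
by under eq_fun do rewrite mulN1r addrC.
Qed.

Lemma partialD i u v : H1 D u -> H1 D v ->
  ae_eq (leb d) D (partial D i (fun x => u x + v x))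
    (fun x => partial D i u x + partial D i v x).
Proof.
move=> Hu Hv; have := partial_lin bD i 1 Hu Hv.
rewrite (_ : (fun x => 1 * u x + v x) = fun x => u x + v x); last first.
  by apply/funext => x; rewrite mul1r.
by rewrite (_ : (fun x => 1 * _ + _) = fun x => partial D i u x + partial D i v x)//;
   apply/funext => x; rewrite mul1r.
Qed.

(** Integrate by parts the square of the function against the coordinate x_k,
    which is bounded on D. *)
Lemma poincare_C1c (k : 'I_d) (L : R) phi : 0 <= L ->
  (forall x, D x -> forall i, `|x ord0 i| <= L) -> C1c D phi ->
  snorm D phi <= 2 * L * snorm D ('D_(ebase k) phi).
Proof.
move=> L0 DL Cc; have [Cphi _ _] := Cc.
have Lphi := L2_C1 bD Cphi; have Ldphi := L2_derive bD k Cphi.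
pose X (x : E) : R := x ord0 k.
have dX (t : R) : is_derive t 1 (fun s : R => s) (cst 1 t) by exact: is_derive_id.
have CX : C1 X by apply: (C1_coord k dX); exact: cst_continuous.
have bX : ae_bounded D L X.
  split; first by apply: measurable_funTS; exact: continuous_measurable_rV CX.1.
  by apply: aeW => x Dx; exact: DL.
have LX := L2_bmul bD bX Lphi.
have := C1_by_parts k CX (C1c_mul Cphi Cc).
have -> : sip D ('D_(ebase k) X) (fun x => phi x * phi x) = sip D phi phi.
  apply: eq_Rintegral => x _.
  by rewrite (derive_coord k dX)// eqxx mul1r.
have -> : sip D X ('D_(ebase k) (fun x => phi x * phi x)) =
    2 * sip D (fun x => X x * phi x) ('D_(ebase k) phi).
  rewrite -(sipZl bD 2 LX Ldphi); apply: eq_Rintegral => x _.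
  rewrite (derive_mul k x Cphi Cphi).
  by move: ('D_(ebase k) phi x) (phi x) (X x) => p q r; ring.
move=> H.
have sE : snorm D phi * snorm D phi <= 2 * L * snorm D ('D_(ebase k) phi) * snorm D phi.
  rewrite -expr2 snorm_sqr -[leLHS]opprK -H -mulrN.
  rewrite (mulrAC (2 * L)) -!mulrA ler_wpM2l// mulrA.
  apply: (le_trans (ler_norm _)); rewrite normrN.
  apply: (le_trans (cauchy_schwarz bD LX Ldphi)).
  by rewrite ler_wpM2r ?snorm_ge0// snorm_bmul.
have [p0|p0] := eqVneq (snorm D phi) 0.
  by rewrite p0 !mulr_ge0 ?snorm_ge0.
by move: sE; rewrite ler_pM2r// lt0r p0 snorm_ge0.
Qed.

(** By approximation with test functions: the constant does not depend on the
    function. *)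
Lemma poincare (k : 'I_d) (L : R) u : 0 <= L ->
  (forall x, D x -> forall i, `|x ord0 i| <= L) -> H10 D u ->
  snorm D u <= 2 * L * snorm D (partial D k u).
Proof.
move=> L0 DL H10u; have [Hu _] := H10u.
have Lu := H1_L2 Hu; have Lpu := L2_partial k Hu.
apply/ler_addgt0Pr => e e0.
have L1 : 0 < 2 * L + 1 by rewrite ltr_wpDl// mulr_ge0.
have [phi [Cc pu dpu]] := H10_approx H10u (divr_gt0 e0 L1).
have Hp := C1c_H1 Cc; have [Cphi _ _] := Cc.
have Lw : L2 D (fun x => phi x - u x) by exact: H1_L2 (H1B Hp Hu).
have up : snorm D u <= snorm D phi + e / (2 * L + 1).
  have := snorm_triangle (H1_L2 Hp) (L2N bD Lw).
  rewrite (_ : (fun x => _ + _) = u); last by apply/funext => x; ring.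
  move/le_trans; apply; rewrite lerD2l (le_trans _ pu)//.
  rewrite (_ : (fun x => - _) = fun x => (-1) * (phi x - u x)); last by apply/funext => x; ring.
  have -> : snorm D (fun x => -1 * (phi x - u x)) = snorm D (fun x => phi x - u x) => //.
  by congr Num.sqrt; apply: eq_Rintegral => x _; ring.
have dp : snorm D ('D_(ebase k) phi) <= snorm D (partial D k u) + e / (2 * L + 1).
  rewrite -(snorm_ae (L2_partial k Hp) (L2_derive bD k Cphi) (partial_C1 bD k Cphi)).
  have Lpw := L2_partial k (H1B Hp Hu).
  have := snorm_triangle Lpu Lpw.
  have -> : snorm D (fun x => partial D k u x + partial D k (fun x => phi x - u x) x)
      = snorm D (partial D k phi).
    apply: (snorm_ae (L2D bD Lpu Lpw) (L2_partial k Hp)).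
    have := partialD k Hu (H1B Hp Hu).
    rewrite (_ : (fun x => u x + _) = phi); last by apply/funext => x; ring.
    by apply: filterS => x /= + Dx => ->.
  by move/le_trans; apply; rewrite lerD2l.
have := poincare_C1c k L0 DL Cc.
have : 2 * L * snorm D ('D_(ebase k) phi) <= 2 * L * (snorm D (partial D k u) + e / (2 * L + 1)).
  by rewrite ler_wpM2l// mulr_ge0.
have eE : 2 * L * (e / (2 * L + 1)) + e / (2 * L + 1) = e.
  by rewrite -[X in _ + X]mul1r -mulrDl mulrC divfK// gt_eqF.
move: up eE {dp}; move: (e / _) => c up eE; rewrite mulrDr; lra.
Qed.

End H10_theory.

(** * The transport form *)
Section transport.
Context {R : realType} {d : nat} {D : set 'rV[R]_d}.
Hypothesis bD : bounded_open D.
Local Notation E := 'rV[R]_d.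
Implicit Types u v w g : E -> R.
Variables (a : 'I_d -> E -> R) (b : E -> R) (Ka Kb : R).
Hypotheses (Ha : forall k, H1 D (a k)) (ba : forall k, ae_bounded D Ka (a k)).
Hypotheses (bb : ae_bounded D Kb b) (Ka0 : 0 <= Ka) (Kb0 : 0 <= Kb).
Hypothesis bE : ae_eq (leb d) D b (fun x => \sum_k partial D k (a k) x).

(** The integral of div (w v a) expanded by the product rule, with b for the
    divergence of a. *)
Definition transport w v : R :=
  \sum_k (sip D (fun x => a k x * partial D k w x) v +
          sip D (fun x => a k x * partial D k v x) w) +
  sip D (fun x => b x * w x) v.

Let La k w : H1 D w -> L2 D (fun x => a k x * partial D k w x).
Proof. by move=> Hw; exact: (L2_bmul bD (ba k) (L2_partial k Hw)). Qed.

Let Lb w : H1 D w -> L2 D (fun x => b x * w x).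
Proof. by move=> Hw; exact: (L2_bmul bD bb (H1_L2 Hw)). Qed.

Lemma transport_sym w v : transport w v = transport v w.
Proof.
congr (_ + _); first by apply: eq_bigr => k _; rewrite addrC.
by apply: eq_Rintegral => x _; rewrite mulrAC.
Qed.

Lemma H1D u v : H1 D u -> H1 D v -> H1 D (fun x => u x + v x).
Proof.
move=> Hu Hv; have := H1_lin bD 1 Hu Hv.
by under eq_fun do rewrite mul1r.
Qed.

Lemma transportDl w1 w2 v : H1 D w1 -> H1 D w2 -> H1 D v ->
  transport (fun x => w1 x + w2 x) v = transport w1 v + transport w2 v.
Proof.
move=> H1w H2w Hv; have Hw := H1D H1w H2w.
have Lw1 := H1_L2 H1w; have Lw2 := H1_L2 H2w; have Lv := H1_L2 Hv.
have bS : sip D (fun x => b x * (w1 x + w2 x)) v =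
    sip D (fun x => b x * w1 x) v + sip D (fun x => b x * w2 x) v.
  rewrite -(sipDl bD (Lb H1w) (Lb H2w) Lv).
  by apply: eq_Rintegral => x _; rewrite mulrDr.
rewrite /transport bS addrACA -big_split/=; congr (_ + _).
apply: eq_bigr => k _; rewrite addrACA; congr (_ + _); last first.
  by rewrite sipC (sipDl bD Lw1 Lw2 (La k Hv)) (sipC w1) (sipC w2).
rewrite -(sipDl bD (La k H1w) (La k H2w) Lv).
apply: sip_ae => //; last 2 first.
- exact: La.
- exact: (L2D bD (La k H1w) (La k H2w)).
- have := partialD bD k H1w H2w; apply: filterS => x /= + Dx => -> //.
  by rewrite mulrDr.
- exact: aeW.
Qed.

Lemma sip_bound (K : R) (c f g : E -> R) (n m : R) : 0 <= K -> ae_bounded D K c ->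
  L2 D f -> L2 D g -> 0 <= n -> snorm D f <= n -> snorm D g <= m ->
  `|sip D (fun x => c x * f x) g| <= K * (n * m).
Proof.
move=> K0 bc Lf Lg n0 fn gm.
apply: (le_trans (cauchy_schwarz bD (L2_bmul bD bc Lf) Lg)).
rewrite mulrA ler_pM ?snorm_ge0//.
by apply: (le_trans (snorm_bmul bD K0 bc Lf)); rewrite ler_wpM2l.
Qed.

Lemma transport_bound w v (n m : R) : H1 D w -> H1 D v ->
  snorm D w <= n -> (forall k, snorm D (partial D k w) <= n) ->
  snorm D v <= m -> (forall k, snorm D (partial D k v) <= m) ->
  `|transport w v| <= (\sum_(k < d) (Ka + Ka) + Kb) * (n * m).
Proof.
move=> Hw Hv wn dwn vm dvm.
have n0 : 0 <= n := le_trans (snorm_ge0 _) wn.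
have m0 : 0 <= m := le_trans (snorm_ge0 _) vm.
have Lw := H1_L2 Hw; have Lv := H1_L2 Hv.
rewrite mulrDl (le_trans (ler_normD _ _))// lerD//; last first.
  exact: sip_bound Kb0 bb Lw Lv n0 wn vm.
rewrite (le_trans (ler_norm_sum _ _ _))// mulr_suml ler_sum// => k _.
rewrite mulrDl (le_trans (ler_normD _ _))// lerD//.
  exact: sip_bound Ka0 (ba k) (L2_partial k Hw) Lv n0 (dwn k) vm.
rewrite (mulrC n).
exact: sip_bound Ka0 (ba k) (L2_partial k Hv) Lw m0 (dvm k) wn.
Qed.

Lemma transport_C1c phi psi : C1c D phi -> C1c D psi -> transport phi psi = 0.
Proof.
move=> Cphi Cpsi; have Hphi := C1c_H1 bD Cphi; have Hpsi := C1c_H1 bD Cpsi.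
have [C1phi _ _] := Cphi; have [C1psi _ _] := Cpsi.
have Lphi := H1_L2 Hphi; have Lpsi := H1_L2 Hpsi.
have Cpp := C1c_mul C1phi Cpsi.
have Lpp : L2 D (fun x => phi x * psi x) := L2_C1 bD (C1M C1phi C1psi).
have LS : L2 D (fun x => \sum_k partial D k (a k) x).
  by apply: (L2_sum bD) => k; exact: L2_partial.
have Lbb : L2 D b.
  have := L2_bmul bD bb (L2_C1 bD (C1_cst (d := d) (1 : R))).
  by under eq_fun do rewrite mulr1.
rewrite /transport.
have -> : sip D (fun x => b x * phi x) psi =
    \sum_k sip D (partial D k (a k)) (fun x => phi x * psi x).
  rewrite -(sip_suml bD _ (fun k => L2_partial k (Ha k)) Lpp).
  transitivity (sip D b (fun x => phi x * psi x)).
    by apply: eq_Rintegral => x _; rewrite mulrA.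
  by apply: (sip_ae bD bE) => //; exact: aeW.
rewrite -big_split/= big1// => k _.
have [_ wp] := partialP k (Ha k).
have := wp _ Cpp => /eqP; rewrite -addr_eq0 => /eqP <-; congr (_ + _).
have Ld f : C1 f -> L2 D (fun x => a k x * 'D_(ebase k) f x).
  by move=> Cf; exact: (L2_bmul bD (ba k) (L2_derive bD k Cf)).
have pE f g : C1 f -> L2 D g -> sip D (fun x => a k x * partial D k f x) g =
    sip D (fun x => a k x * 'D_(ebase k) f x) g.
  move=> Cf Lg; have Hf := C1_H1 bD Cf.
  apply: (sip_ae bD _ _ (La k Hf) (Ld _ Cf) Lg Lg); last exact: aeW.
  by have := partial_C1 bD k Cf; apply: filterS => x /= + Dx => ->.
rewrite (pE _ _ C1phi Lpsi) (pE _ _ C1psi Lphi).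
rewrite /sip -(RintegralD (bounded_open_measurable bD)
  (L2_mul_integrable bD (Ld _ C1phi) Lpsi) (L2_mul_integrable bD (Ld _ C1psi) Lphi)).
apply: eq_Rintegral => x _; rewrite (derive_mul k x C1phi C1psi).
by move: ('D_(ebase k) phi x) ('D_(ebase k) psi x) => p q; ring.
Qed.

Lemma H1_bound w : H1 D w -> exists n, [/\ snorm D w <= n,
    forall k, snorm D (partial D k w) <= n & 0 <= n].
Proof.
move=> Hw; exists (snorm D w + \sum_k snorm D (partial D k w)).
have S0 (P : pred 'I_d) : 0 <= \sum_(k | P k) snorm D (partial D k w).
  by rewrite sumr_ge0// => k _; exact: snorm_ge0.
split; rewrite ?addr_ge0 ?snorm_ge0//; first by rewrite lerDl.
by move=> k; rewrite (bigD1 k)//= addrCA lerDl addr_ge0 ?snorm_ge0.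
Qed.

(** On test functions this is the definition of the weak derivatives of the
    velocity; the form is continuous in the H^1 norm because the velocity and
    its divergence are bounded. *)
Lemma transport_H10 w v : H10 D w -> H10 D v -> transport w v = 0.
Proof.
move=> Zw Zv; have [Hw _] := Zw; have [Hv _] := Zv.
pose Kc := \sum_(k < d) (Ka + Ka) + Kb.
have Kc0 : 0 <= Kc by rewrite addr_ge0// sumr_ge0// => k _; rewrite addr_ge0.
have [n [wn dwn n0]] := H1_bound Hw.
have [m [vm dvm m0]] := H1_bound Hv.
apply/eqP; rewrite -normr_eq0 eq_le normr_ge0 andbT.
apply/ler_addgt0Pl => e e0; rewrite addr0.
have B0 : 0 < Kc * (n + 1 + m) + 1.
  by rewrite ltr_wpDl// mulr_ge0// addr_ge0// addr_ge0.
pose e1 := Num.min 1 (e / (Kc * (n + 1 + m) + 1)).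
have e10 : 0 < e1 by rewrite lt_min ltr01 divr_gt0.
have e11 : e1 <= 1 by rewrite ge_min lexx.
have [phi [Cphi wphi dwphi]] := H10_approx Zw e10.
have [psi [Cpsi vpsi dvpsi]] := H10_approx Zv e10.
have Hphi := C1c_H1 bD Cphi; have Hpsi := C1c_H1 bD Cpsi.
pose dw x := phi x - w x; pose dv x := psi x - v x.
have Hdw : H1 D dw := H1B bD Hphi Hw.
have Hdv : H1 D dv := H1B bD Hpsi Hv.
have phiE : phi = fun x => dw x + w x by apply/funext => x; rewrite /dw subrK.
have psiE : psi = fun x => dv x + v x by apply/funext => x; rewrite /dv subrK.
have phin : snorm D phi <= n + 1.
  rewrite phiE (le_trans (snorm_triangle bD (H1_L2 Hdw) (H1_L2 Hw)))// addrC lerD//.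
  exact: le_trans wphi e11.
have dphin k : snorm D (partial D k phi) <= n + 1.
  have Lw := L2_partial k Hw; have Ldw := L2_partial k Hdw.
  rewrite (snorm_ae bD (L2_partial k Hphi) (L2D bD Ldw Lw)).
    rewrite (le_trans (snorm_triangle bD Ldw Lw))// addrC lerD//.
    exact: le_trans (dwphi k) e11.
  by have := partialD bD k Hdw Hw; rewrite -phiE.
have E1 : transport phi v = - transport phi dv.
  have := transport_C1c Cphi Cpsi.
  rewrite psiE transport_sym (transportDl Hdv Hv Hphi).
  by rewrite (transport_sym dv) (transport_sym v) addrC => /eqP; rewrite addr_eq0 => /eqP.
have E2 : transport w v = - transport phi dv - transport dw v.
  have := transportDl Hdw Hw Hv; rewrite -phiE E1 => ->.
  by rewrite addrAC subrr add0r.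
rewrite E2 (le_trans (ler_normB _ _))// normrN.
have B1 := transport_bound Hphi Hdv phin dphin vpsi dvpsi.
have B2 := transport_bound Hdw Hv wphi dwphi vm dvm.
apply: (le_trans (lerD B1 B2)); rewrite -/Kc.
have : (Kc * (n + 1 + m) + 1) * e1 <= e.
  by rewrite mulrC -ler_pdivlMr// ge_min lexx orbT.
apply: le_trans; rewrite [leRHS]mulrDl mul1r ler_wpDr ?(ltW e10)//.
by rewrite -mulrDr (mulrC e1) -mulrDl -mulrA.
Qed.

End transport.

(** * Essentially bounded functions *)
Section essentially_bounded.
Context {R : realType} {d : nat} {D : set 'rV[R]_d}.
Hypothesis bD : bounded_open D.
Local Notation E := 'rV[R]_d.
Implicit Types f g : E -> R.
Local Notation mD := (bounded_open_measurable bD).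

Definition ess_bounded f := exists2 K : R, 0 <= K & ae_bounded D K f.

Lemma ess_bounded_cst (c : R) : ess_bounded (fun=> c).
Proof. by exists `|c| => //; split; [exact: measurable_cst|apply: aeW]. Qed.

Lemma ess_boundedD f g : ess_bounded f -> ess_bounded g ->
  ess_bounded (fun x => f x + g x).
Proof.
move=> [K K0 [mf fK]] [M M0 [mg gM]]; exists (K + M); first exact: addr_ge0.
split; first exact: measurable_funD.
apply: filterS2 fK gM => x /= fK gM Dx.
by rewrite (le_trans (ler_normD _ _))// lerD ?fK ?gM.
Qed.

Lemma ess_boundedM f g : ess_bounded f -> ess_bounded g ->
  ess_bounded (fun x => f x * g x).
Proof.
move=> [K K0 [mf fK]] [M M0 [mg gM]]; exists (K * M); first exact: mulr_ge0.
split; first exact: measurable_funM.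
apply: filterS2 fK gM => x /= fK gM Dx.
by rewrite normrM ler_pM ?fK ?gM.
Qed.

Lemma ess_bounded_sum I (r : seq I) (F : I -> E -> R) :
  (forall i, ess_bounded (F i)) -> ess_bounded (fun x => \sum_(i <- r) F i x).
Proof.
move=> bF; elim: r => [|i r IH].
  by under eq_fun do rewrite big_nil; exact: ess_bounded_cst.
by under eq_fun do rewrite big_cons; exact: ess_boundedD.
Qed.

Lemma L2_ess_bounded f g : ess_bounded f -> L2 D g -> L2 D (fun x => f x * g x).
Proof. by move=> [K K0 bf]; exact: L2_bmul bf. Qed.

Lemma ess_sup_on_lty f : ess_bounded f -> (ess_sup_on D f < +oo)%E.
Proof.
move=> [K K0 [mf fK]]; apply: (@le_lt_trans _ _ K%:E); last exact: ltry.
apply/ess_supP; apply: filterS fK => x /= fK; rewrite patchE.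
by case: ifPn => [/set_mem Dx|_]; rewrite lee_fin ?fK.
Qed.

Lemma ess_sup_on_ae f (r : \bar R) : ess_sup_on D f = r ->
  {ae leb d, forall x, (patch (cst 0%E) D (fun x => `|f x|%:E) x <= r)%E}.
Proof. by move=> <-; exact: ess_sup_ge. Qed.

Lemma patch_norm_ge0 f x : (0 <= patch (cst 0%E) D (fun x => `|f x|%:E) x)%E.
Proof. by rewrite patchE; case: ifPn => // _; rewrite lee_fin. Qed.

(** The essential supremum of |f| can only be negative if every property holds
    almost everywhere; it is then -oo, which [fine] sends to 0. *)
Lemma Linfty_norm_ge0 f : 0 <= Linfty_norm D f.
Proof.
rewrite /Linfty_norm.
case rE: (ess_sup_on D f) => [r| |]//=.
rewrite leNgt; apply/negP => r0.
suff : ess_sup_on D f = -oo%E by rewrite rE.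
apply/eqP; rewrite -leeNy_eq; apply/ess_supP.
apply: filterS (ess_sup_on_ae rE) => x /= xr.
have := le_trans (patch_norm_ge0 f x) xr.
by rewrite lee_fin leNgt r0.
Qed.

Lemma Linfty_norm_ae f : (ess_sup_on D f < +oo)%E ->
  {ae leb d, forall x, D x -> `|f x| <= Linfty_norm D f}.
Proof.
rewrite /Linfty_norm.
case rE: (ess_sup_on D f) => [r| |]//= _;
  apply: filterS (ess_sup_on_ae rE) => x /= + Dx; rewrite patchE mem_set//.
Qed.

Lemma Linfty_ae_bounded f : Linfty D f -> ae_bounded D (Linfty_norm D f) f.
Proof. by move=> [mf foo]; split => //; exact: Linfty_norm_ae. Qed.

Lemma Linfty_ess_bounded f : Linfty D f -> ess_bounded f.
Proof.
move=> Lf; exists (Linfty_norm D f); first exact: Linfty_norm_ge0.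
exact: Linfty_ae_bounded.
Qed.

Lemma ess_bounded_Linfty_norm f : ess_bounded f ->
  ae_bounded D (Linfty_norm D f) f.
Proof.
move=> bf; apply: Linfty_ae_bounded; split; last exact: ess_sup_on_lty.
by case: bf => K _ [].
Qed.

(** [fine] sends an infinite essential infimum to 0, so a positive value of
    [ess_inf_on] is the true essential infimum. *)
Lemma ess_inf_on_ae f : 0 < ess_inf_on D f ->
  {ae leb d, forall x, D x -> ess_inf_on D f <= f x}.
Proof.
rewrite /ess_inf_on.
have := ess_inf_le (leb d) (patch (cst +oo%E) D (EFin \o f)).
case: (ess_inf _ _) => [r| |]/=; rewrite ?ltxx// => H _.
by apply: filterS H => x /= + Dx; rewrite /patch mem_set// lee_fin.
Qed.

End essentially_bounded.
Arguments ess_bounded {R d} D f.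

(** * Polytopes and meshes *)
Section polytopes.
Context {R : realType} {d : nat}.
Local Notation E := 'rV[R]_d.
Implicit Types (P K : halfspaces R d) (T : seq (halfspaces R d)).

Lemma open_opoly P : open (opoly P).
Proof.
elim: P => [|h P IH].
  by rewrite (_ : opoly _ = setT); [exact: openT|apply/seteqP; split].
rewrite (_ : opoly _ = (dotm h.1 : E -> R) @^-1` [set t | t < h.2] `&` opoly P).
  apply: openI => //; move: (@continuous_dotm R d h.1) => /continuousP; apply.
  exact: open_lt.
apply/seteqP; split => x /=.
  move=> xP; split; first by apply: xP; rewrite inE eqxx.
  by move=> k kP; apply: xP; rewrite inE kP orbT.
by move=> [xh xP] k; rewrite inE => /predU1P[->//|]; exact: xP.
Qed.

Lemma opoly_sub P : opoly P `<=` cpoly P.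
Proof. by move=> x xP h /xP/ltW. Qed.

Lemma polytope_bounded P : polytope P -> bounded_open (opoly P).
Proof.
move=> [_ [M [_ PM]] _]; split; first exact: open_opoly.
exists (M + 1) => x /opoly_sub xP i.
have := PM (M + 1) _ x xP; rewrite ltrDl => /(_ ltr01).
apply: le_trans.
by rewrite /Num.norm/= mx_normrE; apply: (@le_bigmax _ _ _ _ _ (ord0, i)).
Qed.

Lemma negligible_seq (I : eqType) (r : seq I) (F : I -> set E) :
  (forall i, i \in r -> (leb d).-negligible (F i)) ->
  (leb d).-negligible (\bigcup_(i in [set` r]) F i).
Proof.
elim: r => [|i r IH] Fr.
  rewrite (_ : \bigcup_(_ in _) _ = set0); first exact: negligible_set0.
  by apply/seteqP; split => // x [].
apply: (@negligibleS _ _ _ _ (F i `|` \bigcup_(i in [set` r]) F i)).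
  move=> x [j /=]; rewrite inE => /predU1P[->|jr] Fx; first by left.
  by right; exists j.
apply: negligibleU; first by apply: Fr; rewrite inE eqxx.
by apply: IH => j jr; apply: Fr; rewrite inE jr orbT.
Qed.

Lemma enorm1_neq0 (a : E) : enorm a = 1 -> a != 0.
Proof.
move=> a1; apply/eqP => a0; move: a1; rewrite a0 /enorm dotm_row big1.
  by rewrite sqrtr0 => /eqP; rewrite eq_sym oner_eq0.
by move=> j _; rewrite mxE mul0r.
Qed.

Lemma polytope_boundary_negligible K : polytope K ->
  (leb d).-negligible (cpoly K `\` opoly K).
Proof.
move=> [K1 _ _].
apply: (@negligibleS _ _ _ _
    (\bigcup_(h in [set` K]) [set x : E | dotm h.1 x = h.2])).
  move=> x [xc /= /existsNP[h /not_implyP[hK /negP]]]; rewrite -leNgt => hx.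
  by exists h => //=; apply/eqP; rewrite eq_le hx xc.
apply: negligible_seq => h hK; apply/negligibleP.
  by apply: closed_measurable_rV; exact: closed_hyperplane.
by apply: hyperplane_null; apply: enorm1_neq0; exact: K1.
Qed.

Lemma mesh_negligible D T : is_mesh D T ->
  (leb d).-negligible (D `\` \bigcup_(K in [set` T]) opoly K).
Proof.
move=> [TP TD _ _].
apply: (@negligibleS _ _ _ _ (\bigcup_(K in [set` T]) (cpoly K `\` opoly K))).
  move=> x [/subset_closure]; rewrite -TD => -[K KT xK] xT; exists K => //.
  by split=> // xoK; apply: xT; exists K.
by apply: negligible_seq => K KT; apply: polytope_boundary_negligible; exact: TP.
Qed.

Lemma seq_bound (I : eqType) (r : seq I) (Q : I -> R -> Prop) :
  (forall i M N, M <= N -> Q i M -> Q i N) ->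
  (forall i, i \in r -> exists M, Q i M) ->
  exists2 M, 0 <= M & forall i, i \in r -> Q i M.
Proof.
move=> Qle; elim: r => [|i r IH] Qr; first by exists 0.
have [|M M0 rM] := IH; first by move=> j jr; apply: Qr; rewrite inE jr orbT.
have [|N iN] := Qr i; first by rewrite inE eqxx.
exists (Num.max M N); first by rewrite le_max M0.
by move=> j; rewrite inE => /predU1P[->|/rM jM]; [apply: Qle iN|apply: Qle jM];
  rewrite le_max lexx ?orbT.
Qed.

(** Inside a cell the weak derivative is the classical one, which is bounded
    since it is continuous up to the boundary; the skeleton of the mesh is a
    null set. *)
Lemma piecewise_C1_bounded D T (u : E -> R) : bounded_open D -> is_mesh D T ->
  piecewise_C1 T u -> H1 D u ->
  ess_bounded D u /\ forall k, ess_bounded D (partial D k u).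
Proof.
move=> bD mT pu Hu.
have nT := mesh_negligible mT.
have key (g : E -> R) : L2 D g ->
    (forall K, K \in T -> exists M, {ae leb d, forall x, (opoly K `&` D) x -> `|g x| <= M}) ->
    ess_bounded D g.
  move=> [mg _] /seq_bound[|M M0 gM].
    by move=> i M N MN; apply: filterS => x /= + Kx => /(_ Kx)/le_trans; exact.
  exists M => //; split => //.
  have {}gM := @negligible_seq _ T
    (fun K => ~` [set x | (opoly K `&` D) x -> `|g x| <= M]) gM.
  apply: negligibleS (negligibleU nT gM) => x /= /not_implyP[Dx gx].
  have [xT|xT] := pselect ((\bigcup_(K in [set` T]) opoly K) x); last by left.
  by right; case: xT => K KT xK; exists K => //= /(_ (conj xK Dx)).
split=> [|k]; apply: key; [exact: H1_L2| |exact: L2_partial|] => K /pu[phi [Cphi uphi]].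
  have [M phiM] := continuous_bounded_on bD Cphi.1.
  by exists M; apply: aeW => x [xK Dx]; rewrite uphi// phiM.
have [M dM] := continuous_bounded_on bD (Cphi.2 k).2.
exists M.
have oK : open (opoly K `&` D) by apply: openI; [exact: open_opoly|exact: bD.1].
have KD : opoly K `&` D `<=` D by move=> x [].
have H : ae_eq (leb d) (opoly K `&` D) (partial D k u) ('D_(ebase k) phi).
  by apply: (partial_local bD) => // x [xK _]; exact: uphi.
by apply: filterS H => x /= + KDx => -> //; apply: dM; case: KDx.
Qed.

End polytopes.

(** * Vector and matrix fields *)
Section finite_sums.
Context {R : realType}.

Lemma sum_cauchy_schwarz (I : finType) (a b : I -> R) :
  (\sum_i a i * b i) ^+ 2 <= (\sum_i a i ^+ 2) * (\sum_i b i ^+ 2).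
Proof.
set A := \sum_i a i ^+ 2; set S := \sum_i b i ^+ 2; set p := \sum_i a i * b i.
have S0 : 0 <= S by rewrite sumr_ge0// => i _; exact: sqr_ge0.
have [S1|S1] := eqVneq S 0.
  have b0 i : b i = 0.
    apply/eqP; rewrite -sqrf_eq0; apply/eqP.
    by apply: (psumr_eq0P (P := xpredT) (fun k _ => sqr_ge0 (b k)) S1).
  by rewrite /p big1 ?expr0n ?S1 ?mulr0// => i _; rewrite b0 mulr0.
have Sp : 0 < S by rewrite lt0r S1.
have : 0 <= \sum_i (a i * S - b i * p) ^+ 2 by rewrite sumr_ge0// => i _; exact: sqr_ge0.
have -> : \sum_i (a i * S - b i * p) ^+ 2 = S * (A * S - p ^+ 2).
  transitivity (\sum_i (S ^+ 2 * a i ^+ 2 + (- 2 * S * p) * (a i * b i) + p ^+ 2 * b i ^+ 2)).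
    by apply: eq_bigr => i _; ring.
  rewrite !big_split/= -!mulr_sumr -/A -/S -/p; ring.
by rewrite pmulr_rge0// subr_ge0.
Qed.

Lemma sum_pair_cauchy_schwarz (I J : finType) (a b : I -> J -> R) :
  \sum_i \sum_j a i j * b i j <=
  Num.sqrt (\sum_i \sum_j a i j ^+ 2) * Num.sqrt (\sum_i \sum_j b i j ^+ 2).
Proof.
rewrite !pair_bigA/=.
have Q0 (c : I -> J -> R) : 0 <= \sum_(p : I * J) c p.1 p.2 ^+ 2.
  by rewrite sumr_ge0// => p _; exact: sqr_ge0.
apply: (le_trans (ler_norm _)).
rewrite -ler_sqr ?nnegrE ?mulr_ge0 ?sqrtr_ge0// exprMn !sqr_sqrtr//.
rewrite real_normK ?num_real//.
exact: sum_cauchy_schwarz (fun p => a p.1 p.2) (fun p => b p.1 p.2).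
Qed.

Lemma dotmZl m n (c : R) (A B : 'M[R]_(m, n)) : dotm (c *: A) B = c * dotm A B.
Proof.
rewrite /dotm mulr_sumr; apply: eq_bigr => i _; rewrite mulr_sumr.
by apply: eq_bigr => j _; rewrite mxE mulrA.
Qed.

Lemma dotm_ge0 m n (A : 'M[R]_(m, n)) : 0 <= dotm A A.
Proof. by do 2 (rewrite sumr_ge0// => ? _); rewrite -expr2 sqr_ge0. Qed.

Lemma enorm_sqr d (x : 'rV[R]_d) : enorm x ^+ 2 = dotm x x.
Proof. by rewrite sqr_sqrtr// dotm_ge0. Qed.

(** Pointwise, so that the first term on the right can be compared with the
    eddy viscosity, which varies in space, before integrating. *)
Lemma dotm_advect_young d (t : R) (u w : 'rV[R]_d) (A : 'M[R]_d) : 0 < t ->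
  dotm (u *m A^T) w <= t * dotm u u * dotm A A + (4 * t)^-1 * dotm w w.
Proof.
move=> t0; rewrite !dotm_row [dotm A A]/dotm [t * _ * _]mulr_sumr [(4 * t)^-1 * _]mulr_sumr -big_split/= ler_sum// => i _.
have -> : (u *m A^T) ord0 i = \sum_k A i k * u ord0 k.
  by rewrite mxE; apply: eq_bigr => k _; rewrite mxE mulrC.
have := sum_cauchy_schwarz (A i) (u ord0).
set s := \sum_k A i k * _; set a := \sum_k A i k ^+ 2.
have -> : \sum_k u ord0 k ^+ 2 = \sum_k u ord0 k * u ord0 k.
  by apply: eq_bigr => k _; rewrite expr2.
move: (\sum_k u ord0 k * _) (w ord0 i) => p q sap.
have : 0 <= (2 * t * s - q) ^+ 2 * (4 * t)^-1 by rewrite mulr_ge0 ?sqr_ge0 ?invr_ge0 ?mulr_ge0 ?ltW.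
have -> : (2 * t * s - q) ^+ 2 * (4 * t)^-1 = t * s ^+ 2 - s * q + (4 * t)^-1 * (q * q).
  by field; rewrite gt_eqF.
have : t * s ^+ 2 <= t * (a * p) by rewrite ler_wpM2l// ltW.
rewrite (mulrAC t p) -mulrA; lra.
Qed.

End finite_sums.

Section fields.
Context {R : realType} {d : nat} {D : set 'rV[R]_d}.
Hypothesis bD : bounded_open D.
Local Notation E := 'rV[R]_d.
Local Notation mD := (bounded_open_measurable bD).

Definition L2m m n (f : E -> 'M[R]_(m, n)) := forall i j, L2 D (fun x => f x i j).

Lemma L2v_L2m (u : E -> E) : L2v D u -> L2m u.
Proof. by move=> Lu i j; rewrite (ord1 i); exact: Lu. Qed.

Lemma L2mD m n (f g : E -> 'M[R]_(m, n)) : L2m f -> L2m g -> L2m (fun x => f x + g x).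
Proof.
by move=> Lf Lg i j; under eq_fun do rewrite mxE; exact: L2D.
Qed.

Lemma L2mZ m n (c : R) (f : E -> 'M[R]_(m, n)) : L2m f -> L2m (fun x => c *: f x).
Proof. by move=> Lf i j; under eq_fun do rewrite mxE; exact: L2Z. Qed.

Lemma L2m_bounded m n b (f : E -> 'M[R]_(m, n)) : ess_bounded D b -> L2m f ->
  L2m (fun x => b x *: f x).
Proof. by move=> bb Lf i j; under eq_fun do rewrite mxE; exact: L2_ess_bounded. Qed.

Lemma integrable_sum I (r : seq I) (F : I -> E -> R) :
  (forall i, (leb d).-integrable D (EFin \o F i)) ->
  (leb d).-integrable D (EFin \o (fun x => \sum_(i <- r) F i x)).
Proof.
move=> iF; elim: r => [|i r IH].
  under eq_fun do rewrite big_nil.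
  by apply: L2_integrable => //; exact: L2_0.
under eq_fun do rewrite big_cons.
have := integrableD mD (iF i) IH.
by apply: eq_integrable => [|x _]; [exact: mD|rewrite /= EFinD].
Qed.

Lemma Rintegral_sum I (r : seq I) (F : I -> E -> R) :
  (forall i, (leb d).-integrable D (EFin \o F i)) ->
  \int[leb d]_(x in D) (\sum_(i <- r) F i x) =
  \sum_(i <- r) \int[leb d]_(x in D) F i x.
Proof.
move=> iF; elim: r => [|i r IH].
  rewrite big_nil; under eq_Rintegral do rewrite big_nil.
  by rewrite Rintegral_cst ?mul0r//; exact: mD.
under eq_Rintegral do rewrite big_cons.
by rewrite big_cons (RintegralD mD (iF i) (integrable_sum r iF)) IH.
Qed.

Lemma L2m_integrable m n (f g : E -> 'M[R]_(m, n)) : L2m f -> L2m g ->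
  (leb d).-integrable D (EFin \o (fun x => dotm (f x) (g x))).
Proof.
move=> Lf Lg; apply: integrable_sum => i; apply: integrable_sum => j.
exact: L2_mul_integrable.
Qed.

Lemma ip_sip m n (f g : E -> 'M[R]_(m, n)) : L2m f -> L2m g ->
  ip D f g = \sum_i \sum_j sip D (fun x => f x i j) (fun x => g x i j).
Proof.
move=> Lf Lg; have I2 i j := L2_mul_integrable bD (Lf i j) (Lg i j).
rewrite /ip /dotm (Rintegral_sum _ (fun i => integrable_sum _ (I2 i))).
by apply: eq_bigr => i _; rewrite (Rintegral_sum _ (I2 i)).
Qed.

Lemma ipC m n (f g : E -> 'M[R]_(m, n)) : ip D f g = ip D g f.
Proof.
apply: eq_Rintegral => x _; apply: eq_bigr => i _; apply: eq_bigr => j _.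
exact: mulrC.
Qed.

Lemma ipDl m n (f g h : E -> 'M[R]_(m, n)) : L2m f -> L2m g -> L2m h ->
  ip D (fun x => f x + g x) h = ip D f h + ip D g h.
Proof.
move=> Lf Lg Lh; rewrite /ip -(RintegralD mD (L2m_integrable Lf Lh) (L2m_integrable Lg Lh)).
apply: eq_Rintegral => x _; rewrite /dotm -big_split/=; apply: eq_bigr => i _.
by rewrite -big_split/=; apply: eq_bigr => j _; rewrite mxE mulrDl.
Qed.

Lemma ipZl m n (c : R) (f h : E -> 'M[R]_(m, n)) : L2m f -> L2m h ->
  ip D (fun x => c *: f x) h = c * ip D f h.
Proof.
move=> Lf Lh; rewrite /ip -(RintegralZl c mD (L2m_integrable Lf Lh)).
by apply: eq_Rintegral => x _; rewrite dotmZl.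
Qed.

Lemma ip_ge0 m n (f : E -> 'M[R]_(m, n)) : 0 <= ip D f f.
Proof. by apply: Rintegral_ge0 => x _; exact: dotm_ge0. Qed.

Lemma norm2_sqr m n (f : E -> 'M[R]_(m, n)) : norm2 D f ^+ 2 = ip D f f.
Proof. by rewrite sqr_sqrtr// ip_ge0. Qed.

Lemma norm2_ge0 m n (f : E -> 'M[R]_(m, n)) : 0 <= norm2 D f.
Proof. exact: sqrtr_ge0. Qed.

Lemma norm2_snorm m n (f : E -> 'M[R]_(m, n)) : L2m f ->
  norm2 D f = Num.sqrt (\sum_i \sum_j snorm D (fun x => f x i j) ^+ 2).
Proof.
move=> Lf; rewrite /norm2 ip_sip//; congr Num.sqrt.
by apply: eq_bigr => i _; apply: eq_bigr => j _; rewrite snorm_sqr.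
Qed.

Lemma ip_le m n (f g : E -> 'M[R]_(m, n)) : L2m f -> L2m g ->
  `|ip D f g| <= norm2 D f * norm2 D g.
Proof.
move=> Lf Lg; rewrite !norm2_snorm//; apply: le_trans (sum_pair_cauchy_schwarz _ _).
rewrite ip_sip// (le_trans (ler_norm_sum _ _ _))// ler_sum// => i _.
rewrite (le_trans (ler_norm_sum _ _ _))// ler_sum// => j _.
exact: cauchy_schwarz.
Qed.

Lemma ip_bmul_le m n (K : R) b (f g : E -> 'M[R]_(m, n)) : 0 <= K ->
  ae_bounded D K b -> L2m f -> L2m g ->
  `|ip D (fun x => b x *: f x) g| <= K * (norm2 D f * norm2 D g).
Proof.
move=> K0 bb Lf Lg.
have Lbf : L2m (fun x => b x *: f x) by apply: L2m_bounded => //; exists K.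
rewrite ip_sip// !norm2_snorm//.
apply: le_trans (ler_wpM2l K0 (sum_pair_cauchy_schwarz _ _)).
rewrite mulr_sumr (le_trans (ler_norm_sum _ _ _))// ler_sum// => i _.
rewrite mulr_sumr (le_trans (ler_norm_sum _ _ _))// ler_sum// => j _.
rewrite (_ : (fun x => (b x *: f x) i j) = fun x => b x * f x i j); last first.
  by apply/funext => x; rewrite mxE.
apply: (sip_bound bD K0 bb (Lf i j) (Lg i j)) => //; exact: snorm_ge0.
Qed.

Lemma norm2_triangle m n (f g : E -> 'M[R]_(m, n)) : L2m f -> L2m g ->
  norm2 D (fun x => f x + g x) <= norm2 D f + norm2 D g.
Proof.
move=> Lf Lg; have Lfg := L2mD Lf Lg.
rewrite -ler_sqr ?nnegrE ?addr_ge0 ?norm2_ge0// norm2_sqr.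
rewrite ipDl// (ipC f) (ipC g) !ipDl// sqrrD !norm2_sqr (ipC g f).
have := le_trans (ler_norm _) (ip_le Lf Lg); lra.
Qed.

Lemma norm2Z m n (c : R) (f : E -> 'M[R]_(m, n)) : L2m f ->
  norm2 D (fun x => c *: f x) = `|c| * norm2 D f.
Proof.
move=> Lf; rewrite /norm2 (ipZl c Lf (L2mZ c Lf)) (ipC f) (ipZl c Lf Lf) mulrA -expr2.
by rewrite sqrtrM ?sqr_ge0// sqrtr_sqr.
Qed.

Lemma norm2_ae m n (f g : E -> 'M[R]_(m, n)) : L2m f -> L2m g ->
  (forall i j, ae_eq (leb d) D (fun x => f x i j) (fun x => g x i j)) ->
  norm2 D f = norm2 D g.
Proof.
move=> Lf Lg fg; rewrite !norm2_snorm//; congr Num.sqrt.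
by apply: eq_bigr => i _; apply: eq_bigr => j _; congr (_ ^+ 2); exact: snorm_ae.
Qed.

Lemma le_Rintegral_ae (f g : E -> R) :
  (leb d).-integrable D (EFin \o f) -> (leb d).-integrable D (EFin \o g) ->
  {ae leb d, forall x, D x -> f x <= g x} ->
  \int[leb d]_(x in D) f x <= \int[leb d]_(x in D) g x.
Proof.
move=> If Ig fg; rewrite -subr_ge0 -RintegralB//; last exact: mD.
have mfg : measurable_fun D (fun x => g x - f x).
  apply: measurable_funB; first by apply/measurable_EFinP; exact: measurable_int Ig.
  by apply/measurable_EFinP; exact: measurable_int If.
have -> : \int[leb d]_(x in D) (g x - f x) = \int[leb d]_(x in D) Num.max 0 (g x - f x).
  congr fine; apply: ae_eq_integral => //; first exact: mD.
  - exact/measurable_EFinP.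
  - by apply/measurable_EFinP; apply: measurable_maxr => //; exact: measurable_cst.
  - apply: filterS fg => x /= fg Dx; congr EFin; apply/esym/max_idPr.
    by rewrite subr_ge0 fg.
by apply: Rintegral_ge0 => x _; rewrite le_max lexx.
Qed.

Lemma ip_lower m n (r : R) b (f : E -> 'M[R]_(m, n)) : ess_bounded D b -> L2m f ->
  {ae leb d, forall x, D x -> r <= b x} ->
  r * norm2 D f ^+ 2 <= ip D (fun x => b x *: f x) f.
Proof.
move=> bb Lf rb; rewrite norm2_sqr -ipZl//.
apply: le_Rintegral_ae.
- by apply: L2m_integrable => //; exact: L2mZ.
- by apply: L2m_integrable => //; exact: L2m_bounded.
- by apply: filterS rb => x /= rb Dx; rewrite !dotmZl ler_wpM2r ?dotm_ge0 ?rb.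
Qed.

End fields.
Arguments L2m {R d} D {m n} f.

(** * Estimates for velocity fields *)
Section velocity_fields.
Context {R : realType} {d : nat} {D : set 'rV[R]_d}.
Hypothesis bD : bounded_open D.
Local Notation E := 'rV[R]_d.
Implicit Types u v w : E -> E.

Lemma H10v_H1v u : H10v D u -> H1v D u. Proof. by move=> Zu i; case: (Zu i). Qed.

Lemma H1v_L2m u : H1v D u -> L2m D u.
Proof. by move=> Hu; apply: L2v_L2m => i; exact: H1_L2. Qed.

Lemma grad_L2m u : H1v D u -> L2m D (grad D u).
Proof. by move=> Hu i k; under eq_fun do rewrite mxE; exact: L2_partial. Qed.

Lemma poincare_vec (L : R) v : (0 < d)%N -> 0 <= L ->
  (forall x, D x -> forall i, `|x ord0 i| <= L) -> H10v D v ->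
  norm2 D v <= 2 * L * norm2 D (grad D v).
Proof.
move=> d0 L0 DL Zv; have Hv := H10v_H1v Zv; pose k := Ordinal d0.
rewrite (norm2_snorm bD (H1v_L2m Hv)) (norm2_snorm bD (grad_L2m Hv)).
rewrite -ler_sqr ?nnegrE ?mulr_ge0 ?sqrtr_ge0// exprMn.
have S0 m n (f : E -> 'M[R]_(m, n)) : 0 <= \sum_i \sum_j snorm D (fun x => f x i j) ^+ 2.
  by do 2 (rewrite sumr_ge0// => ? _); exact: sqr_ge0.
rewrite !sqr_sqrtr// big_ord1 mulr_sumr ler_sum// => i _.
apply: (@le_trans _ _ ((2 * L * snorm D (partial D k (component v i))) ^+ 2)).
  have p0 : 0 <= 2 * L * snorm D (partial D k (component v i)).
    by rewrite !mulr_ge0 ?snorm_ge0.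
  rewrite ler_sqr ?nnegrE ?snorm_ge0//.
  exact: (poincare bD k L0 DL (Zv i)).
rewrite exprMn ler_wpM2l ?sqr_ge0// (bigD1 k)//= (_ : (fun x => _) = partial D k (component v i)).
  by rewrite lerDl sumr_ge0// => j _; exact: sqr_ge0.
by apply/funext => x; rewrite mxE.
Qed.

Lemma weak_partialZ i (c : R) (u g : E -> R) : L2 D u -> L2 D g ->
  weak_partial D i u g -> weak_partial D i (fun x => c * u x) (fun x => c * g x).
Proof.
move=> Lu Lg ug chi Cc; have [Cchi _ _] := Cc.
by rewrite (sipZl bD c Lu (L2_derive bD i Cchi)) (sipZl bD c Lg (L2_C1 bD Cchi)) ug// mulrN.
Qed.

Lemma H1Z (c : R) (u : E -> R) : H1 D u -> H1 D (fun x => c * u x).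
Proof.
move=> Hu; split; first exact: (L2Z bD c (H1_L2 Hu)).
move=> i; have [Lp wp] := partialP i Hu; exists (fun x => c * partial D i u x).
by split; [exact: L2Z|apply: weak_partialZ => //; exact: H1_L2].
Qed.

Lemma partialZ i (c : R) (u : E -> R) : H1 D u ->
  ae_eq (leb d) D (partial D i (fun x => c * u x)) (fun x => c * partial D i u x).
Proof.
move=> Hu; have [Lp wp] := partialP i Hu; apply: (partial_ae bD).
- exact: H1Z.
- exact: L2Z.
- by apply: weak_partialZ => //; exact: H1_L2.
Qed.

Lemma H1vZ (c : R) u : H1v D u -> H1v D (c *: u).
Proof.
move=> Hu i; rewrite (_ : component _ i = fun x => c * component u i x).
  exact: H1Z.
by apply/funext => x; rewrite /component !mxE.
Qed.

Lemma gradD_ae u v : H1v D u -> H1v D v -> forall i k,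
  ae_eq (leb d) D (fun x => grad D (u + v) x i k) (fun x => (grad D u x + grad D v x) i k).
Proof.
move=> Hu Hv i k; have := partialD bD k (Hu i) (Hv i).
apply: filterS => x /= H Dx; rewrite !mxE; refine (etrans _ (H Dx)).
by congr (partial D k _ x); apply/funext => y; rewrite /component !mxE.
Qed.

Lemma gradZ_ae (c : R) u : H1v D u -> forall i k,
  ae_eq (leb d) D (fun x => grad D (c *: u) x i k) (fun x => (c *: grad D u x) i k).
Proof.
move=> Hu i k; have := partialZ k c (Hu i).
apply: filterS => x /= H Dx; rewrite !mxE; refine (etrans _ (H Dx)).
by congr (partial D k _ x); apply/funext => y; rewrite /component !mxE.
Qed.

Lemma H1vD u v : H1v D u -> H1v D v -> H1v D (u + v).
Proof.
move=> Hu Hv i; rewrite (_ : component _ i = fun x => component u i x + component v i x).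
  exact: H1D.
by apply/funext => x; rewrite /component !mxE.
Qed.

Lemma norm2_gradD u v : H1v D u -> H1v D v ->
  norm2 D (grad D (u + v)) <= norm2 D (grad D u) + norm2 D (grad D v).
Proof.
move=> Hu Hv; have Lu := grad_L2m Hu; have Lv := grad_L2m Hv.
rewrite (norm2_ae bD (grad_L2m (H1vD Hu Hv)) (L2mD bD Lu Lv)).
  exact: norm2_triangle.
exact: gradD_ae.
Qed.

Lemma norm2_gradZ (c : R) u : H1v D u -> norm2 D (grad D (c *: u)) = `|c| * norm2 D (grad D u).
Proof.
move=> Hu; have Lu := grad_L2m Hu.
rewrite (norm2_ae bD (grad_L2m (H1vZ c Hu)) (L2mZ bD c Lu)); first exact: norm2Z.
exact: gradZ_ae.
Qed.

Lemma norm2_grad_extrap u v : H1v D u -> H1v D v ->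
  norm2 D (grad D (2 *: u - v)) <= 2 * norm2 D (grad D u) + norm2 D (grad D v).
Proof.
move=> Hu Hv; have -> : 2 *: u - v = 2 *: u + (-1) *: v by rewrite scaleN1r.
apply: (le_trans (norm2_gradD (H1vZ 2 Hu) (H1vZ (-1) Hv))).
rewrite (norm2_gradZ 2 Hu) (norm2_gradZ (-1) Hv).
by rewrite normrN1 mul1r ger0_norm.
Qed.

(** What is used of the finite element velocities. The bounds may depend on the
    mesh: they make integrals finite and never enter a constant. *)
Definition bounded_field v :=
  [/\ H10v D v, forall i, ess_bounded D (component v i) &
      forall i k, ess_bounded D (partial D k (component v i))].

Lemma div_sum v x : div D v x = \sum_k partial D k (component v k) x.
Proof. by apply: eq_bigr => k _; rewrite mxE. Qed.

Lemma div_ess_bounded v : bounded_field v -> ess_bounded D (div D v).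
Proof.
move=> [_ _ bv]; rewrite (funext (div_sum v)).
by apply: ess_bounded_sum => // k; exact: bv.
Qed.

Lemma advect_entry u v x i : advect D u v x ord0 i =
  \sum_k u x ord0 k * partial D k (component v i) x.
Proof. by rewrite mxE; apply: eq_bigr => k _; rewrite !mxE. Qed.

Lemma advect_L2m u v : bounded_field u -> H1v D v -> L2m D (advect D u v).
Proof.
move=> [_ bu _] Hv; apply: L2v_L2m => i.
rewrite (_ : component _ i = fun x =>
   \sum_k component u k x * partial D k (component v i) x); last first.
  by apply/funext => x; rewrite /component advect_entry.
apply: (L2_sum bD) => k; apply: (L2_ess_bounded bD (bu k)); exact: L2_partial.
Qed.

Lemma ip_advect u v w : bounded_field u -> H1v D v -> H1v D w ->
  ip D (advect D u v) w =
  \sum_i \sum_k sip D (fun x => component u k x * partial D k (component v i) x) (component w i).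
Proof.
move=> Bu Hv Hw; rewrite (ip_sip bD (advect_L2m Bu Hv) (H1v_L2m Hw)) big_ord1.
have [_ bu _] := Bu.
apply: eq_bigr => i _; rewrite -(sip_suml bD _ _ (H1_L2 (Hw i))).
  by apply: eq_Rintegral => x _; rewrite advect_entry.
by move=> k; apply: (L2_ess_bounded bD (bu k)); exact: L2_partial.
Qed.

(** The transport form vanishes on each pair of components of w and v, which
    eliminates the gradient of w. *)
Lemma bstar_by_parts u w v : bounded_field u -> H10v D w -> H10v D v ->
  bstar D u w v = - ip D (advect D u v) w
                  - 2^-1 * ip D (fun x => div D u x *: w x) v.
Proof.
move=> Bu Zw Zv; have Hw := H10v_H1v Zw; have Hv := H10v_H1v Zv.
have bdiv := div_ess_bounded Bu.
have [Zu bu dbu] := Bu.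
have [Ka Ka0 ba] : exists2 Ka : R, 0 <= Ka & forall k, ae_bounded D Ka (component u k).
  have [||Ka Ka0 ba] := @seq_bound R _ (enum 'I_d) (fun k M => ae_bounded D M (component u k)).
  - move=> k M N MN [mk kM]; split => //.
    by apply: filterS kM => x /= kM Dx; exact: le_trans (kM Dx) MN.
  - by move=> k _; have [K _ bK] := bu k; exists K.
  by exists Ka => // k; apply: ba; rewrite mem_enum.
have [Kb Kb0 bb] := bdiv.
have T0 i := transport_H10 bD (fun k => (Zu k).1) ba bb Ka0 Kb0
  (aeW (leb d) (fun x _ => div_sum u x)) (Zw i) (Zv i).
have Ldw : L2m D (fun x => div D u x *: w x) := L2m_bounded bD bdiv (H1v_L2m Hw).
rewrite /bstar !(ip_advect Bu)// (ip_sip bD Ldw (H1v_L2m Hv)) big_ord1.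
have : \sum_i @transport R d D (component u) (div D u) (component w i) (component v i) = 0.
  by rewrite big1// => i _; exact: T0.
rewrite /transport big_split/= (eq_bigr _ (fun i _ => big_split _ _ _ _ _))/= big_split/=.
rewrite (eq_bigr (fun i => sip D (fun x => (div D u x *: w x) ord0 i) (component v i)) (F1 := fun i => sip D (fun x => div D u x * component w i x) (component v i))); last first.
  by move=> i _; apply: eq_Rintegral => x _; rewrite mxE.
move: (\sum_i sip _ _ _) => p; set q := \sum_i \sum_k _; set r := \sum_i \sum_k _; lra.
Qed.

(** The derivative is moved to v because the eddy viscosity NT, which is at
    least m |u|^2, only dissipates the gradient of v. *)
Lemma convection_bound u w v (NT : E -> R) (m K : R) : bounded_field u ->
  H10v D w -> H10v D v -> 0 < m -> ess_bounded D NT ->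
  (forall x, D x -> m * dotm (u x) (u x) <= NT x) -> 0 <= K ->
  ae_bounded D K (div D u) ->
  - bstar D u w v <= ip D (fun x => NT x *: grad D v x) (grad D v)
    + (4 * m)^-1 * norm2 D w ^+ 2 + 2^-1 * (K * (norm2 D w * norm2 D v)).
Proof.
move=> Bu Zw Zv m0 bNT mNT K0 bK; have Hw := H10v_H1v Zw; have Hv := H10v_H1v Zv.
have Lw := H1v_L2m Hw; have Lv := H1v_L2m Hv; have Lgv := grad_L2m Hv.
have LN := L2m_bounded bD bNT Lgv.
rewrite bstar_by_parts// opprB opprK [leLHS]addrC lerD//; last first.
  rewrite ler_wpM2l ?invr_ge0// (le_trans (ler_norm _))//.
  exact: ip_bmul_le.
rewrite norm2_sqr -(ipZl bD _ Lw Lw).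
have LZ := L2mZ bD (4 * m)^-1 Lw.
rewrite {2 3}/ip -RintegralD; last 3 first.
- exact: bounded_open_measurable.
- exact: L2m_integrable.
- exact: L2m_integrable.
apply: le_Rintegral.
- exact: bounded_open_measurable.
- by apply: L2m_integrable => //; exact: advect_L2m.
- have := integrableD (bounded_open_measurable bD) (L2m_integrable bD LN Lgv) (L2m_integrable bD LZ Lw).
  by apply: eq_integrable => [|x _]; [exact: bounded_open_measurable|rewrite /= EFinD].
move=> x Dx; rewrite !dotmZl (le_trans (dotm_advect_young _ _ _ m0))//.
by rewrite lerD2r ler_wpM2r ?dotm_ge0 ?mNT.
Qed.

End velocity_fields.
Arguments bounded_field {R d} D v.

(** * The BDF2 energy *)
Section bdf2_identities.
Context {R : realType} {d : nat} {D : set 'rV[R]_d}.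
Hypothesis bD : bounded_open D.
Local Notation E := 'rV[R]_d.
Implicit Types a x y z : E -> E.

(** The squared G-norm of the two-step backward differentiation formula. *)
Definition bdf2_energy y x : R := norm2 D y ^+ 2 + norm2 D (2 *: y - x) ^+ 2.

Lemma ip_lin3l (p q r : R) a y x z : L2m D a -> L2m D y -> L2m D x -> L2m D z ->
  ip D (p *: a + q *: y + r *: x) z = p * ip D a z + q * ip D y z + r * ip D x z.
Proof.
move=> La Ly Lx Lz.
have [Lpa Lqy Lrx] := And3 (L2mZ bD p La) (L2mZ bD q Ly) (L2mZ bD r Lx).
have := ipDl bD (L2mD bD Lpa Lqy) Lrx Lz; rewrite -[LHS]/(ip D _ z) => ->.
by rewrite (ipDl bD Lpa Lqy Lz) (ipZl bD _ La Lz) (ipZl bD _ Ly Lz) (ipZl bD _ Lx Lz).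
Qed.

Lemma L2m_lin3 (p q r : R) a y x : L2m D a -> L2m D y -> L2m D x ->
  L2m D (p *: a + q *: y + r *: x).
Proof.
move=> La Ly Lx.
exact: (L2mD bD (L2mD bD (L2mZ bD p La) (L2mZ bD q Ly)) (L2mZ bD r Lx)).
Qed.

Lemma norm2_lin3 (p q r : R) a y x : L2m D a -> L2m D y -> L2m D x ->
  norm2 D (p *: a + q *: y + r *: x) ^+ 2 =
  p ^+ 2 * ip D a a + q ^+ 2 * ip D y y + r ^+ 2 * ip D x x +
  2 * (p * q * ip D a y + p * r * ip D a x + q * r * ip D y x).
Proof.
move=> La Ly Lx; have Ls := L2m_lin3 p q r La Ly Lx.
rewrite norm2_sqr ip_lin3l// !(ipC _ (p *: a + q *: y + r *: x)) !ip_lin3l//.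
rewrite (ipC y a) (ipC x a) (ipC x y); ring.
Qed.

Lemma bdf2_energyE y x : L2m D y -> L2m D x ->
  bdf2_energy y x = 5 * ip D y y - 4 * ip D y x + ip D x x.
Proof.
move=> Ly Lx; rewrite /bdf2_energy norm2_sqr.
have -> : 2 *: y - x = 2 *: y + (-1) *: x + 0 *: x by rewrite scaleN1r scale0r addr0.
rewrite norm2_lin3//; ring.
Qed.

Lemma bdf2_difference a y x : L2m D a -> L2m D y -> L2m D x ->
  ip D (3 *: a - 4 *: y + x) a = 3 * ip D a a - 4 * ip D a y + ip D a x.
Proof.
move=> La Ly Lx.
have -> : 3 *: a - 4 *: y + x = 3 *: a + (- 4) *: y + 1 *: x by rewrite scaleNr scale1r.
by rewrite ip_lin3l// (ipC y) (ipC x) mul1r mulNr.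
Qed.

(** G-stability of BDF2, perturbed by the projection z of a: the projection only
    decreases the energy, and its error is orthogonal to z, y and x. *)
Lemma bdf2_energy_step a z y x : L2m D a -> L2m D z -> L2m D y -> L2m D x ->
  ip D (z - a) z = 0 -> ip D (z - a) y = 0 -> ip D (z - a) x = 0 ->
  bdf2_energy z y <= bdf2_energy y x + 2 * ip D (3 *: a - 4 *: y + x) a.
Proof.
move=> La Lz Ly Lx.
have subE t : L2m D t -> ip D (z - a) t = ip D z t - ip D a t.
  move=> Lt; have -> : z - a = 1 *: z + (-1) *: a + 0 *: a.
    by rewrite scale1r scaleN1r scale0r addr0.
  by rewrite ip_lin3l//; ring.
rewrite !subE// bdf2_difference// !bdf2_energyE// => azE ayE axE.
have : 0 <= norm2 D (1 *: z + (- 2) *: y + 1 *: x) ^+ 2 by exact: sqr_ge0.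
have : 0 <= norm2 D (1 *: a + (-1) *: z + 0 *: x) ^+ 2 by exact: sqr_ge0.
rewrite !norm2_lin3//; lra.
Qed.

(** When |a|^2 alone is wanted, the difference quotient can be used with weight
    1/3, and only 5/9 of the previous energy is needed. The difference of the
    two sides is (|3a - 4y + x|^2 + |3y - 2x|^2) / 9. *)
Lemma bdf2_last_step a y x : L2m D a -> L2m D y -> L2m D x ->
  norm2 D a ^+ 2 <= 2 / 3 * ip D (3 *: a - 4 *: y + x) a + 5 / 9 * bdf2_energy y x.
Proof.
move=> La Ly Lx; rewrite bdf2_difference// bdf2_energyE// norm2_sqr.
have : 0 <= norm2 D (3 *: a + (- 4) *: y + 1 *: x) ^+ 2 by exact: sqr_ge0.
have : 0 <= norm2 D (3 *: y + (- 2) *: x + 0 *: a) ^+ 2 by exact: sqr_ge0.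
rewrite !norm2_lin3//; lra.
Qed.

(** Without the factor 5/9 this fails for x = - y. *)
Lemma bdf2_energy_initial y x : L2m D y -> L2m D x ->
  5 / 9 * bdf2_energy y x <= 6 * norm2 D y ^+ 2 + 2 * norm2 D x ^+ 2.
Proof.
move=> Ly Lx; rewrite bdf2_energyE// !norm2_sqr.
have : 0 <= norm2 D (1 *: y + 1 *: x + 0 *: x) ^+ 2 by exact: sqr_ge0.
rewrite norm2_lin3//.
have := ip_ge0 (D := D) y; have := ip_ge0 (D := D) x; lra.
Qed.

End bdf2_identities.

Section bdf2_summation.
Context {R : realType}.

(** The new gradient norm is [g], the two extrapolated ones are [g1] and [g0].
    After division by 4 l they receive N + 6 B and half of it: over the two
    steps in which a given gradient norm is extrapolated this amounts to
    3/2 N + 9 B, and with the 3/2 N that [g] pays to 3 N + 9 B. *)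
Lemma young_absorb (l F g g1 g0 W N B al : R) : 0 <= l -> 0 < al -> 0 <= N -> 0 <= B ->
  0 <= g -> 0 <= g1 -> 0 <= g0 -> 0 <= W -> W <= 2 * g1 + g0 ->
  4 * l * (F * g + B * W ^+ 2 + N * (W * g)) <=
  4 / al * F ^+ 2 + (al * l ^+ 2 + 6 * l * N) * g ^+ 2 +
  4 * l * (N + 6 * B) * g1 ^+ 2 + 2 * l * (N + 6 * B) * g0 ^+ 2.
Proof.
move=> l0 al0 N0 B0 g_0 g10 g00 W0 Wg.
have H1 : 4 * l * (F * g) <= 4 / al * F ^+ 2 + al * l ^+ 2 * g ^+ 2.
  rewrite -subr_ge0.
  have -> : 4 / al * F ^+ 2 + al * l ^+ 2 * g ^+ 2 - 4 * l * (F * g) =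
      (2 * F - al * l * g) ^+ 2 / al by field; rewrite gt_eqF.
  by rewrite divr_ge0 ?sqr_ge0 ?ltW.
have W2 : W ^+ 2 <= 6 * g1 ^+ 2 + 3 * g0 ^+ 2.
  have : W ^+ 2 <= (2 * g1 + g0) ^+ 2 by rewrite ler_sqr ?nnegrE ?addr_ge0 ?mulr_ge0.
  have := sqr_ge0 (g1 - g0); rewrite !expr2; lra.
have Wg' : 2 * (W * g) <= 2 * g1 ^+ 2 + g0 ^+ 2 + 3 * g ^+ 2.
  have : W * g <= (2 * g1 + g0) * g by rewrite ler_wpM2r.
  have := sqr_ge0 (g1 - g); have := sqr_ge0 (g0 - g); rewrite !expr2; lra.
have lB : 0 <= 4 * l * B by rewrite !mulr_ge0.
have lN : 0 <= 2 * l * N by rewrite !mulr_ge0.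
have := ler_wpM2l lB W2; have := ler_wpM2l lN Wg'; lra.
Qed.

(** The energy inequality of every step but the last is used with weight 5/9,
    that of the last with weight 1/3: the energies G then telescope up to the
    one that the last step needs. *)
Lemma bdf2_sum (m : nat) (X : R) (E G g W e F : nat -> R) (dt ga nu N al B ze : R) :
  0 < dt -> 0 <= ga -> 0 < al -> 0 <= N -> 0 <= B ->
  al + 3 * N <= nu -> ze <= al / 2 - 20 * B -> 0 < ze ->
  (forall n, 0 <= g n) -> (forall n, 0 <= e n) -> (forall n, 0 <= W n) ->
  (forall n, (1 <= n < m.+2)%N -> W n <= 2 * g n + g n.-1) ->
  (forall n, (1 <= n < m.+2)%N -> (2 * dt)^-1 * E n + nu * g n.+1 ^+ 2 + ga * e n.+1 <=
     F n.+1 * g n.+1 + al / 4 * g n.+1 ^+ 2 + B * W n ^+ 2 + N * (W n * g n.+1)) ->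
  (forall n, (1 <= n < m.+1)%N -> G n.+1 <= G n + 2 * E n) ->
  X <= 2 / 3 * E m.+1 + 5 / 9 * G m.+1 ->
  X + ze * dt * \sum_(1 <= n < m.+3) g n ^+ 2 + dt * ga * \sum_(2 <= n < m.+3) e n <=
  5 / 9 * G 1%N + 2 * nu * dt * (g 0%N ^+ 2 + g 1%N ^+ 2) +
  4 * dt / al * \sum_(2 <= n < m.+3) F n ^+ 2.
Proof.
move=> dt0 ga0 al0 N0 B0 nu_al zeB ze0 g_0 e0 W0 Wg stepE stepG XG.
have step (l : R) n : 0 <= l -> (1 <= n < m.+2)%N -> 2 * l * E n <=
    dt * (4 / al * F n.+1 ^+ 2 - 4 * l * (ga * e n.+1) -
    (4 * l * (nu - al / 4 - 3 / 2 * N) - al * l ^+ 2) * g n.+1 ^+ 2 +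
    4 * l * (N + 6 * B) * g n ^+ 2 + 2 * l * (N + 6 * B) * g n.-1 ^+ 2).
  move=> l0 nm.
  have Y := young_absorb (F n.+1) l0 al0 N0 B0 (g_0 n.+1) (g_0 n) (g_0 n.-1) (W0 n) (Wg _ nm).
  have l4 : 0 <= 4 * l by rewrite mulr_ge0.
  have S := ler_wpM2l l4 (stepE _ nm).
  have -> : 2 * l * E n = dt * (4 * l * ((2 * dt)^-1 * E n)) by field; rewrite gt_eqF.
  rewrite ler_pM2l//; lra.
pose p := 20 / 9 * (N + 6 * B).
have p0 : 0 <= p by rewrite mulr_ge0// addr_ge0// mulr_ge0.
(* The last two terms on the left are what the extrapolated gradients will cost
   in the two following steps. *)
have inv n : (n <= m)%N ->
    5 / 9 * G n.+1 + ze * dt * \sum_(1 <= k < n.+2) g k ^+ 2 +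
    dt * ga * \sum_(2 <= k < n.+2) e k +
    dt * (3 / 2 * p) * g n.+1 ^+ 2 + dt * (p / 2) * g n ^+ 2 <=
    5 / 9 * G 1%N + dt * (3 / 2 * p + ze) * g 1%N ^+ 2 + dt * (p / 2) * g 0%N ^+ 2 +
    4 * dt / al * \sum_(2 <= k < n.+2) F k ^+ 2.
  elim: n => [_|n IH nm].
    rewrite big_nat1 !big_geq//; lra.
  have {}IH := IH (ltnW nm).
  have S1 : (1 <= n.+1 < m.+2)%N by rewrite /= ltnS ltnW.
  have S2 : (1 <= n.+1 < m.+1)%N by [].
  have H1 := step (5 / 9) n.+1 ltac:(lra) S1.
  have H2 := stepG _ S2.
  rewrite (big_nat_recr n.+2)//= (big_nat_recr (n.+2) 2)//= (big_nat_recr (n.+2) 2)//=.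
  have g2 : 0 <= dt * g n.+2 ^+ 2 := mulr_ge0 (ltW dt0) (sqr_ge0 _).
  have ge2 : 0 <= dt * (ga * e n.+2) := mulr_ge0 (ltW dt0) (mulr_ge0 ga0 (e0 _)).
  have K : 0 <= (20 / 9 * (nu - al / 4 - 3 / 2 * N) - al * (5 / 9) ^+ 2) - ze - 3 / 2 * p.
    by rewrite /p; lra.
  have := mulr_ge0 K g2.
  move: IH H1 H2 ge2; have -> : 4 * dt / al = dt * (4 / al) by rewrite mulrAC mulrC.
  rewrite /p /=; move: (4 / al) => ial.
  lra.
have H3 := inv m (leqnn m).
have {step} H4 := step (1 / 3) m.+1 ltac:(lra) ltac:(by rewrite /= ltnSn).
rewrite (big_nat_recr m.+2)//= (big_nat_recr (m.+2) 2)//= (big_nat_recr (m.+2) 2)//=.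
have g2 : 0 <= dt * g m.+2 ^+ 2 := mulr_ge0 (ltW dt0) (sqr_ge0 _).
have g1 : 0 <= dt * g m.+1 ^+ 2 := mulr_ge0 (ltW dt0) (sqr_ge0 _).
have g0 : 0 <= dt * g m ^+ 2 := mulr_ge0 (ltW dt0) (sqr_ge0 _).
have h1 : 0 <= dt * g 1%N ^+ 2 := mulr_ge0 (ltW dt0) (sqr_ge0 _).
have h0 : 0 <= dt * g 0%N ^+ 2 := mulr_ge0 (ltW dt0) (sqr_ge0 _).
have ge2 : 0 <= dt * (ga * e m.+2) := mulr_ge0 (ltW dt0) (mulr_ge0 ga0 (e0 _)).
have K2 : 0 <= (4 / 3 * (nu - al / 4 - 3 / 2 * N) - al * (1 / 3) ^+ 2) - ze by lra.
have P2 := mulr_ge0 K2 g2.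
have P1 := mulr_ge0 p0 g1.
have P0 := mulr_ge0 p0 g0.
have K1 : 0 <= 2 * nu - (3 / 2 * p + ze) by rewrite /p; lra.
have Q1 := mulr_ge0 K1 h1.
have K0 : 0 <= 2 * nu - p / 2 by rewrite /p; lra.
have Q0 := mulr_ge0 K0 h0.
move: H3 H4; have -> : 4 * dt / al = dt * (4 / al) by rewrite mulrAC mulrC.
move: P1 P0 Q1 Q0 P2 ge2; rewrite /p /=; move: (4 / al) => ial; lra.
Qed.

End bdf2_summation.

(** * One step of the scheme *)
Section step_energy.
Context {R : realType} {d : nat} {D : set 'rV[R]_d}.
Hypothesis bD : bounded_open D.
Local Notation E := 'rV[R]_d.

Lemma bstar_skew (u v : E -> E) : bstar D u v v = 0.
Proof. exact: subrr. Qed.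

(** [W] and [g] are the gradient norms of the extrapolated and of the new
    velocity, [w] and [a] their L2 norms, and c is the Poincare constant. The
    divergence term is split so as to cost al/4 of the viscosity. *)
Lemma step_energy_reals (c m al K N nb ga F T f W g w a e i1 i2 i3 b : R) :
  0 <= c -> 0 < m -> 0 <= K -> 0 < al -> 0 <= w -> 0 <= a -> 0 <= W -> 0 <= g ->
  w <= c * W -> a <= c * g -> f <= F * g -> nb * g ^+ 2 <= i1 ->
  - b <= i2 + (4 * m)^-1 * w ^+ 2 + 2^-1 * (K * (w * a)) ->
  - (N * (W * g)) <= i3 -> T + 0 + i1 + ga * e + i2 = f - b - i3 ->
  T + nb * g ^+ 2 + ga * e <= F * g + al / 4 * g ^+ 2 +
  (c ^+ 2 / (4 * m) + c ^+ 4 * K ^+ 2 / (4 * al)) * W ^+ 2 + N * (W * g).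
Proof.
move=> c0 m0 K0 al0 w0 a0 W0 g0 wW ag fF A1 A2 A3 eqn.
have m4 : 0 <= (4 * m)^-1 by rewrite invr_ge0 mulr_ge0 ?ltW.
have B1 : (4 * m)^-1 * w ^+ 2 <= (4 * m)^-1 * (c * W) ^+ 2.
  by rewrite ler_wpM2l// ler_sqr ?nnegrE ?(le_trans w0 wW).
have E1 : (4 * m)^-1 * (c * W) ^+ 2 = c ^+ 2 / (4 * m) * W ^+ 2.
  by field; rewrite gt_eqF.
have B3 : K * (w * a) <= K * (c * W * (c * g)) by rewrite ler_wpM2l// ler_pM.
have : 0 <= (al * g - c ^+ 2 * K * W) ^+ 2 / (4 * al).
  by rewrite divr_ge0 ?sqr_ge0// mulr_ge0// ltW.
have -> : (al * g - c ^+ 2 * K * W) ^+ 2 / (4 * al) =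
  al / 4 * g ^+ 2 + c ^+ 4 * K ^+ 2 / (4 * al) * W ^+ 2 - 2^-1 * (K * (c * W * (c * g))).
  by field; rewrite gt_eqF.
rewrite E1 in B1; lra.
Qed.

Lemma step_energy (c : R) (a w uf um : E -> E) (NB NF NT : E -> R)
    (K N nb m ga F al T f : R) :
  0 <= c -> (forall v, H10v D v -> norm2 D v <= c * norm2 D (grad D v)) ->
  0 < m -> 0 <= N -> 0 <= K -> 0 < al ->
  H10v D a -> H10v D w -> bounded_field D uf ->
  ess_bounded D NB -> {ae leb d, forall x, D x -> nb <= NB x} ->
  ae_bounded D N NF -> ess_bounded D NT ->
  (forall x, D x -> m * dotm (uf x) (uf x) <= NT x) ->
  ae_bounded D K (div D uf) ->
  f <= F * norm2 D (grad D a) ->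
  T + bstar D um a a + ip D (fun x => NB x *: grad D a x) (grad D a)
    + ga * sip D (div D a) (div D a)
    + ip D (fun x => NT x *: grad D a x) (grad D a) =
  f - bstar D uf w a - ip D (fun x => NF x *: grad D w x) (grad D a) ->
  T + nb * norm2 D (grad D a) ^+ 2 + ga * snorm D (div D a) ^+ 2 <=
  F * norm2 D (grad D a) + al / 4 * norm2 D (grad D a) ^+ 2 +
  (c ^+ 2 / (4 * m) + c ^+ 4 * K ^+ 2 / (4 * al)) * norm2 D (grad D w) ^+ 2 +
  N * (norm2 D (grad D w) * norm2 D (grad D a)).
Proof.
move=> c0 poin m0 N0 K0 al0 Za Zw Buf bNB nbNB bNF bNT mNT bK fF eqn.
have Ha := H10v_H1v Za; have Hw := H10v_H1v Zw.
have Lga := grad_L2m Ha; have Lgw := grad_L2m Hw.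
have A1 := ip_lower bD bNB Lga nbNB.
have A2 := convection_bound bD Buf Zw Za m0 bNT mNT K0 bK.
have A3 := ip_bmul_le bD N0 bNF Lgw Lga.
move/lerNnormlW: A3 => A3.
rewrite bstar_skew -snorm_sqr in eqn.
exact: (step_energy_reals c0 m0 K0 al0 (norm2_ge0 _) (norm2_ge0 _)
  (norm2_ge0 _) (norm2_ge0 _) (poin _ Zw) (poin _ Za) fF A1 A2 A3 eqn).
Qed.

End step_energy.

(** * Data of the scheme *)
Section scheme_data.
Context {R : realType} {d : nat}.
Local Notation E := 'rV[R]_d.
Implicit Types (D : set E) (fe : fe_data R d).

Lemma Hm1_le D (F : (E -> E) -> R) v : Hm1 D F -> H10v D v ->
  F v <= Hm1_norm D F * norm2 D (grad D v).
Proof.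
move=> [_ [c Fc]] Zv.
have n0 := norm2_ge0 (D := D) (grad D v).
have [nv|nv] := eqVneq (norm2 D (grad D v)) 0.
  have := Fc v Zv; rewrite nv !mulr0 => /le_trans-/(_ _ (lexx 0)).
  by rewrite normr_le0 => /eqP ->.
have nv0 : 0 < norm2 D (grad D v) by rewrite lt0r nv.
rewrite -ler_pdivrMr//; apply: ub_le_sup; last by exists v.
exists `|c| => _ [w Zw <-].
have m0 := norm2_ge0 (D := D) (grad D w).
have [->|nw] := eqVneq (norm2 D (grad D w)) 0; first by rewrite invr0 mulr0.
have nw0 : 0 < norm2 D (grad D w) by rewrite lt0r nw.
rewrite ler_pdivrMr// (le_trans (ler_norm _))// (le_trans (Fc w Zw))//.
by rewrite ler_wpM2r// ler_norm.
Qed.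

Lemma finite_span_lin (V : set (E -> E)) (a : R) u v : finite_span V ->
  V u -> V v -> V (a *: u + v).
Proof.
move=> [m [b ->]] [p ->] [q ->] /=; exists (fun k => a * p k + q k).
by rewrite scaler_sumr -big_split; apply: eq_bigr => k _; rewrite scalerA scalerDl.
Qed.

Lemma finite_span_sum (V : set (E -> E)) (I : Type) (r : seq I) (F : I -> E -> E) :
  finite_span V -> (forall i, V (F i)) -> V (\sum_(i <- r) F i).
Proof.
move=> fV VF; elim: r => [|i r IH].
  rewrite big_nil; have [m [b ->]] := fV; exists (fun=> 0).
  by rewrite big1// => k _; rewrite scale0r.
by rewrite big_cons -[F i]scale1r; exact: finite_span_lin.
Qed.

Lemma finite_span_extrap (V : set (E -> E)) (u : nat -> E -> E) n :
  finite_span V -> V (u n) -> V (u n.-1) -> V (extrap u n).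
Proof.
move=> fV Vn Vn1; rewrite /extrap; apply: (finite_span_lin 2 fV Vn).
have := finite_span_lin (-1) fV Vn1 (finite_span_lin (-1) fV Vn1 Vn1).
by rewrite scaleN1r addNr addr0.
Qed.

Lemma finite_span_fluct (V : set (E -> E)) (J : nat) (u : 'I_J -> nat -> E -> E) j n :
  finite_span V -> (forall j, V (extrap (u j) n)) -> V (u_fluct u j n).
Proof.
move=> fV Vu; rewrite /u_fluct /u_mean addrC -scaleNr.
by apply: finite_span_lin => //; exact: finite_span_sum.
Qed.

Section coefficients.
Context {D : set E} {J : nat} (nu : 'I_J -> E -> R).
Hypothesis bnu : forall j, ess_bounded D (nu j).

Lemma nu_bar_ess_bounded : ess_bounded D (nu_bar nu).
Proof.
apply: ess_boundedM; first exact: ess_bounded_cst.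
by apply: ess_bounded_sum => j; exact: bnu.
Qed.

Lemma nu_fluct_ess_bounded j : ess_bounded D (nu_fluct nu j).
Proof.
rewrite (_ : nu_fluct nu j = fun x => nu j x + (-1) * nu_bar nu x); last first.
  by apply/funext => x; rewrite mulN1r.
apply: ess_boundedD => //; apply: ess_boundedM; first exact: ess_bounded_cst.
exact: nu_bar_ess_bounded.
Qed.

Lemma alpha_min_le j : alpha_min D nu <= alpha D nu j.
Proof.
apply: ge_inf; last by exists j.
exists (- \sum_i `|alpha D nu i|) => _ [i _ <-].
rewrite lerNl (bigD1 i)//= (le_trans (ler_norm _))// normrN lerDl.
by rewrite sumr_ge0.
Qed.

Lemma alpha_min_gt0 : (0 < J)%N -> (forall j, 0 < alpha D nu j) -> 0 < alpha_min D nu.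
Proof.
move=> J0 a0; pose j0 := Ordinal J0.
have [i _ imin] := @Order.TotalTheory.arg_minP _ _ _ j0 xpredT (alpha D nu) isT.
apply: (lt_le_trans (a0 i)); apply: lb_le_inf; first by exists (alpha D nu j0), j0.
by move=> _ [j _ <-]; exact: imin.
Qed.

End coefficients.

Section eddy_viscosity.
Context {D : set E} {J : nat} (u : 'I_J -> nat -> E -> E).
Hypothesis bD : bounded_open D.

Lemma nu_T_ess_bounded mu dt n : (forall j, bounded_field D (u_fluct u j n)) ->
  ess_bounded D (nu_T mu dt u n).
Proof.
move=> bu; apply: ess_boundedM; first exact: ess_bounded_cst.
apply: ess_bounded_sum => j; have [_ b _] := bu j.
rewrite (_ : (fun _ => _) = fun x => \sum_k component (u_fluct u j n) k x * component (u_fluct u j n) k x).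
  by apply: ess_bounded_sum => k; exact: ess_boundedM.
by apply/funext => x; rewrite enorm_sqr dotm_row.
Qed.

Lemma le_nu_T mu dt n j x : 0 <= mu * dt ->
  mu * dt * dotm (u_fluct u j n x) (u_fluct u j n x) <= nu_T mu dt u n x.
Proof.
move=> m0; rewrite /nu_T ler_wpM2l// (bigD1 j)//= enorm_sqr lerDl.
by rewrite sumr_ge0// => i _; exact: sqr_ge0.
Qed.

Lemma D_infty_ge0 M : 0 <= D_infty D M u.
Proof. exact: bigmax_ge_id. Qed.

Lemma D_infty_ae_bounded M n j : (0 < n <= M)%N ->
  bounded_field D (u_fluct u j n) ->
  ae_bounded D (D_infty D M u) (div D (u_fluct u j n)).
Proof.
move=> nM bu; have [mdiv b] := ess_bounded_Linfty_norm (div_ess_bounded bu).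
split => //; apply: filterS b => x /= H /H/le_trans; apply.
refine (le_trans _ (le_bigmax _ _ j)).
have nr : n \in index_iota 1 M.+1 by rewrite mem_index_iota ltnS.
exact: (le_bigmax_seq (r := index_iota 1 M.+1) (0 : R) n xpredT
  (fun n => Linfty_norm D (div D (u_fluct u j n))) nr isT).
Qed.

End eddy_viscosity.

Lemma conforming_bounded_field D fe v : bounded_open D -> conforming_fe D fe ->
  fe_X fe v -> bounded_field D v.
Proof.
move=> bD [mT _ [pX _ _] [XH _ _ _]] Xv; have Zv := XH v Xv.
have H i := piecewise_C1_bounded bD mT (pX v i Xv) (Zv i).1.
by split => // i; [exact: (H i).1|exact: (H i).2].
Qed.

End scheme_data.
(** * The stability estimate *)
(** The estimate when no step is performed: M = 1. *)
Lemma one_level_bound (R : realType) (dt ze nu p q r s : R) :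
  0 <= dt -> 0 <= nu -> ze <= 2 * nu -> 0 <= p -> 0 <= q -> 0 <= r -> 0 <= s ->
  r + ze * dt * p <= 6 * r + 2 * s + 2 * nu * dt * (q + p).
Proof.
move=> dt0 nu0 zenu p0 q0 r0 s0.
have H1 : 0 <= (2 * nu - ze) * (dt * p) by rewrite mulr_ge0 ?subr_ge0 ?mulr_ge0.
have H2 : 0 <= 2 * nu * (dt * q) by rewrite !mulr_ge0.
lra.
Qed.

Theorem theorem4p2 (R : realType) (d : nat) (hd : d = 2%N \/ d = 3%N)
    (P : halfspaces R d) (hP : polytope P)
    (I : Type) (fem : I -> fe_data R d) (beta : R) (hbeta : 0 < beta)
    (hfem : fe_family (opoly P) fem beta) :
  let D := opoly P in
  exists C : R, 0 < C /\
  forall (i : I) (J : nat) (hJ : (0 < J)%N)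
    (nu : 'I_J -> 'rV[R]_d -> R) (nu_min : 'I_J -> R)
    (hnu : forall j, Linfty D (nu j))
    (hnu_min : forall j, 0 < nu_min j /\
       \forall x \ae leb d, D x -> nu_min j <= nu j x)
    (halpha : forall j, 0 < alpha D nu j)
    (T : R) (hT : 0 < T)
    (f : 'I_J -> R -> ('rV[R]_d -> 'rV[R]_d) -> R)
    (hf : forall j, L2_Hm1 D T (f j))
    (u0 u1 : 'I_J -> 'rV[R]_d -> 'rV[R]_d)
    (hu0 : forall j, L2v D (u0 j)) (hu1 : forall j, L2v D (u1 j))
    (gamma mu dt : R) (hgamma : 0 < gamma) (hmu : 0 < mu) (hdt : 0 < dt)
    (M : nat) (hM : M%:R * dt = T)
    (uhat util : 'I_J -> nat -> 'rV[R]_d -> 'rV[R]_d)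
    (phat : 'I_J -> nat -> 'rV[R]_d -> R)
    (hscheme : bdf2_eev_spp D (fem i) nu f u0 u1 gamma mu dt M uhat util phat)
    (huhat : forall j, H1v D (uhat j 0%N) /\ H1v D (uhat j 1%N))
    (hzeta : 0 < zeta D nu C mu dt M uhat)
    (halphaD : C * D_infty D M uhat < alpha_min D nu)
    (hmuC : C * alpha_min D nu
              / (dt * (alpha_min D nu ^+ 2 - C * D_infty D M uhat ^+ 2)) < mu),
  forall j : 'I_J,
    norm2 D (uhat j M) ^+ 2
      + zeta D nu C mu dt M uhat * dt *
          \sum_(1 <= n < M.+1) norm2 D (grad D (uhat j n)) ^+ 2
      + dt * gamma * \sum_(2 <= n < M.+1) snorm D (div D (uhat j n)) ^+ 2
    <= 6 * norm2 D (uhat j 1%N) ^+ 2 + 2 * norm2 D (uhat j 0%N) ^+ 2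
      + 2 * nu_bar_min D nu * dt *
          (norm2 D (grad D (uhat j 0%N)) ^+ 2
             + norm2 D (grad D (uhat j 1%N)) ^+ 2)
      + 4 * dt / alpha_min D nu *
          \sum_(2 <= n < M.+1) Hm1_norm D (f j (n%:R * dt)) ^+ 2.
Proof.
move=> D.
have bD : bounded_open D := polytope_bounded hP.
have [L L0 DL] : exists2 L : R, 0 <= L & forall x, D x -> forall i, `|x ord0 i| <= L.
  have [_ [L DL]] := bD; exists `|L| => // x Dx i.
  exact: le_trans (DL x Dx i) (ler_norm L).
have d0 : (0 < d)%N by case: hd => ->.
pose c := 2 * L; have c0 : 0 <= c by rewrite mulr_ge0.
have poin v := poincare_vec bD d0 L0 DL (v := v).
(* Chosen so that C / (mu dt) + C D_infty^2 / alpha_min >= 20 B below. *)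
pose C := 1 + 5 * c ^+ 2 + 5 * c ^+ 4.
have c2 : 0 <= c ^+ 2 by exact: exprn_ge0.
have c4 : 0 <= c ^+ 4 by exact: exprn_ge0.
exists C; split; first by rewrite /C; lra.
move=> i J hJ nu nu_min hnu hnu_min halpha T hT f hf u0 u1 hu0 hu1 gamma mu dt
  hgamma hmu hdt M hM uhat util phat hscheme huhat hzeta _ _ j.
have conf : conforming_fe D (fem i) by case: hfem.
have [_ [spX spY _] _ [_ YD _ XY]] := conf.
have XH v : fe_X (fem i) v -> bounded_field D v by exact: conforming_bounded_field.
have al0 := alpha_min_gt0 hJ halpha.
have alj := alpha_min_le nu j (D := D).
set al := alpha_min D nu in al0 alj *.
have bnu k : ess_bounded D (nu k) by exact: Linfty_ess_bounded.
have bNF := nu_fluct_ess_bounded bnu j.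
pose N := Linfty_norm D (nu_fluct nu j).
have N0 : 0 <= N := Linfty_norm_ge0 _.
have K0 := D_infty_ge0 uhat M (D := D).
set K := D_infty D M uhat in K0 *.
have m0 : 0 < mu * dt by exact: mulr_gt0.
pose B := c ^+ 2 / (4 * (mu * dt)) + c ^+ 4 * K ^+ 2 / (4 * al).
have nubar : al + 3 * N <= nu_bar_min D nu by rewrite -lerBrDr.
have nu0 : 0 < nu_bar_min D nu.
  by apply: lt_le_trans nubar; rewrite ltr_wpDr// mulr_ge0.
have B0 : 0 <= B by rewrite addr_ge0// divr_ge0 ?mulr_ge0 ?sqr_ge0// ltW.
have [h0 hproj hs1 hs2] := hscheme.
set ze := zeta D nu C mu dt M uhat in hzeta *.
have zeB : ze <= al / 2 - 20 * B.
  have q0 : 0 <= (mu * dt)^-1 by rewrite invr_ge0 ltW.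
  have r0 : 0 <= al^-1 * K ^+ 2 by rewrite mulr_ge0 ?sqr_ge0// invr_ge0 ltW.
  have -> : ze = al / 2 - C * (mu * dt)^-1 - C * (al^-1 * K ^+ 2).
    by rewrite /ze /zeta (mulrA C al^-1).
  have -> : 20 * B = 5 * c ^+ 2 * (mu * dt)^-1 + 5 * c ^+ 4 * (al^-1 * K ^+ 2).
    by rewrite /B; field; rewrite !gt_eqF.
  have H1 : 0 <= (1 + 5 * c ^+ 4) * (mu * dt)^-1 by rewrite mulr_ge0// addr_ge0// mulr_ge0.
  have H2 : 0 <= (1 + 5 * c ^+ 2) * (al^-1 * K ^+ 2) by rewrite mulr_ge0// addr_ge0// mulr_ge0.
  rewrite /C; lra.
have Xu k n : (n <= M)%N -> fe_X (fem i) (uhat k n).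
  case: n => [|[|n]] nM; first by case: (hproj k) => [[[]]].
    by case: (hproj k) => [_ [[]]].
  by have [] := hs1 k n.+1 nM.
have Yu n : (n <= M)%N -> fe_Y (fem i) (util j n).
  have [t0 t1] := h0 j; case: n => [|[|n]] nM.
  - by rewrite t0; apply: XY; exact: Xu.
  - by rewrite t1; apply: XY; exact: Xu.
  - by have [] := hs2 j n.+1 nM.
have divu n q : (n <= M)%N -> fe_Q (fem i) q -> sip D (div D (util j n)) q = 0.
  have [t0 t1] := h0 j; case: n => [|[|n]] nM Qq.
  - by rewrite t0; case: (hproj j) => [[[_ +]]] => /(_ q Qq).
  - by rewrite t1; case: (hproj j) => [_ [[_ +]]] => /(_ q Qq).
  - by have [_ _ _] := hs2 j n.+1 nM; exact.
have Lhat k n : (n <= M)%N -> L2m D (uhat k n).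
  by move=> nM; have [Zu _ _] := XH _ (Xu k n nM); exact: H1v_L2m (H10v_H1v Zu).
have Ltil n : (n <= M)%N -> L2m D (util j n).
  by move=> nM; have [Hu _] := YD _ (Yu n nM); exact: H1v_L2m.
have orth n k : (1 <= n < M)%N -> (k <= M)%N ->
    ip D (util j n.+1 - uhat j n.+1) (util j k) = 0.
  move=> nM kM; have [_ Qp H _] := hs2 j n nM.
  have := H _ (Yu k kM); rewrite sipC divu// subr0 => /eqP.
  rewrite mulf_eq0 => /orP[|/eqP//].
  by rewrite mulf_eq0 invr_eq0 mulf_eq0 !pnatr_eq0 (gt_eqF hdt).
have M0 : (0 < M)%N.
  by case: (M) hM hT => // <-; rewrite mul0r ltxx.
have [t0 t1] := h0 j.
have Ginit : 5 / 9 * bdf2_energy (D := D) (util j 1%N) (util j 0%N) <=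
    6 * norm2 D (uhat j 1%N) ^+ 2 + 2 * norm2 D (uhat j 0%N) ^+ 2.
  by rewrite t0 t1; apply: bdf2_energy_initial => //; exact: Lhat.
case: M => [//|[|m]] in hM hscheme hs1 hs2 Xu Yu divu Lhat Ltil orth M0 K K0 B B0 ze hzeta zeB *.
  rewrite big_nat1 !big_geq// !mulr0 !addr0.
  apply: one_level_bound; rewrite ?sqr_ge0 ?(ltW hdt) ?(ltW nu0)//.
  have := ltW hzeta; have := ltW al0; lra.
have step n : (1 <= n < m.+2)%N ->
  (2 * dt)^-1 * ip D (3 *: uhat j n.+1 - 4 *: util j n + util j n.-1) (uhat j n.+1) +
  nu_bar_min D nu * norm2 D (grad D (uhat j n.+1)) ^+ 2 +
  gamma * snorm D (div D (uhat j n.+1)) ^+ 2 <=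
  Hm1_norm D (f j (n.+1%:R * dt)) * norm2 D (grad D (uhat j n.+1)) +
  al / 4 * norm2 D (grad D (uhat j n.+1)) ^+ 2 +
  B * norm2 D (grad D (extrap (uhat j) n)) ^+ 2 +
  N * (norm2 D (grad D (extrap (uhat j) n)) * norm2 D (grad D (uhat j n.+1))).
  move=> nM; have /andP[n1 nM'] := nM.
  have [Xn eqn] := hs1 j n nM.
  have [Za _ _] := XH _ Xn.
  have Xe k : fe_X (fem i) (extrap (uhat k) n).
    apply: finite_span_extrap => //; apply: Xu; first exact: ltnW.
    exact: leq_trans (leq_pred _) (ltnW nM').
  have Xf k : bounded_field D (u_fluct uhat k n).
    by apply: XH; exact: finite_span_fluct.
  have [Zw _ _] := XH _ (Xe j).
  have fF : f j (n.+1%:R * dt) (uhat j n.+1) <=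
      Hm1_norm D (f j (n.+1%:R * dt)) * norm2 D (grad D (uhat j n.+1)).
    apply: Hm1_le Za; have [hfj _ _] := hf j; apply: hfj.
    have n0 : 0 <= n.+1%:R * dt by rewrite mulr_ge0 ?ler0n ?(ltW hdt).
    by rewrite n0 /= -hM (ler_pM2r hdt) ler_nat.
  have n1M : (0 < n <= m.+2)%N by rewrite n1 ltnW.
  exact: (step_energy bD c0 poin m0 N0 K0 al0 Za Zw (Xf j)
    (nu_bar_ess_bounded bnu) (ess_inf_on_ae nu0) (ess_bounded_Linfty_norm bNF)
    (nu_T_ess_bounded mu dt Xf)
    (fun x _ => le_nu_T uhat n j x (ltW m0))
    (D_infty_ae_bounded n1M (Xf j)) fF (eqn _ Xn)).
have := @bdf2_sum R m (norm2 D (uhat j m.+2) ^+ 2)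
  (fun n => ip D (3 *: uhat j n.+1 - 4 *: util j n + util j n.-1) (uhat j n.+1))
  (fun n => bdf2_energy (D := D) (util j n) (util j n.-1))
  (fun n => norm2 D (grad D (uhat j n)))
  (fun n => norm2 D (grad D (extrap (uhat j) n)))
  (fun n => snorm D (div D (uhat j n)) ^+ 2)
  (fun n => Hm1_norm D (f j (n%:R * dt)))
  dt gamma (nu_bar_min D nu) N al B ze hdt (ltW hgamma) al0 N0 B0 nubar zeB hzeta
  (fun n => norm2_ge0 _) (fun n => sqr_ge0 _) (fun n => norm2_ge0 _) _ step _ _.
move=> H; refine (le_trans (H _ _ _) _) => {H}.
- move=> n /andP[n1 nM]; apply: (norm2_grad_extrap bD).
    by have [Zu _ _] := XH _ (Xu j n (ltnW nM)); exact: H10v_H1v.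
  have [Zu _ _] := XH _ (Xu j n.-1 (leq_trans (leq_pred _) (ltnW nM))).
  exact: H10v_H1v.
- move=> n /andP[n1 nM].
  have nM2 : (n < m.+2)%N := ltnW nM.
  have nM3 : (n.-1 <= m.+2)%N := leq_trans (leq_pred _) (ltnW nM2).
  have n12 : (1 <= n < m.+2)%N by rewrite n1.
  apply: (bdf2_energy_step bD).
  + exact: Lhat.
  + exact: Ltil.
  + exact: Ltil (ltnW nM2).
  + exact: Ltil nM3.
  + exact: orth n12 nM2.
  + exact: orth n12 (ltnW nM2).
  + exact: orth n12 nM3.
- apply: (bdf2_last_step bD).
  + exact: Lhat.
  + exact: Ltil.
  + exact: Ltil (ltnW (leqnSn m.+1)).
by rewrite !lerD2r.
Qed.
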